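(* Let $1<p<\infty$ and let $f\in h^p(\mathbb{D})$. Then for every $s\in[0,2\pi]$, $$\int_{-1}^{1}|f(re^{is})|^p\,dr\leq \frac{1}{2\cos^p\frac{\pi}{2p}}\int_{0}^{2\pi}|f(e^{i\theta})|^p\,d\theta .$$
   Context: $\mathbb{D}$ denotes the open unit disk in the complex plane. For $0<p<\infty$ and a (complex-valued) harmonic function $f$ on $\mathbb{D}$, the integral means are $M_p(r,f)=\left(\frac{1}{2\pi}\int_0^{2\pi}|f(re^{i\theta})|^p\,d\theta\right)^{1/p}$, $0<r<1$. The harmonic Hardy space $h^p(\mathbb{D})$ is the space of all harmonic functions $f$ on $\mathbb{D}$ for which $M_p(r,f)$ is bounded for $0<r<1$. For $f\in h^p(\mathbb{D})$ with $1<p<\infty$, $f(e^{i\theta})$ denotes the radial limit $\lim_{r\to1^-}f(re^{i\theta})$, which exists for almost every $\theta$. *)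

(* Defs.v *)
From HB Require Import structures.
From mathcomp Require Import all_boot all_order all_algebra.
From mathcomp Require Import complex.
From mathcomp Require Import all_classical all_reals all_analysis.
Import Order.TTheory GRing.Theory Num.Theory numFieldNormedType.Exports.

Set Implicit Arguments.
Unset Strict Implicit.
Unset Printing Implicit Defensive.

Local Open Scope classical_set_scope.
Local Open Scope ring_scope.
Local Open Scope complex_scope.

Definition unit_disk (R : realType) : set R[i] := [set z | `|z| < 1].

Definition expi (R : realType) (t : R) : R[i] := cos t +i* sin t.

(* [R[i]] carries no normed-module structure over [R], so the real partial
   derivatives are those of real-valued functions of (x, y) : R * R. *)
Definition axis (R : realType) (b : bool) : R * R :=
  if b then (0, 1) else (1, 0).

Definition laplacian (R : realType) (u : R * R -> R) (q : R * R) : R :=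
  'D_(axis R false) ('D_(axis R false) u) q +
  'D_(axis R true) ('D_(axis R true) u) q.

(* C^2 on the open set [D]: all partial derivatives of order at most 2 exist and
   are continuous at each point of [D]; the values of [u] off [D] are irrelevant. *)
Definition C2_on (R : realType) (D : set (R * R)) (u : R * R -> R) : Prop :=
  forall q : R * R, D q ->
  [/\ {for q, continuous u},
      forall b, derivable u q (axis R b) /\
                {for q, continuous ('D_(axis R b) u)} &
      forall b c, derivable ('D_(axis R b) u) q (axis R c) /\
                  {for q, continuous ('D_(axis R c) ('D_(axis R b) u))}].

Definition real_harmonic (R : realType) (D : set (R * R)) (u : R * R -> R) : Prop :=
  C2_on D u /\ forall q : R * R, D q -> laplacian u q = 0.

Definition harmonic_on (R : realType) (D : set R[i]) (f : R[i] -> R[i]) : Prop :=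
  let D2 := [set q : R * R | D (q.1 +i* q.2)] in
  real_harmonic D2 (fun q => complex.Re (f (q.1 +i* q.2))) /\
  real_harmonic D2 (fun q => complex.Im (f (q.1 +i* q.2))).

Definition integral_mean (R : realType) (p : R) (f : R[i] -> R[i]) (r : R) : \bar R :=
  (((2 * pi)^-1%:E *
    \int[lebesgue_measure]_(t in `[0%R, (2 * pi)%R])
      (Normc.normc (f (r%:C * expi t)) `^ p)%:E) `^ p^-1)%E.

Definition hardy_harmonic (R : realType) (p : R) (f : R[i] -> R[i]) : Prop :=
  harmonic_on (@unit_disk R) f /\
  exists M : R, forall r : R, 0 < r < 1 -> (integral_mean p f r <= M%:E)%E.

(* [lim] is total: where the radial limit does not exist it returns an
   unspecified value. *)
Definition radial_limit (R : realType) (f : R[i] -> R[i]) (t : R) : R[i] :=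
  lim ((f (r%:C * expi t) : R[i]^o) @[r --> (1 : R)^'-]).

(* Main.v *)
(* Writing [c = 1 / p], the inequality is a Schur test for the Poisson kernel with the weight
   [|sin (t - s)|^(-c)] on the circle.  Two estimates are needed, and both come from the
   Poisson formula for [Re (1 - w z^2)^e], whose boundary values dominate
   [cos (c pi / 2) |2 sin (t - s)|^e] when [|e| = c], because [1 - w z^2] stays in the right
   half plane.  With [e = - c] one gets
     [\int P_r(t - s) |sin (t - s)|^(-c) dt <= 2 pi 2^c (1 - r^2)^(-c) / cos (c pi / 2)],
   and with [e = c], after the substitution [r = tan (pi / 4 - x / 2)],
     [\int_(-1)^1 (1 - r^2)^c / (1 - 2 r cos th + r^2) dr
        <= pi / (2 |sin th|) (2 |sin th|)^c / cos (c pi / 2)].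
   Hoelder's inequality and Tonelli's theorem then give the bound for Poisson integrals of
   integrable functions.  A function in [h^p] is such a Poisson integral: its restrictions to
   circles are uniformly integrable, so that they converge weakly along an ultrafilter, the
   limit being a density provided by the Radon-Nikodym theorem; this density is the radial
   limit at each of its Lebesgue points. *)

Require Import Defs.
From HB Require Import structures.
From mathcomp Require Import all_boot all_order all_algebra.
From mathcomp Require Import complex.
From mathcomp Require Import all_classical all_reals all_analysis.
From mathcomp Require Import measurable_realfun.
From mathcomp Require Import ring lra.
Import Order.TTheory GRing.Theory Num.Theory numFieldNormedType.Exports.

Local Open Scope classical_set_scope.
Local Open Scope ring_scope.
Local Open Scope complex_scope.

Set Implicit Arguments.
Unset Strict Implicit.
Unset Printing Implicit Defensive.

(** The weight is adapted to a diameter: [sin (t - s)] vanishes at both of its endpoints, whence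
    [z^2] rather than [z]. The exponent [c = 1 / p] makes the two estimates fit together. Hoelder's
    inequality raises the factor [(1 - r^2)^(-c)] of the first one to the power [p - 1], which gives
    [(1 - r^2)^(c - 1)]; the numerator [1 - r^2] of the Poisson kernel turns this into
    [(1 - r^2)^c], the numerator in the second one. The remaining sines, [|sin|^(1 - c)] and
    [|sin|^(c - 1)], cancel. The constant [2^c / cos (c pi / 2)] occurs to the power [p - 1] from
    Hoelder and once more from the radial integral, hence the [p]-th power of the cosine; since
    [2^(c p) = 2], the leftover factors [1 / (2 pi)] and [pi / 2] leave [1 / 2]. On the closed disk
    [(1 - w z^2)^e] has singular points when [|w| = 1]; the work is done with [|w| = rho < 1], and
    [rho] tends to 1 in the integrals. Harmonicity is used through second differences only, so that
    the Poisson formula needs just a maximum principle and a uniform bound on the discrete Laplacian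
    of the kernel. *)

Section continuous_for.
Context {R : realType} {T : topologicalType}.
Implicit Types (f g : T -> R) (x : T).

Lemma contD f g x : {for x, continuous f} -> {for x, continuous g} ->
  {for x, continuous (fun t => f t + g t)}.
Proof. exact: continuousD. Qed.

Lemma contN f x : {for x, continuous f} -> {for x, continuous (fun t => - f t)}.
Proof. exact: continuousN. Qed.

Lemma contM f g x : {for x, continuous f} -> {for x, continuous g} ->
  {for x, continuous (fun t => f t * g t)}.
Proof. exact: continuousM. Qed.

Lemma contX n f x : {for x, continuous f} -> {for x, continuous (fun t => f t ^+ n)}.
Proof.
move=> fx; apply: (@continuous_comp _ _ _ f (fun y : R => y ^+ n) x) => //.
exact: exprn_continuous.
Qed.

Lemma contV f x : f x != 0 -> {for x, continuous f} ->
  {for x, continuous (fun t => (f t)^-1)}.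
Proof. exact: continuousV. Qed.

Lemma contC (c : R) x : {for x, continuous (fun _ : T => c)}.
Proof. exact: cst_continuous. Qed.

Lemma cont_comp (h : R -> R) f x : {for f x, continuous h} -> {for x, continuous f} ->
  {for x, continuous (fun t => h (f t))}.
Proof. by move=> hf fx; exact: continuous_comp. Qed.

End continuous_for.
Arguments contD {R T f g x}.
Arguments contN {R T f x}.
Arguments contM {R T f g x}.
Arguments contX {R T n f x}.
Arguments contV {R T f x}.
Arguments contC {R T} c x.
Arguments cont_comp {R T h f x}.

Section continuous_plane.
Context {R : realType}.

Lemma cont_fst (q : R * R) : {for q, continuous (fun z : R * R => z.1)}.
Proof. exact: cvg_fst. Qed.

Lemma cont_snd (q : R * R) : {for q, continuous (fun z : R * R => z.2)}.
Proof. exact: cvg_snd. Qed.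

Lemma cont_pair (T : topologicalType) (f g : T -> R) x :
  {for x, continuous f} -> {for x, continuous g} ->
  {for x, continuous (fun t => (f t, g t))}.
Proof.
move=> cf cg; have : (fun t => (f t, g t)) @ x --> (f x, g x) by exact: (cvg_pair cf cg).
exact.
Qed.

End continuous_plane.
Arguments cont_pair {R T f g x}.
Arguments cont_fst {R} q.
Arguments cont_snd {R} q.

Section deriv1.
Context {R : realType}.
Implicit Types (f g : R -> R) (x a b : R).

Lemma derivD f g x a b : is_derive x (1 : R) f a -> is_derive x (1 : R) g b ->
  is_derive x (1 : R) (fun t => f t + g t) (a + b).
Proof. exact: is_deriveD. Qed.

Lemma derivN f x a : is_derive x (1 : R) f a ->
  is_derive x (1 : R) (fun t => - f t) (- a).
Proof. exact: is_deriveN. Qed.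

Lemma derivM f g x a b : is_derive x (1 : R) f a -> is_derive x (1 : R) g b ->
  is_derive x (1 : R) (fun t => f t * g t) (a * g x + f x * b).
Proof.
move=> fa gb; have := is_deriveM fa gb.
by rewrite /GRing.scale/= addrC [g x * a]mulrC.
Qed.

Lemma derivC (c x : R) : is_derive x (1 : R) (fun=> c) (0 : R).
Proof. exact: is_derive_cst. Qed.

Lemma derivI x : is_derive x (1 : R) (fun t => t) (1 : R).
Proof. exact: is_derive_id. Qed.

Lemma deriv_comp f g x a b : is_derive (g x) (1 : R) f a -> is_derive x (1 : R) g b ->
  is_derive x (1 : R) (fun t => f (g t)) (a * b).
Proof. exact: is_derive1_comp. Qed.

Lemma derivV f x a : f x != 0 -> is_derive x (1 : R) f a ->
  is_derive x (1 : R) (fun t => (f t)^-1) (- a / f x ^+ 2).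
Proof.
move=> fx fa; have := is_deriveV fx fa.
by rewrite /GRing.scale/= => H; apply: is_derive_eq H _; rewrite mulNr mulrC mulNr.
Qed.

Lemma derivX2 f x a : is_derive x (1 : R) f a ->
  is_derive x (1 : R) (fun t => f t ^+ 2) (2 * f x * a).
Proof.
move=> fa; have := derivM fa fa.
by move=> H; apply: is_derive_eq H _; ring.
Qed.

End deriv1.

(** * Second differences and the maximum principle *)

Section calculus.
Context {R : realType}.
Implicit Types (u v w : R * R -> R) (q : R * R) (h : R).

(** L'Hopital's rule, applied once, leads to the symmetric quotient [(df h - df (- h)) / (2 * h)].
    It cannot be applied again, [df] being differentiable at 0 only. *)
Lemma second_difference (f df : R -> R) (l : R) :
  (\forall t \near (0 : R), is_derive (t : R) (1 : R) f (df t)) ->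
  is_derive (0 : R) (1 : R) df l ->
  (f h + f (- h) - 2 * f 0) / h ^+ 2 @[h --> 0^'+] --> l.
Proof.
move=> fdf dfl.
have /nbhs_ballP[e /= e0 be] := fdf.
have fd (t : R) : `|t| < e -> is_derive t (1 : R) f (df t).
  by move=> te; apply: be; rewrite /ball/= sub0r normrN.
have fN (x : R) : x \in `]0, e[ -> is_derive (- x) (1 : R) f (df (- x)).
  by rewrite in_itv/= => /andP[x0 xe]; apply: fd; rewrite normrN gtr0_norm.
have cf : {for 0, continuous f}.
  have [] := fd 0; first by rewrite normr0.
  by move=> /derivable1_diffP/differentiable_continuous.
have cN (g : R -> R) : {for 0, continuous g} -> g (- x) @[x --> (0 : R)] --> g 0.
  move=> cg; rewrite -[X in _ --> g X]oppr0.
  by apply: (@continuous_comp _ _ _ -%R g 0); [exact: opp_continuous|rewrite oppr0].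
apply: (@lhopital_at_right _ (fun h => f h + f (- h) - 2 * f 0)
  (fun h => df h - df (- h)) (fun h => h ^+ 2) (fun h => 2 * h) 0 e l) => //.
- move=> x xe; have := xe; rewrite in_itv/= => /andP[x0 xe1].
  have dx : is_derive x (1 : R) f (df x) by apply: fd; rewrite gtr0_norm.
  have dc := deriv_comp (fN x xe) (derivN (derivI x)).
  by apply: is_derive_eq (derivD (derivD dx dc) (derivC (- (2 * f 0)) x)) _; ring.
- by move=> x xe; apply: is_derive_eq (derivX2 (derivI x)) _; rewrite mulr1.
- have E : f 0 + f 0 - 2 * f 0 = 0 by lra.
  rewrite -[X in _ --> X]E {E}.
  apply: cvg_at_right_filter; apply: cvgB; last exact: cvg_cst.
  by apply: cvgD; [exact: cf|exact: cN].
- apply: cvg_at_right_filter; rewrite -[X in _ --> X](expr0n R 2).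
  exact: exprn_continuous.
- by move=> x; rewrite in_itv/= => /andP[x0 _]; rewrite mulf_neq0// gt_eqF.
(* With Caratheodory's slope function [g] of [df] at 0, the symmetric quotient is the mean of [g h]
   and [g (- h)], and [g] is continuous at 0. *)
- have [g [gE cg gl]] := (is_derive1_caratheodory df 0 l).1 dfl.
  have : (g h + g (- h)) / 2 @[h --> (0 : R)] --> (g 0 + g 0) / 2.
    by apply: cvgMl; apply: cvgD; [exact: cg|exact: cN].
  have -> : (g 0 + g 0) / 2 = l by rewrite gl; field.
  move=> /cvg_at_right_filter; apply: cvg_trans; apply: near_eq_cvg; near=> h.
  have h0 : h != 0 by rewrite gt_eqF//; near: h; exact: nbhs_right_gt.
  have -> : df h - df (- h) = (df h - df 0) - (df (- h) - df 0) by lra.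
  by rewrite !gE !subr0; field.
Unshelve. all: by end_near. Qed.

Definition dlap u q h : R :=
  u (q.1 + h, q.2) + u (q.1 - h, q.2) + u (q.1, q.2 + h) + u (q.1, q.2 - h)
  - 4 * u q.

(* A notion of harmonicity that requires no differentiation of parametrized
   integrals. *)
Definition dharm u q := (fun h => dlap u q h / h ^+ 2) @ 0^'+ --> (0 : R).

Lemma dharmB u v q : dharm u q -> dharm v q -> dharm (fun z => u z - v z) q.
Proof.
rewrite /dharm => hu hv.
have : (fun h => dlap u q h / h ^+ 2 - dlap v q h / h ^+ 2) @ 0^'+ --> (0 : R).
  by rewrite -[X in _ --> X](subr0 0); exact: cvgB.
apply: cvg_trans; apply: near_eq_cvg; near=> h.
by rewrite -mulrBl /dlap/=; congr (_ / _); ring.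
Unshelve. all: by end_near. Qed.

Definition nsq q : R := q.1 ^+ 2 + q.2 ^+ 2.

Lemma continuous_nsq q : {for q, continuous nsq}.
Proof. exact: (contD (contX (cont_fst q)) (contX (cont_snd q))). Qed.

Lemma compact_disk (r : R) : compact [set q | nsq q <= r].
Proof.
apply: (@subclosed_compact _ _ (`[- (1 + r), 1 + r] `*` `[- (1 + r), 1 + r])).
- apply: (@preimage_closed _ _ nsq _ _ (@closed_le _ r)) => x _.
  exact: continuous_nsq.
- by apply: compact_setX; exact: segment_compact.
- move=> [x y]; rewrite /nsq/= => xy; split; rewrite /= in_itv/=; apply/andP; split; nra.
Qed.

(* The hypothesis [bdry] replaces continuity up to the boundary. *)
Lemma max_principle u :
  (forall q, nsq q < 1 -> {for q, continuous u}) ->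
  (forall q, nsq q < 1 -> dharm u q) ->
  (forall e, 0 < e -> exists2 r : R, r < 1 & forall q, r <= nsq q < 1 -> u q <= e) ->
  forall q, nsq q < 1 -> u q <= 0.
Proof.
move=> cu hu bdry q0 q01; rewrite leNgt; apply/negP => uq0.
(* With a third of [u q0], the function [U] below is at most [2 * e] where [r <= nsq q], hence
   smaller than [u q0 = 3 * e]: its maximum is attained in the interior. *)
pose e := u q0 / 3.
have e0 : 0 < e by rewrite divr_gt0.
have [r r1 ur] := bdry e e0.
have nq0 : 0 <= nsq q0 by rewrite addr_ge0// sqr_ge0.
have q0r : nsq q0 < r.
  rewrite ltNge; apply/negP => rq; have := ur q0; rewrite rq q01 => /(_ isT).
  by rewrite /e; lra.
(* The discrete Laplacian of [nsq] is exactly [4 * h ^+ 2]. At a maximum of [U] this forces [dlap u]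
   below [- (4 * e * h ^+ 2)], which contradicts [dharm u]. *)
pose U z := u z + e * nsq z.
have [] := @compact_EVT_max _ _ U [set q | nsq q <= r].
- by exists q0; exact: ltW.
- exact: compact_disk.
- apply: continuous_in_subspaceT => q; rewrite inE/= => qr.
  have cU : {for q, continuous u} by apply: cu; exact: le_lt_trans r1.
  exact: (contD cU (contM (contC e _) (@continuous_nsq q))).
move=> q1; rewrite inE/= => q1r q1max.
have q1q0 : U q0 <= U q1 by apply: q1max; rewrite inE/= ltW.
have {}q1r : nsq q1 < r.
  rewrite lt_neqAle q1r andbT; apply/eqP => q1E.
  have := ur q1; rewrite q1E lexx r1 => /(_ isT).
  by move: q1q0; rewrite /U q1E /e; nra.
have Umax q : nsq q < 1 -> U q <= U q1.
  move=> q1'; have [qr|rq] := leP (nsq q) r; first by apply: q1max; rewrite inE.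
  have := ur q; rewrite (ltW rq) q1' => /(_ isT).
  by move: q1q0; rewrite /U /e; nra.
have := hu q1 (lt_trans q1r r1) => /cvgrPdist_lt /(_ e e0) hn.
near (0 : R)^'+ => h.
have h0 : 0 < h by near: h; exact: nbhs_right_gt.
have : `|0 - dlap u q1 h / h ^+ 2| < e by near: h.
have shift (a b : R) : `|a| <= h -> `|b| <= h -> nsq (q1.1 + a, q1.2 + b) < 1.
  move=> ah bh.
  have hs : h < (1 - r) / 8 by near: h; apply: nbhs_right_lt; lra.
  have : `|q1.1| <= 1 /\ `|q1.2| <= 1.
    have := q1r; rewrite /nsq => q1r'.
    by split; rewrite -(@ler_pXn2r _ 2)// ?nnegrE// expr1n real_normK ?num_real//; nra.
  have := q1r; move: ah bh; rewrite /nsq/= !ler_norml => /andP[? ?] /andP[? ?] ? [/andP[? ?] /andP[? ?]].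
  nra.
have hh : `|h| <= h by rewrite gtr0_norm.
have hh' : `|-h| <= h by rewrite normrN gtr0_norm.
have z0 : `|0 : R| <= h by rewrite normr0 ltW.
have := Umax _ (shift h 0 hh z0); have := Umax _ (shift (- h) 0 hh' z0).
have := Umax _ (shift 0 h z0 hh); have := Umax _ (shift 0 (- h) z0 hh').
rewrite sub0r normrN /U /nsq/= !addr0 => H1 H2 H3 H4.
have : dlap u q1 h <= - (4 * e * h ^+ 2).
  by rewrite /dlap; case: (q1) H1 H2 H3 H4 => x y/= *; nra.
move=> H; rewrite ltr_norml => /andP[+ _].
rewrite ltr_pdivlMr ?exprn_gt0// => H5.
have : 0 < h ^+ 2 by rewrite exprn_gt0.
nra.
Unshelve. all: by end_near. Qed.
End calculus.

(** * The Poisson kernel and its total mass *)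

Section poisson_kernel.
Context {R : realType}.
Notation mu := (@lebesgue_measure R).
Implicit Types (q : R * R) (t h : R).

Definition den q t : R := (cos t - q.1) ^+ 2 + (sin t - q.2) ^+ 2.

Definition pk q t : R := (1 - nsq q) / den q t.

(** The square of [|e^{it} - q| >= 1 - |q| >= (1 - |q|^2) / 2], in a form without square roots:
    [1 + nsq q - den q t] is twice an inner product, bounded by Cauchy-Schwarz. *)
Lemma den_ge q t : nsq q < 1 -> (1 - nsq q) ^+ 2 / 4 <= den q t.
Proof.
move=> q1; have n0 : 0 <= nsq q by rewrite addr_ge0// sqr_ge0.
have D0 : 0 <= den q t by rewrite addr_ge0// sqr_ge0.
have cs := cos2Dsin2 t.
have H : (1 + nsq q - den q t) ^+ 2 <= 4 * nsq q.
  have -> : 1 + nsq q - den q t = 2 * (cos t * q.1 + sin t * q.2).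
    by have := cs; rewrite /den /nsq; lra.
  have -> : 4 * nsq q = (2 * (cos t * q.1 + sin t * q.2)) ^+ 2 +
                        (2 * (cos t * q.2 - sin t * q.1)) ^+ 2.
    by rewrite -[LHS]mulr1 -[X in _ * X]cs /nsq; ring.
  by rewrite lerDl sqr_ge0.
nra.
Qed.

Lemma den_gt0 q t : nsq q < 1 -> 0 < den q t.
Proof.
by move=> q1; apply: lt_le_trans (den_ge t q1); rewrite divr_gt0// exprn_gt0// subr_gt0.
Qed.

Lemma pk_ge0 q t : nsq q < 1 -> 0 <= pk q t.
Proof. by move=> q1; rewrite divr_ge0 ?subr_ge0 ?ltW// den_gt0. Qed.

Lemma continuous_den (z : (R * R) * R) :
  {for z, continuous (fun z : (R * R) * R => den z.1 z.2)}.
Proof.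
have c1 : {for z, continuous (fun z : (R * R) * R => z.1.1)}.
  by apply: (@continuous_comp _ _ _ fst fst z); [exact: cvg_fst|exact: cvg_fst].
have c2 : {for z, continuous (fun z : (R * R) * R => z.1.2)}.
  by apply: (@continuous_comp _ _ _ fst snd z); [exact: cvg_fst|exact: cvg_snd].
have c3 : {for z, continuous (fun z : (R * R) * R => z.2)} by exact: cvg_snd.
exact: (contD (contX (contD (cont_comp (@continuous_cos _ _) c3) (contN c1)))
  (contX (contD (cont_comp (@continuous_sin _ _) c3) (contN c2)))).
Qed.

Arguments continuous_den : clear implicits.

Lemma continuous_pk (z : (R * R) * R) : nsq z.1 < 1 ->
  {for z, continuous (fun z : (R * R) * R => pk z.1 z.2)}.
Proof.
move=> z1; have c1 : {for z, continuous (fun z : (R * R) * R => nsq z.1)}.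
  by apply: (@continuous_comp _ _ _ fst nsq z); [exact: cvg_fst|exact: continuous_nsq].
have d0 : den z.1 z.2 != 0 by rewrite gt_eqF// den_gt0.
have H1 := contD (contC 1 z) (contN c1).
have H2 := (@contV _ _ (fun z : (R * R) * R => den z.1 z.2) z d0 (continuous_den z)).
exact: (contM H1 H2).
Qed.

Lemma continuous_pk2 q : nsq q < 1 -> continuous (pk q).
Proof.
move=> q1 t.
have H : {for t, continuous (den q)}.
  exact: (contD (contX (contD (@continuous_cos R t) (contC (- q.1) t)))
    (contX (contD (@continuous_sin R t) (contC (- q.2) t)))).
have d0 : den q t != 0 by rewrite gt_eqF// den_gt0.
exact: (contM (contC (1 - nsq q) t) (contV d0 H)).
Qed.

(** In the proof [D t + i N t] is [1 - q e^{-it}], and the kernel is the derivative of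
    [t + 2 arg (1 - q e^{-it})]. As [D t > 0], a single arctangent gives the argument for all [t];
    it is periodic, so only the term [t] contributes. *)
Lemma integral_pk q : nsq q < 1 ->
  \int[mu]_(t in `[0, 2 * pi]) pk q t = 2 * pi.
Proof.
move=> q1.
pose N t := q.1 * sin t - q.2 * cos t.
pose D t := 1 - (q.1 * cos t + q.2 * sin t).
pose F t := t + 2 * atan (N t / D t).
have denE t : D t ^+ 2 + N t ^+ 2 = den q t.
  have cs := cos2Dsin2 t.
  have -> : den q t = (D t *+ 2 - 1 + nsq q).
    by have := cs; rewrite /den /D /nsq; lra.
  have -> : nsq q = (q.1 * cos t + q.2 * sin t) ^+ 2 + N t ^+ 2.
    by rewrite -[LHS]mulr1 -[X in _ * X]cs /nsq /N; ring.
  by rewrite /D; ring.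
have D0 t : 0 < D t.
  have d0 := den_gt0 t q1.
  have n0 : 0 <= nsq q by rewrite addr_ge0// sqr_ge0.
  have : den q t = D t *+ 2 - 1 + nsq q by have := cos2Dsin2 t; rewrite /den /D /nsq; lra.
  lra.
have dN t : is_derive t (1 : R) N (1 - D t).
  apply: is_derive_eq (derivD (derivM (derivC q.1 t) (is_derive_sin t))
    (derivN (derivM (derivC q.2 t) (is_derive_cos t)))) _.
  by rewrite /D; ring.
have dD t : is_derive t (1 : R) D (N t).
  apply: is_derive_eq (derivD (derivC 1 t) (derivN (derivD
    (derivM (derivC q.1 t) (is_derive_cos t))
    (derivM (derivC q.2 t) (is_derive_sin t))))) _.
  by rewrite /N; ring.
have dF t : is_derive t (1 : R) F (pk q t).
  have D0' : D t != 0 by rewrite gt_eqF.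
  apply: is_derive_eq (derivD (derivI t) (derivM (derivC 2 t) (deriv_comp
    (is_derive1_atan _) (derivM (dN t) (derivV D0' (dD t)))))) _.
  have n1 : nsq q = den q t + 1 - D t *+ 2.
    by have := cos2Dsin2 t; rewrite /den /D /nsq; lra.
  rewrite /pk n1 -denE; field.
  have d0 : D t ^+ 2 + N t ^+ 2 != 0 by rewrite denE gt_eqF// den_gt0.
  by rewrite d0 D0'.
have cF t : {for t, continuous F}.
  by have [/derivable1_diffP/differentiable_continuous] := dF t.
rewrite /Rintegral (@continuous_FTC2 _ (pk q) F); last 1 first.
- by move=> t _; have [_ <-] := dF t; rewrite derive1E.
- rewrite /= /F /N /D sin0 cos0 mulr_natl cos2pi sin2pi; ring.
- by rewrite mulr_gt0// pi_gt0.
- by apply: continuous_subspaceT; exact: continuous_pk2.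
- split.
  + by move=> t _; have [] := dF t.
  + by apply: cvg_at_right_filter; exact: cF.
  + by apply: cvg_at_left_filter; exact: cF.
Qed.

End poisson_kernel.
Arguments continuous_den {R} z.
Arguments continuous_pk {R} z.
Arguments continuous_pk2 {R} q.

(** * The discrete Laplacian of the kernel, uniformly on the circle *)

Section dlap_poisson_kernel.
Context {R : realType}.
Implicit Types (q : R * R) (t h : R).

(* With [w = e^{it} - q], the discrete Laplacian of [1 / w] in [q] is exactly
   [4 h^4 / (w (w^4 - h^4))], and [pk q t = 2 Re (e^{it} / w) - 1]. *)
Lemma dlap_pkE q t h :
  let a := cos t - q.1 in let b := sin t - q.2 in
  0 < a ^+ 2 + b ^+ 2 ->
  0 < (a - h) ^+ 2 + b ^+ 2 -> 0 < (a + h) ^+ 2 + b ^+ 2 ->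
  0 < a ^+ 2 + (b - h) ^+ 2 -> 0 < a ^+ 2 + (b + h) ^+ 2 ->
  dlap (pk ^~ t) q h = 8 * h ^+ 4 *
    (cos t * (a ^+ 5 - 10 * (a ^+ 3 * b ^+ 2) + 5 * (a * b ^+ 4) - h ^+ 4 * a) +
     sin t * (5 * (a ^+ 4 * b) - 10 * (a ^+ 2 * b ^+ 3) + b ^+ 5 - h ^+ 4 * b)) /
    ((a ^+ 2 + b ^+ 2) * ((a - h) ^+ 2 + b ^+ 2) * ((a + h) ^+ 2 + b ^+ 2) *
     (a ^+ 2 + (b - h) ^+ 2) * (a ^+ 2 + (b + h) ^+ 2)).
Proof.
move=> a b; rewrite /dlap /pk /den /nsq/=.
have cE : q.1 = cos t - a by rewrite /a; ring.
have sE : q.2 = sin t - b by rewrite /b; ring.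
move: a b cE sE => a b cE sE; have cs := cos2Dsin2 t.
have numE (x y : R) : 1 - ((cos t - x) ^+ 2 + (sin t - y) ^+ 2) =
    2 * (cos t * x + sin t * y) - (x ^+ 2 + y ^+ 2).
  by lra.
have kE (x y : R) : 0 < x ^+ 2 + y ^+ 2 ->
    (1 - ((cos t - x) ^+ 2 + (sin t - y) ^+ 2)) / (x ^+ 2 + y ^+ 2) =
    2 * (cos t * x + sin t * y) / (x ^+ 2 + y ^+ 2) - 1.
  by move=> xy; rewrite numE mulrBl divff// gt_eqF.
move=> h0 h1 h2 h3 h4.
have -> : q.1 + h = cos t - (a - h) by rewrite cE; ring.
have -> : q.1 - h = cos t - (a + h) by rewrite cE; ring.
have -> : q.2 + h = sin t - (b - h) by rewrite sE; ring.
have -> : q.2 - h = sin t - (b + h) by rewrite sE; ring.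
rewrite cE sE !subKr !kE//.
move: (cos t) (sin t) a b h0 h1 h2 h3 h4 {cE sE cs numE kE} => c s a b h0 h1 h2 h3 h4.
field.
by rewrite !gt_eqF.
Qed.

Lemma mul_bnd (x y A B : R) : `|x| <= A -> `|y| <= B -> `|x * y| <= A * B.
Proof. by move=> xA yB; rewrite normrM ler_pM. Qed.

Lemma add_bnd (x y A B : R) : `|x| <= A -> `|y| <= B -> `|x + y| <= A + B.
Proof. by move=> xA yB; apply: le_trans (ler_normD _ _) _; exact: lerD. Qed.

Lemma exp_bnd n (x A : R) : `|x| <= A -> `|x ^+ n| <= A ^+ n.
Proof. by move=> xA; rewrite normrX lerXn2r// nnegrE// (le_trans _ xA). Qed.

(** Uniformity in [t] is the point: an error of order [h ^+ 4], against the [h ^+ 2] of [dharm],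
    survives integration against any bounded function. *)
Lemma dlap_pk_le q : nsq q < 1 -> exists2 C : R, 0 <= C &
  \forall h \near 0^'+, forall t, `|dlap (pk ^~ t) q h| <= C * h ^+ 4.
Proof.
move=> q1; have n0 : 0 <= nsq q by rewrite addr_ge0// sqr_ge0.
(* For small [h] the five points of the stencil satisfy [nsq <= (1 + nsq q) / 2], so [den_ge] bounds
   each of the five denominators below by [k]. The constant [10 ^+ 4] is a crude bound for the
   bracket in [dlap_pkE], where [|a|, |b| <= 2] and [|h| <= 1]. *)
pose k := ((1 - nsq q) / 2) ^+ 2 / 4.
have k0 : 0 < k by rewrite divr_gt0// exprn_gt0// divr_gt0// subr_gt0.
exists (8 * 10 ^+ 4 / k ^+ 5); first by rewrite divr_ge0// exprn_ge0// ltW.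
near=> h => t.
have h0 : 0 < h by near: h; exact: nbhs_right_gt.
have h1 : h < 1 by near: h; exact: nbhs_right_lt.
have hq : h < (1 - nsq q) / 6 by near: h; apply: nbhs_right_lt; rewrite divr_gt0// subr_gt0.
have [x1 y1] : `|q.1| <= 1 /\ `|q.2| <= 1.
  have := q1; rewrite /nsq => q1'.
  by split; rewrite -(@ler_pXn2r _ 2)// ?nnegrE// expr1n real_normK ?num_real//; nra.
have dE (x y : R) : nsq (x, y) <= (1 + nsq q) / 2 ->
    k <= (cos t - x) ^+ 2 + (sin t - y) ^+ 2.
  move=> xy; have xy1 : nsq (x, y) < 1 by apply: le_lt_trans xy _; lra.
  apply: le_trans (@den_ge _ (x, y) t xy1).
  rewrite /k ler_pM2r// ler_pXn2r// ?nnegrE; lra.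
move: k k0 dE => k k0 dE.
have nE (e : R) : e = h \/ e = - h ->
    nsq (q.1 + e, q.2) <= (1 + nsq q) / 2 /\ nsq (q.1, q.2 + e) <= (1 + nsq q) / 2.
  have hh : h ^+ 2 <= h by nra.
  move: x1 y1 hq; rewrite /nsq/= !ler_norml => /andP[? ?] /andP[? ?] ? [] ->; split; nra.
have [n1 n2] := nE h (or_introl erefl).
have [n3 n4] := nE (- h) (or_intror erefl).
have k_ (x y : R) : nsq (x, y) <= (1 + nsq q) / 2 -> 0 < (cos t - x) ^+ 2 + (sin t - y) ^+ 2.
  by move/dE; exact: lt_le_trans.
have nn : nsq (q.1, q.2) <= (1 + nsq q) / 2 by rewrite -surjective_pairing; lra.
have e1 (x y : R) : x - (y + h) = x - y - h by ring.
have e2 (x y : R) : x - (y - h) = x - y + h by ring.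
have d0 := k_ _ _ nn; have d1 := k_ _ _ n1; have d2 := k_ _ _ n2.
have d3 := k_ _ _ n3; have d4 := k_ _ _ n4.
have b0 := dE _ _ nn; have b1 := dE _ _ n1; have b2 := dE _ _ n2.
have b3 := dE _ _ n3; have b4 := dE _ _ n4.
rewrite ?e1 ?e2 in d0 d1 d2 d3 d4 b0 b1 b2 b3 b4.
rewrite dlap_pkE//.
set a := cos t - q.1 in d0 d1 d2 d3 d4 b0 b1 b2 b3 b4 *.
set b := sin t - q.2 in d0 d1 d2 d3 d4 b0 b1 b2 b3 b4 *.
rewrite normrM normfV.
set N := (X in `|X| / _); set P := (X in _ / `|X|).
have P0 : k ^+ 5 <= `|P|.
  rewrite ger0_norm; last by rewrite !mulr_ge0// ltW.
  have -> : k ^+ 5 = k * k * k * k * k by ring.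
  have kk := ltW k0; rewrite /P.
  by do 4 (apply: ler_pM => //; rewrite ?mulr_ge0//).
have a2 : `|a| <= 2 by apply: le_trans (ler_normB _ _) _; have := cos_max t; lra.
have b2' : `|b| <= 2 by apply: le_trans (ler_normB _ _) _; have := sin_max t; lra.
have hn : `|h| <= 1 by rewrite gtr0_norm// ltW.
have N0 : `|N| <= 8 * h ^+ 4 * 10 ^+ 4.
  rewrite /N normrM ger0_norm; last by rewrite mulr_ge0// exprn_ge0// ltW.
  apply: ler_wpM2l; first by rewrite mulr_ge0// exprn_ge0// ltW.
  have num n : `|n%:R : R| <= n%:R by rewrite normr_nat.
  have Nn (x A : R) : `|x| <= A -> `|- x| <= A by rewrite normrN.
  apply: le_trans (_ : 1 * (2 ^+ 5 + 10%:R * (2 ^+ 3 * 2 ^+ 2) + 5%:R * (2 * 2 ^+ 4) + 1 ^+ 4 * 2)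
    + 1 * (5%:R * (2 ^+ 4 * 2) + 10%:R * (2 ^+ 2 * 2 ^+ 3) + 2 ^+ 5 + 1 ^+ 4 * 2) <= _); last by lra.
  by repeat lazymatch goal with
  | |- is_true (`|_ + _| <= _) => apply: add_bnd
  | |- is_true (`|- _| <= _) => apply: Nn
  | |- is_true (`|_ * _| <= _) => apply: mul_bnd
  | |- is_true (`|_ ^+ _| <= _) => apply: exp_bnd
  | |- is_true (`|cos _| <= _) => exact: cos_max
  | |- is_true (`|sin _| <= _) => exact: sin_max
  | |- is_true (`|_%:R| <= _) => exact: num
  | _ => assumption
  end.
have -> : 8 * 10 ^+ 4 / k ^+ 5 * h ^+ 4 = 8 * h ^+ 4 * 10 ^+ 4 / k ^+ 5 by ring.
apply: ler_pM; rewrite ?invr_ge0//.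
by rewrite lef_pV2// posrE ?exprn_gt0// (lt_le_trans _ P0)// exprn_gt0.
Unshelve. all: by end_near. Qed.

End dlap_poisson_kernel.

(** * Poisson integrals and the Poisson formula *)

Section poisson_formula.
Context {R : realType}.
Notation mu := (@lebesgue_measure R).
Implicit Types (q : R * R) (t h : R) (g : R -> R).

Lemma continuous_itv_integrable (a b : R) g : continuous g ->
  mu.-integrable `[a, b] (EFin \o g).
Proof.
move=> cg; apply: continuous_compact_integrable; first exact: segment_compact.
exact: continuous_subspaceT.
Qed.

Lemma Rintegral_const (a b c : R) : a <= b -> \int[mu]_(_ in `[a, b]) c = c * (b - a).
Proof.
move=> ab; rewrite Rintegral_cst//= lebesgue_measure_itv/= lte_fin.
by move: ab; rewrite le_eqVlt => /predU1P[->|->//]; rewrite ltxx subrr.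
Qed.

Lemma le_Rintegral_const (a b M : R) g : a <= b -> continuous g ->
  (forall t, t \in `[a, b] -> `|g t| <= M) ->
  `|\int[mu]_(t in `[a, b]) g t| <= M * (b - a).
Proof.
move=> ab cg gM; apply: le_trans (le_normr_Rintegral _ _) _ => //.
  exact: continuous_itv_integrable.
rewrite -Rintegral_const//; apply: le_Rintegral => //.
- apply: continuous_itv_integrable => t.
  by apply: (cont_comp _ (cg t)); exact: norm_continuous.
- by apply: continuous_itv_integrable; exact: cst_continuous.
Qed.

Lemma continuous_itv_bounded (a b : R) g : continuous g ->
  exists2 M, 0 <= M & forall t, t \in `[a, b] -> `|g t| <= M.
Proof.
move=> cg; have [ab|ba] := leP a b; last first.
  exists 0 => // t; rewrite in_itv/= => /andP[/le_trans/[apply]].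
  by rewrite leNgt ba.
have [] := @compact_EVT_max _ _ (fun t => `|g t|) `[a, b]%classic.
- by exists a; rewrite /= in_itv/= lexx.
- exact: segment_compact.
- apply: continuous_subspaceT => t.
  by apply: (cont_comp _ (cg t)); exact: norm_continuous.
- by move=> c _ H; exists `|g c| => // t tI; apply: H; rewrite inE.
Qed.

Lemma pi2_gt0 : 0 < 2 * pi :> R.
Proof. by rewrite mulr_gt0// pi_gt0. Qed.

Definition poisson_int g q : R := (2 * pi)^-1 * \int[mu]_(t in `[0, 2 * pi]) (pk q t * g t).

Lemma continuous_pkM g q : continuous g -> nsq q < 1 -> continuous (fun t => pk q t * g t).
Proof.
move=> cg q1 t; have H1 : {for t, continuous (pk q)} by exact: continuous_pk2.
have H2 : {for t, continuous g} by exact: cg.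
exact: (contM H1 H2).
Qed.

Arguments continuous_pkM : clear implicits.

Lemma near_nsq_lt1 q : nsq q < 1 -> \forall z \near q, nsq z < 1.
Proof.
move/cvgrPdist_lt : (@continuous_nsq R q) => /(_ (1 - nsq q)) H q1.
have : 0 < 1 - nsq q by rewrite subr_gt0.
by move=> /H; apply: filterS => x; rewrite ltr_norml => /andP[]; lra.
Qed.

Lemma continuous_poisson_int g q : continuous g -> nsq q < 1 ->
  {for q, continuous (poisson_int g)}.
Proof.
move=> cg q1; have p0 := pi2_gt0.
have [M M0 gM] := continuous_itv_bounded (0 : R) (2 * pi) cg.
apply/cvgrPdist_le => e e0.
pose d := e / (M + 1).
have d0 : 0 < d by rewrite divr_gt0// ltr_wpDl.
have cov := (@compact_near_coveringP _ _).1 (@segment_compact R 0 (2 * pi)).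
(* Compactness of the interval, in the form of near coverings, turns the joint continuity of the
   kernel into closeness uniform in [t]. *)
have : \forall z \near q, `[0, 2 * pi] `<=` (fun t => `|pk z t - pk q t| < d).
  apply: (cov (R * R)%type (nbhs q) (fun z t => `|pk z t - pk q t| < d)) => t _.
  have c1 := continuous_pk (q, t) q1.
  have c2 := continuous_pk2 q q1 t.
  have d2 : 0 < d / 2 by rewrite divr_gt0.
  have /cvgrPdist_lt/(_ _ d2)[[A B] /= [Aq Bt] AB] := c1.
  move/cvgrPdist_lt : c2 => /(_ _ d2) c2.
  exists (B `&` (fun t' => `|pk q t - pk q t'| < d / 2), A) => /=.
    by split => //; exact: filterI.
  move=> [t' z] /= [[Bt' qt'] Az].
  have /= H := AB (z, t') (conj Az Bt').
  rewrite -(subrKA (pk q t)) (le_lt_trans (ler_normD _ _))// (splitr d) ltrD//.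
  by rewrite distrC.
move=> H; near=> z.
have z1 : nsq z < 1 by near: z; exact: near_nsq_lt1.
have Hz : `[0, 2 * pi] `<=` (fun t => `|pk z t - pk q t| < d) by near: z.
rewrite /poisson_int -mulrBr normrM gtr0_norm ?invr_gt0//.
rewrite -RintegralB//; [|exact/continuous_itv_integrable/continuous_pkM..].
rewrite ler_pdivrMl//.
have -> : 2 * pi * e = (e * (2 * pi - 0)) by ring.
apply: le_Rintegral_const; first exact: ltW.
  move=> t; exact: (contD (continuous_pkM g q cg q1 t) (contN (continuous_pkM g z cg z1 t))).
move=> t tI; rewrite -mulrBl normrM distrC.
have zt : `|pk z t - pk q t| < d := Hz t tI.
have -> : e = d * (M + 1) by rewrite /d divfK// gt_eqF// ltr_wpDl.
apply: ler_pM => //; first exact: ltW.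
by apply: le_trans (gM _ tI) _; rewrite lerDl.
Unshelve. all: by end_near. Qed.

(** [dlap] is a finite linear combination of values, so it commutes with the integral, and
    [dlap_pk_le] finishes. *)
Lemma dharm_poisson_int g q : continuous g -> nsq q < 1 -> dharm (poisson_int g) q.
Proof.
move=> cg q1; have p0 := pi2_gt0.
have [M M0 gM] := continuous_itv_bounded (0 : R) (2 * pi) cg.
have [C C0 Ch] := dlap_pk_le q1.
apply/cvgrPdist_le => e e0; near=> h.
have h0 : 0 < h by near: h; exact: nbhs_right_gt.
have h1 : h <= 1 by near: h; exact: nbhs_right_le.
have hq : h < (1 - nsq q) / 6 by near: h; apply: nbhs_right_lt; rewrite divr_gt0// subr_gt0.
have hC : forall t, `|dlap (pk ^~ t) q h| <= C * h ^+ 4 by near: h.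
have he : h < e / (C * M + 1).
  by near: h; apply: nbhs_right_lt; rewrite divr_gt0// ltr_wpDl// mulr_ge0.
rewrite sub0r normrN normrM normfV (ger0_norm (exprn_ge0 _ (ltW h0))).
rewrite ler_pdivrMr ?exprn_gt0//.
have [x1 y1] : `|q.1| <= 1 /\ `|q.2| <= 1.
  have := q1; rewrite /nsq => q1'.
  by split; rewrite -(@ler_pXn2r _ 2)// ?nnegrE// expr1n real_normK ?num_real//; nra.
have [n1 n2 n3 n4] : [/\ nsq (q.1 + h, q.2) < 1, nsq (q.1 - h, q.2) < 1,
    nsq (q.1, q.2 + h) < 1 & nsq (q.1, q.2 - h) < 1].
  have hh : h ^+ 2 <= h by nra.
  move: x1 y1 hq; rewrite /nsq/= !ler_norml => /andP[? ?] /andP[? ?] ?; split; nra.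
pose I z := \int[mu]_(t in `[0, 2 * pi]) (pk z t * g t).
have cI z : nsq z < 1 -> continuous (fun t => pk z t * g t).
  by move=> z1; exact: continuous_pkM.
have iI z : nsq z < 1 -> mu.-integrable `[0, 2 * pi] (EFin \o (fun t => pk z t * g t)).
  by move=> z1; exact/continuous_itv_integrable/cI.
have -> : dlap (poisson_int g) q h = (2 * pi)^-1 *
    \int[mu]_(t in `[0, 2 * pi]) (dlap (pk ^~ t) q h * g t).
  rewrite /dlap /poisson_int -!mulrDr mulrCA -mulrBr; congr *%R.
  pose G t := (pk (q.1 + h, q.2) t * g t + pk (q.1 - h, q.2) t * g t).
  pose H t := (pk (q.1, q.2 + h) t * g t + pk (q.1, q.2 - h) t * g t).
  have cG : continuous G by move=> t; exact: (contD (cI _ n1 t) (cI _ n2 t)).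
  have cH : continuous H by move=> t; exact: (contD (cI _ n3 t) (cI _ n4 t)).
  have cK : continuous (fun t => 4 * (pk q t * g t)).
    by move=> t; exact: (contM (contC 4 t) (cI _ q1 t)).
  have cGH : continuous (fun t => G t + H t).
    by move=> t; exact: (contD (cG t) (cH t)).
  transitivity (\int[mu]_(t in `[0, 2 * pi]) (G t + H t - 4 * (pk q t * g t))).
    rewrite RintegralB//; [|exact: continuous_itv_integrable..].
    rewrite RintegralD//; [|exact: continuous_itv_integrable..].
    rewrite RintegralZl//; last exact: iI.
    by rewrite !RintegralD ?addrA//; exact: iI.
  by apply: eq_Rintegral => t _; rewrite /G /H; ring.
rewrite normrM gtr0_norm ?invr_gt0// ler_pdivrMl//.
apply: le_trans (le_Rintegral_const (M := C * h ^+ 4 * M) (ltW p0) _ _) _.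
- move=> t; rewrite /dlap.
  exact: (contM (contD (contD (contD (contD (continuous_pk2 _ n1 t)
    (continuous_pk2 _ n2 t)) (continuous_pk2 _ n3 t)) (continuous_pk2 _ n4 t))
    (contN (contM (contC 4 t) (continuous_pk2 _ q1 t)))) (cg t)).
- by move=> t tI; rewrite normrM ler_pM// gM.
rewrite subr0 mulrC ler_pM2l//.
have CM0 : 0 <= C * M by rewrite mulr_ge0.
have -> : C * h ^+ 4 * M = (C * M * h ^+ 2) * h ^+ 2 by ring.
rewrite ler_pM2r ?exprn_gt0//.
apply: le_trans (_ : (C * M + 1) * h <= _); last first.
  by rewrite mulrC -ler_pdivlMr ?ltW// ltr_wpDl.
have : h ^+ 2 <= h by nra.
nra.
Unshelve. all: by end_near. Qed.

(** Closeness is measured by [den], the denominator of the kernel: in the proof of the Poisson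
    formula, the region not covered by this estimate is then one where the kernel is small. *)
Lemma disk_unif_continuous (u : R * R -> R) (e : R) :
  (forall q, nsq q <= 1 -> {for q, continuous u}) -> 0 < e ->
  exists2 d : R, 0 < d &
    forall q t, nsq q <= 1 -> den q t < d -> `|u q - u (cos t, sin t)| < e.
Proof.
move=> cu e0.
have cov := (@compact_near_coveringP _ _).1 (@compact_disk R 1).
have : \forall d \near 0^'+, [set q | nsq q <= 1] `<=`
    (fun q => forall t, den q t < d -> `|u q - u (cos t, sin t)| < e).
  apply: (cov R 0^'+ (fun d q => forall t, den q t < d -> `|u q - u (cos t, sin t)| < e)).
  move=> q0 /= q01.
  have e2 : 0 < e / 2 by rewrite divr_gt0.
  have /cvgrPdist_lt/(_ _ e2)/nbhs_ballP[r /= r0 ur] := cu q0 q01.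
  exists (ball q0 (r / 2), [set d | d < (r / 2) ^+ 2]) => /=.
    split; first by apply: nbhsx_ballx; rewrite divr_gt0.
    by apply: nbhs_right_lt; rewrite exprn_gt0// divr_gt0.
  move=> [q d] /= [[q1r q2r] dr] t qd.
  have {}qd : den q t < (r / 2) ^+ 2 by exact: lt_trans dr.
  have qr (x : R) : x ^+ 2 <= den q t -> `|x| < r / 2.
    move=> xq; rewrite -(@ltr_pXn2r _ 2)// ?nnegrE//; last by rewrite ltW// divr_gt0.
    by rewrite real_normK ?num_real// (le_lt_trans xq).
  have c1 : `|cos t - q.1| < r / 2 by apply: qr; rewrite /den lerDl sqr_ge0.
  have c2 : `|sin t - q.2| < r / 2 by apply: qr; rewrite /den lerDr sqr_ge0.
  have rr : r / 2 <= r by lra.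
  have uq : `|u q0 - u q| < e / 2.
    by apply: ur; split; [exact: lt_le_trans q1r _|exact: lt_le_trans q2r _].
  have ut : `|u q0 - u (cos t, sin t)| < e / 2.
    apply: ur; split => /=; rewrite /ball/=.
      rewrite (_ : q0.1 - cos t = (q0.1 - q.1) - (cos t - q.1)); last by ring.
      by rewrite (le_lt_trans (ler_normB _ _))// (splitr r) ltrD.
    rewrite (_ : q0.2 - sin t = (q0.2 - q.2) - (sin t - q.2)); last by ring.
    by rewrite (le_lt_trans (ler_normB _ _))// (splitr r) ltrD.
  rewrite (_ : u q - _ = (u q0 - u (cos t, sin t)) - (u q0 - u q)); last by ring.
  by rewrite (le_lt_trans (ler_normB _ _))// (splitr e) ltrD.
move=> H; near (0 : R)^'+ => d; exists d; first by near: d; exact: nbhs_right_gt.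
have Hd : [set q | nsq q <= 1] `<=`
    (fun q => forall t, den q t < d -> `|u q - u (cos t, sin t)| < e) by near: d.
by move=> q t q1; exact: Hd.
Unshelve. all: by end_near. Qed.

(** The maximum principle is applied to both differences of [u] and the Poisson integral of its
    boundary values. The boundary hypothesis [bdry] holds because the kernel is an approximate
    identity, uniformly over the circle. *)
Theorem poisson_formula (u : R * R -> R) q :
  (forall q, nsq q <= 1 -> {for q, continuous u}) ->
  (forall q, nsq q < 1 -> dharm u q) -> nsq q < 1 ->
  u q = poisson_int (fun t => u (cos t, sin t)) q.
Proof.
move=> cu hu q1; have p0 := pi2_gt0; have p1 : 2 * pi != 0 :> R by rewrite gt_eqF.
pose g t := u (cos t, sin t).
have cg : continuous g.
  move=> t; apply: (@continuous_comp _ _ _ (fun t => (cos t, sin t)) u t).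
    exact: (cont_pair (@continuous_cos R t) (@continuous_sin R t)).
  by apply: cu; rewrite /nsq/= cos2Dsin2.
have [M uM] : exists M, forall q, nsq q <= 1 -> `|u q| <= M.
  have [] := @compact_EVT_max _ _ (fun q => `|u q|) [set q | nsq q <= 1].
  - by exists (0, 0); rewrite /nsq/= expr0n/= addr0 ler01.
  - exact: compact_disk.
  - apply: continuous_in_subspaceT => z; rewrite inE/= => z1.
    by apply: (cont_comp _ (cu z z1)); exact: norm_continuous.
  - by move=> c _ H; exists `|u c| => z z1; apply: H; rewrite inE.
have bdry e : 0 < e -> exists2 r : R, r < 1 &
    forall z, r <= nsq z < 1 -> `|u z - poisson_int g z| <= e.
  move=> e0; have e2 : 0 < e / 2 by rewrite divr_gt0.
  have [d d0 ud] := disk_unif_continuous cu e2.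
  have M0 : 0 <= M by apply: le_trans (normr_ge0 _) (uM (0, 0) _); rewrite /nsq/= expr0n/= addr0 ler01.
  (* Where [den z t >= d], the kernel is at most [k / d]; multiplied by [2 * M], a bound for
     [|u z - g t|], this stays below [e / 2]. *)
  pose k := d * e / (4 * (M + 1)).
  have k0 : 0 < k by rewrite divr_gt0// mulr_gt0// ltr_wpDl.
  exists (1 - k); first by rewrite ltrBlDr ltrDl.
  move=> z /andP[kz z1].
  have -> : u z - poisson_int g z =
      (2 * pi)^-1 * \int[mu]_(t in `[0, 2 * pi]) (pk z t * (u z - g t)).
    rewrite /poisson_int -[X in X - _](mulKf p1) -mulrBr; congr *%R.
    rewrite -[X in X * u z](integral_pk z1) -RintegralZr//; last first.
      by apply: continuous_itv_integrable; exact: continuous_pk2.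
    rewrite -RintegralB//; last 2 first.
    - by apply: continuous_itv_integrable; apply: continuous_pkM => //; exact: cst_continuous.
    - by apply: continuous_itv_integrable; exact: continuous_pkM.
    by apply: eq_Rintegral => t _; ring.
  rewrite normrM gtr0_norm ?invr_gt0// ler_pdivrMl//.
  have cD : continuous (fun t => u z - g t).
    by move=> t; exact: (contD (contC (u z) t) (contN (cg t))).
  (* The majorant: its first term serves the [t] with [den z t < d], its second one the others. Its
     integral is [2 * pi * e]. *)
  have cB : continuous (fun t => e / 2 * pk z t + e / 2).
    by move=> t; exact: (contD (contM (contC (e / 2) t) (continuous_pk2 z z1 t)) (contC (e / 2) t)).
  apply: le_trans (le_normr_Rintegral _ _) _ => //.
    by apply: continuous_itv_integrable; exact: continuous_pkM.
  apply: (@le_trans _ _ (\int[mu]_(t in `[0, 2 * pi]) (e / 2 * pk z t + e / 2))).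
    apply: le_Rintegral => //; last move=> t _.
    - apply: continuous_itv_integrable => t.
      by apply: (cont_comp _ (continuous_pkM _ _ cD z1 t)); exact: norm_continuous.
    - exact: continuous_itv_integrable.
    have pk0 := pk_ge0 t z1.
    rewrite normrM ger0_norm//.
    have [zd|dz] := ltP (den z t) d.
      have := ud z t (ltW z1) zd; rewrite -/(g t) => /ltW.
      by nra.
    have ug : `|u z - g t| <= 2 * M.
      rewrite mulr_natl mulr2n (le_trans (ler_normB _ _))// lerD//; apply: uM.
        exact: ltW.
      by rewrite /nsq/= cos2Dsin2.
    have pk1 : pk z t <= k / d.
      have dz0 := den_gt0 t z1; rewrite /pk; apply: ler_pM.
      - by rewrite subr_ge0 ltW.
      - by rewrite invr_ge0 ltW.
      - by lra.
      - by rewrite lef_pV2.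
    apply: (@le_trans _ _ (k / d * (2 * (M + 1)))).
      by apply: ler_pM => //; lra.
    have -> : k / d * (2 * (M + 1)) = e / 2.
      by rewrite /k; field; rewrite gt_eqF// gt_eqF// ltr_wpDl.
    by rewrite lerDr mulr_ge0// ltW.
  rewrite RintegralD//; last 2 first.
  - by apply: continuous_itv_integrable => t; exact: (contM (contC (e / 2) t) (continuous_pk2 z z1 t)).
  - by apply: continuous_itv_integrable; exact: cst_continuous.
  rewrite RintegralZl//; last by apply: continuous_itv_integrable; exact: continuous_pk2.
  rewrite integral_pk// Rintegral_const ?(ltW p0)// subr0.
  by rewrite -mulrDl -splitr mulrC.
have cv z : nsq z < 1 -> {for z, continuous (poisson_int g)}.
  by move=> z1; exact: continuous_poisson_int.
have hv z : nsq z < 1 -> dharm (poisson_int g) z.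
  by move=> z1; exact: dharm_poisson_int.
apply/eqP; rewrite eq_le -subr_le0 -[X in _ && X]subr_le0; apply/andP; split.
- apply: (max_principle (u := fun z => u z - poisson_int g z)) => //.
  + by move=> z z1; exact: (contD (cu z (ltW z1)) (contN (cv z z1))).
  + by move=> z z1; apply: dharmB; [exact: hu|exact: hv].
  + move=> e /bdry[r r1 H]; exists r => // z /H.
    by rewrite ler_norml => /andP[].
- apply: (max_principle (u := fun z => poisson_int g z - u z)) => //.
  + by move=> z z1; exact: (contD (cv z z1) (contN (cu z (ltW z1)))).
  + by move=> z z1; apply: dharmB; [exact: hv|exact: hu].
  + move=> e /bdry[r r1 H]; exists r => // z /H.
    by rewrite distrC ler_norml => /andP[].
Qed.

End poisson_formula.

(** * Real parts of complex powers are harmonic *)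

Section complex_powers.
Context {R : realType}.
Implicit Types (a b t e : R) (A B : R -> R) (q : R * R).

Lemma dharm_second_derivatives (u : R * R -> R) q (dx dy : R -> R) a b :
  (\forall t \near (0 : R), is_derive t (1 : R) (fun t => u (q.1 + t, q.2)) (dx t)) ->
  is_derive (0 : R) (1 : R) dx a ->
  (\forall t \near (0 : R), is_derive t (1 : R) (fun t => u (q.1, q.2 + t)) (dy t)) ->
  is_derive (0 : R) (1 : R) dy b ->
  a + b = 0 -> dharm u q.
Proof.
move=> ux dxa uy dyb ab0; rewrite /dharm -[X in _ --> X]ab0.
have : (fun h => (u (q.1 + h, q.2) + u (q.1 - h, q.2) - 2 * u (q.1 + 0, q.2)) / h ^+ 2 +
    (u (q.1, q.2 + h) + u (q.1, q.2 - h) - 2 * u (q.1, q.2 + 0)) / h ^+ 2) @ 0^'+ --> a + b.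
  exact: cvgD (second_difference ux dxa) (second_difference uy dyb).
apply: cvg_trans; apply: near_eq_cvg; near=> h.
rewrite /= -mulrDl /dlap !addr0 -surjective_pairing; congr (_ / _); ring.
Unshelve. all: by end_near. Qed.

(* Real and imaginary parts of the principal value of [(a + i b)^e], for [0 < a]. *)
Definition powre e a b : R := expR (e / 2 * ln (a ^+ 2 + b ^+ 2)) * cos (e * atan (b / a)).
Definition powim e a b : R := expR (e / 2 * ln (a ^+ 2 + b ^+ 2)) * sin (e * atan (b / a)).

(** The relation [z^(e - 1) = z^e conj(z) / |z|^2], where [E] is [1 / |z|]. It lets derivatives of
    powers be written as powers again, so that a second differentiation reuses the same formula. *)
Lemma powre_powim_pred e a b : 0 < a ->
  powre (e - 1) a b = (powre e a b * a + powim e a b * b) / (a ^+ 2 + b ^+ 2) /\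
  powim (e - 1) a b = (powim e a b * a - powre e a b * b) / (a ^+ 2 + b ^+ 2).
Proof.
move=> a0; have r0 : 0 < a ^+ 2 + b ^+ 2 by rewrite ltr_pwDl ?exprn_gt0// sqr_ge0.
pose E := expR (- (1 / 2 * ln (a ^+ 2 + b ^+ 2))).
have E2 : E ^+ 2 = (a ^+ 2 + b ^+ 2)^-1.
  rewrite /E -expRM_natl -[RHS]lnK ?posrE ?invr_gt0// lnV ?posrE//.
  by congr expR; lra.
have aE : 0 < a * E by rewrite mulr_gt0// expR_gt0.
have cE : cos (atan (b / a)) = a * E.
  rewrite cos_atan; apply/eqP; rewrite -(@eqrXn2 _ 2) ?invr_ge0 ?sqrtr_ge0 ?(ltW aE)//.
  rewrite exprVn sqr_sqrtr; last by rewrite addr_ge0// sqr_ge0.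
  by rewrite [(a * E) ^+ 2]exprMn E2; apply/eqP; field; rewrite !gt_eqF.
have sE : sin (atan (b / a)) = b * E.
  have := atanK (b / a); rewrite /tan cE => /(canRL (mulfVK _)) ->.
    by field; rewrite gt_eqF.
  by rewrite gt_eqF.
have eE : expR ((e - 1) / 2 * ln (a ^+ 2 + b ^+ 2)) =
    expR (e / 2 * ln (a ^+ 2 + b ^+ 2)) * E.
  by rewrite -expRD; congr expR; lra.
rewrite /powre /powim eE mulrBl mul1r cosB sinB cE sE.
by split; rewrite -E2; ring.
Qed.

Lemma powre_powim_derive e A B t a b : 0 < A t ->
  is_derive t (1 : R) A a -> is_derive t (1 : R) B b ->
  is_derive t (1 : R) (fun t => powre e (A t) (B t))
    (e * (powre (e - 1) (A t) (B t) * a - powim (e - 1) (A t) (B t) * b)) /\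
  is_derive t (1 : R) (fun t => powim e (A t) (B t))
    (e * (powim (e - 1) (A t) (B t) * a + powre (e - 1) (A t) (B t) * b)).
Proof.
move=> A0 dA dB; have r0 : 0 < A t ^+ 2 + B t ^+ 2 by rewrite ltr_pwDl ?exprn_gt0// sqr_ge0.
have A0' : A t != 0 by rewrite gt_eqF.
have r0' : A t ^+ 2 + B t ^+ 2 != 0 by rewrite gt_eqF.
have dE := deriv_comp (g := fun t => e / 2 * ln (A t ^+ 2 + B t ^+ 2)) (is_derive_expR _) (derivM (derivC (e / 2) t)
  (deriv_comp (g := fun t => A t ^+ 2 + B t ^+ 2) (is_derive1_ln r0) (derivD (derivX2 dA) (derivX2 dB)))).
have dT := derivM (derivC e t) (deriv_comp (g := fun t => B t / A t) (is_derive1_atan _) (derivM dB (derivV A0' dA))).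
have [-> ->] := powre_powim_pred e (B t) A0.
have H : 1 + (B t / A t) ^+ 2 != 0 by rewrite gt_eqF// ltr_pwDl// sqr_ge0.
split.
- apply: is_derive_eq (derivM dE (deriv_comp (g := fun t => e * atan (B t / A t)) (is_derive_cos _) dT)) _.
  by rewrite /powre /powim; field; rewrite r0' A0'.
- apply: is_derive_eq (derivM dE (deriv_comp (g := fun t => e * atan (B t / A t)) (is_derive_sin _) dT)) _.
  by rewrite /powre /powim; field; rewrite r0' A0'.
Qed.

Lemma powre_ge e a b : 0 < a -> `|e| <= 1 ->
  cos (e * (pi / 2)) * (a ^+ 2 + b ^+ 2) `^ (e / 2) <= powre e a b.
Proof.
move=> a0 e1; have r0 : 0 < a ^+ 2 + b ^+ 2 by rewrite ltr_pwDl ?exprn_gt0// sqr_ge0.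
rewrite mulrC /powR gt_eqF// /powre ler_pM2l ?expR_gt0//.
have p2 : `|pi / 2| = pi / 2 :> R by rewrite gtr0_norm// divr_gt0// pi_gt0.
rewrite -[leLHS]cos_norm -[leRHS]cos_norm [X in cos X <= _]normrM p2 [X in _ <= cos X]normrM.
have p0 : 0 < pi :> R := pi_gt0 R.
have tp : `|atan (b / a)| <= pi / 2.
  by rewrite ler_norml !ltW// ?atan_gtNpi2 ?atan_ltpi2.
have h1 : `|e| * (pi / 2) <= pi by nra.
have h2 : `|e| * `|atan (b / a)| <= `|e| * (pi / 2) by rewrite ler_wpM2l.
have h3 : 0 <= `|e| * `|atan (b / a)| by rewrite mulr_ge0.
by rewrite leNgt ltr_cos ?in_itv/= -?leNgt//; apply/andP; split; lra.
Qed.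

Lemma powre_real e a : 0 < a -> powre e a 0 = a `^ e.
Proof.
move=> a0; rewrite /powre mul0r atan0 mulr0 cos0 mulr1 expr0n addr0 lnXn// /powR gt_eqF//.
by congr expR; rewrite -mulr_natr; field.
Qed.

(* [(1 - (c + i s) z^2)^e] *)
Definition pow1Bsq e c s q : R :=
  powre e (1 - (c * (q.1 ^+ 2 - q.2 ^+ 2) - s * (2 * q.1 * q.2)))
    (- (s * (q.1 ^+ 2 - q.2 ^+ 2) + c * (2 * q.1 * q.2))).

Section harmonic.
Variables (e c s : R).
Hypothesis cs1 : c ^+ 2 + s ^+ 2 < 1.
Let A q := 1 - (c * (q.1 ^+ 2 - q.2 ^+ 2) - s * (2 * q.1 * q.2)).
Let B q := - (s * (q.1 ^+ 2 - q.2 ^+ 2) + c * (2 * q.1 * q.2)).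

(** With [z^2 = X + i Y] and [w = c + i s], one has [2 Re (w z^2) <= |w|^2 + |z^2|^2 < 2]. The
    strict bound on [|w|] is what allows points of the circle itself. *)
Let A_gt0 q : nsq q <= 1 -> 0 < A q.
Proof.
rewrite /A /nsq; case: q => x y /= n1.
set X := x ^+ 2 - y ^+ 2; set Y := 2 * x * y.
have XY : X ^+ 2 + Y ^+ 2 <= 1.
  have -> : X ^+ 2 + Y ^+ 2 = (x ^+ 2 + y ^+ 2) ^+ 2 by rewrite /X /Y; ring.
  by rewrite expr_le1// addr_ge0// sqr_ge0.
rewrite subr_gt0; move: X Y XY => X Y XY.
have := cs1; have : 0 <= (c - X) ^+ 2 + (s + Y) ^+ 2 by rewrite addr_ge0// sqr_ge0.
by nra.
Qed.

Lemma continuous_pow1Bsq q : nsq q <= 1 -> {for q, continuous (pow1Bsq e c s)}.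
Proof.
move=> n1; have A0 := A_gt0 n1.
have cX : {for q, continuous (fun q : R * R => q.1 ^+ 2 - q.2 ^+ 2)}.
  exact: (contD (contX (cont_fst q)) (contN (contX (cont_snd q)))).
have cY : {for q, continuous (fun q : R * R => 2 * q.1 * q.2)}.
  exact: (contM (contM (contC 2 q) (cont_fst q)) (cont_snd q)).
have cA : {for q, continuous A}.
  exact: (contD (contC 1 q) (contN (contD (contM (contC c q) cX) (contN (contM (contC s q) cY))))).
have cB : {for q, continuous B}.
  exact: (contN (contD (contM (contC s q) cX) (contM (contC c q) cY))).
have r0 : 0 < A q ^+ 2 + B q ^+ 2 by rewrite ltr_pwDl ?exprn_gt0// sqr_ge0.
have A0' : A q != 0 by rewrite gt_eqF.
have cr : {for q, continuous (fun q => ln (A q ^+ 2 + B q ^+ 2))}.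
  exact: (cont_comp (f := fun q => A q ^+ 2 + B q ^+ 2) (continuous_ln r0) (contD (contX cA) (contX cB))).
have ct : {for q, continuous (fun q => atan (B q / A q))}.
  exact: (cont_comp (f := fun q => B q / A q) (@continuous_atan R _) (contM cB (contV A0' cA))).
exact: (contM (cont_comp (f := fun q => e / 2 * ln (A q ^+ 2 + B q ^+ 2)) (@continuous_expR R _)
    (contM (contC (e / 2) q) cr))
  (cont_comp (f := fun q => e * atan (B q / A q)) (@continuous_cos R _) (contM (contC e q) ct))).
Qed.

Lemma dharm_pow1Bsq q : nsq q < 1 -> dharm (pow1Bsq e c s) q.
Proof.
move=> q1; case: q q1 => x y q1.
have c0 : {for (0 : R), continuous (fun t : R => t)} by exact: cvg_id.
have nx : \forall t \near (0 : R), nsq (x + t, y) < 1.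
  have : {for (0 : R), continuous (fun t => (x + t, y))}.
    exact: (cont_pair (contD (contC x (0 : R)) c0) (contC y (0 : R))).
  by rewrite /prop_for /continuous_at addr0 => H; exact: H (near_nsq_lt1 q1).
have ny : \forall t \near (0 : R), nsq (x, y + t) < 1.
  have : {for (0 : R), continuous (fun t => (x, y + t))}.
    exact: (cont_pair (contC x (0 : R)) (contD (contC y (0 : R)) c0)).
  by rewrite /prop_for /continuous_at addr0 => H; exact: H (near_nsq_lt1 q1).
pose Ax t := A (x + t, y). pose Bx t := B (x + t, y).
pose Ay t := A (x, y + t). pose By t := B (x, y + t).
pose ax t := - (2 * c * (x + t)) + 2 * s * y.
pose bx t := - (2 * s * (x + t)) - 2 * c * y.
pose ay t := 2 * c * (y + t) + 2 * s * x.
pose b_y t := 2 * s * (y + t) - 2 * c * x.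
have dxt t : is_derive t (1 : R) (fun t => x + t) (1 : R).
  by apply: is_derive_eq (derivD (derivC x t) (derivI t)) _; rewrite add0r.
have dyt t : is_derive t (1 : R) (fun t => y + t) (1 : R).
  by apply: is_derive_eq (derivD (derivC y t) (derivI t)) _; rewrite add0r.
have dAx t : is_derive t (1 : R) Ax (ax t).
  apply: is_derive_eq (derivD (derivC 1 t) (derivN (derivD (derivM (derivC c t)
    (derivD (derivX2 (dxt t)) (derivC (- y ^+ 2) t))) (derivN (derivM (derivC s t)
    (derivM (derivM (derivC 2 t) (dxt t)) (derivC y t))))))) _.
  by rewrite /ax; ring.
have dBx t : is_derive t (1 : R) Bx (bx t).
  apply: is_derive_eq (derivN (derivD (derivM (derivC s t)
    (derivD (derivX2 (dxt t)) (derivC (- y ^+ 2) t))) (derivM (derivC c t)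
    (derivM (derivM (derivC 2 t) (dxt t)) (derivC y t))))) _.
  by rewrite /bx; ring.
have dAy t : is_derive t (1 : R) Ay (ay t).
  apply: is_derive_eq (derivD (derivC 1 t) (derivN (derivD (derivM (derivC c t)
    (derivD (derivC (x ^+ 2) t) (derivN (derivX2 (dyt t))))) (derivN (derivM (derivC s t)
    (derivM (derivC (2 * x) t) (dyt t))))))) _.
  by rewrite /ay; ring.
have dBy t : is_derive t (1 : R) By (b_y t).
  apply: is_derive_eq (derivN (derivD (derivM (derivC s t)
    (derivD (derivC (x ^+ 2) t) (derivN (derivX2 (dyt t))))) (derivM (derivC c t)
    (derivM (derivC (2 * x) t) (dyt t))))) _.
  by rewrite /b_y; ring.
have dax t : is_derive t (1 : R) ax (- (2 * c)).
  apply: is_derive_eq (derivD (derivN (derivM (derivC (2 * c) t) (dxt t))) (derivC (2 * s * y) t)) _; ring.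
have dbx t : is_derive t (1 : R) bx (- (2 * s)).
  apply: is_derive_eq (derivD (derivN (derivM (derivC (2 * s) t) (dxt t))) (derivC (- (2 * c * y)) t)) _; ring.
have day t : is_derive t (1 : R) ay (2 * c).
  apply: is_derive_eq (derivD (derivM (derivC (2 * c) t) (dyt t)) (derivC (2 * s * x) t)) _; ring.
have dby t : is_derive t (1 : R) b_y (2 * s).
  apply: is_derive_eq (derivD (derivM (derivC (2 * s) t) (dyt t)) (derivC (- (2 * c * x)) t)) _; ring.
have Ax0 : 0 < Ax 0 by apply: A_gt0; rewrite addr0 ltW.
have Ay0 : 0 < Ay 0 by apply: A_gt0; rewrite addr0 ltW.
(* The second derivative of [Re Z^e], for [Z = f + i g], is the real part of [e ((e - 1) Z^(e - 2)
   Z'^2 + Z^(e - 1) Z'')]. From the first axis to the second, [Z'] is multiplied by [i], so [Z'^2]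
   and [Z''] change sign and the two second derivatives cancel. *)
have second (f g df dg : R -> R) k l : 0 < f 0 ->
    is_derive (0 : R) (1 : R) f (df 0) -> is_derive (0 : R) (1 : R) g (dg 0) ->
    is_derive (0 : R) (1 : R) df k -> is_derive (0 : R) (1 : R) dg l ->
    is_derive (0 : R) (1 : R) (fun t => e * (powre (e - 1) (f t) (g t) * df t -
      powim (e - 1) (f t) (g t) * dg t))
      (e * ((e - 1) * (powre (e - 1 - 1) (f 0) (g 0) * (df 0 ^+ 2 - dg 0 ^+ 2) -
         2 * powim (e - 1 - 1) (f 0) (g 0) * df 0 * dg 0) +
         powre (e - 1) (f 0) (g 0) * k - powim (e - 1) (f 0) (g 0) * l)).
  move=> f0 hf hg hdf hdg.
  have [h1 h2] := powre_powim_derive (e - 1) f0 hf hg.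
  apply: is_derive_eq (derivM (derivC e 0) (derivD (derivM h1 hdf) (derivN (derivM h2 hdg)))) _.
  ring.
apply: (@dharm_second_derivatives (pow1Bsq e c s) (x, y)
  (fun t => e * (powre (e - 1) (Ax t) (Bx t) * ax t - powim (e - 1) (Ax t) (Bx t) * bx t))
  (fun t => e * (powre (e - 1) (Ay t) (By t) * ay t - powim (e - 1) (Ay t) (By t) * b_y t)) _ _ _
  (second _ _ _ _ _ _ Ax0 (dAx 0) (dBx 0) (dax 0) (dbx 0)) _
  (second _ _ _ _ _ _ Ay0 (dAy 0) (dBy 0) (day 0) (dby 0))).
- near=> t.
  have tn : 0 < Ax t by apply/A_gt0/ltW; near: t.
  by have [] := powre_powim_derive e tn (dAx t) (dBx t).
- near=> t.
  have tn : 0 < Ay t by apply/A_gt0/ltW; near: t.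
  by have [] := powre_powim_derive e tn (dAy t) (dBy t).
- have -> : Ay 0 = Ax 0 by rewrite /Ay /Ax !addr0.
  have -> : By 0 = Bx 0 by rewrite /By /Bx !addr0.
  rewrite /ax /bx /ay /b_y !addr0; ring.
Unshelve. all: by end_near. Qed.

End harmonic.
End complex_powers.

(** * The Poisson formula on smaller circles *)

Section harmonic_poisson.
Context {R : realType}.
Implicit Types (u : R * R -> R) (q v : R * R) (t : R).

Lemma is_derive_line u q v t : derivable u (q + t *: v) v ->
  is_derive t (1 : R) (fun x : R => u (q + x *: v)) ('D_v u (q + t *: v)).
Proof.
have E : (fun h : R => h^-1 *: (((fun x : R => u (q + x *: v)) \o shift t) (h *: (1 : R)) - u (q + t *: v))) =
    (fun h : R => h^-1 *: ((u \o shift (q + t *: v)) (h *: v) - u (q + t *: v))).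
  apply/funext => h /=; congr (_ *: (u _ - _)).
  have -> : h *: (1 : R) = h by rewrite /GRing.scale/= mulr1.
  by rewrite scalerDl addrCA.
by move=> H; split; rewrite /derivable /derive E.
Qed.

Lemma real_harmonic_dharm (D : set (R * R)) u q : real_harmonic D u -> open D -> D q ->
  dharm u q.
Proof.
move=> [c2 lap] oD Dq.
have line b : q + 0 *: axis R b = q by rewrite scale0r addr0.
have nD b : \forall t \near (0 : R), D (q + t *: axis R b).
  have : (fun t : R => q + t *: axis R b) @ (0 : R) --> q + 0 *: axis R b.
    apply: cvgD; first exact: cvg_cst.
    by apply: cvgZr_tmp; exact: cvg_id.
  by move=> /(_ D); apply; rewrite /= line; exact: open_nbhs_nbhs.
have d1 b : \forall t \near (0 : R), is_derive t (1 : R) (fun t => u (q + t *: axis R b))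
    ('D_(axis R b) u (q + t *: axis R b)).
  by apply: filterS (nD b) => t /c2[_ /(_ b)[db _] _]; exact: is_derive_line.
have d2 b : is_derive (0 : R) (1 : R) (fun t : R => 'D_(axis R b) u (q + t *: axis R b))
    ('D_(axis R b) ('D_(axis R b) u) q).
  rewrite -[X in is_derive _ _ _ ('D_(_) _ X)](line b).
  apply: (@is_derive_line ('D_(axis R b) u)); rewrite line.
  by have [_ _ /(_ b b)[]] := c2 q Dq.
have E0 (g : R * R -> R) : (fun t : R => g (q + t *: axis R false)) = (fun t => g (q.1 + t, q.2)).
  by apply/funext => t; congr g; rewrite [LHS]surjective_pairing/= /GRing.scale/= mulr1 mulr0 addr0.
have E1 (g : R * R -> R) : (fun t : R => g (q + t *: axis R true)) = (fun t => g (q.1, q.2 + t)).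
  by apply/funext => t; congr g; rewrite [LHS]surjective_pairing/= /GRing.scale/= mulr1 mulr0 addr0.
have := d1 false; have := d1 true; rewrite E0 E1 => H1 H0.
exact: (dharm_second_derivatives H0 (d2 false) H1 (d2 true) (lap q Dq)).
Qed.

Lemma dharm_scale u q (r : R) : 0 < r -> dharm u (r * q.1, r * q.2) ->
  dharm (fun z => u (r * z.1, r * z.2)) q.
Proof.
move=> r0; rewrite /dharm => H.
have rh : (fun h : R => r * h) @ (0 : R)^'+ --> (0 : R)^'+.
  move=> A; rewrite /nbhs/= /at_right /within/= => HA.
  have : (fun h : R => r * h) @ (0 : R) --> (0 : R).
    have c0 : {for (0 : R), continuous (fun t : R => t)} by exact: cvg_id.
    by have := contM (contC r (0 : R)) c0; rewrite /prop_for /continuous_at mulr0.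
  move=> /(_ _ HA) HB; apply: (@filterS _ (nbhs (0 : R)) _ _ _ _ HB) => h /= Hh h0.
  by apply: Hh; rewrite mulr_gt0.
have : r ^+ 2 * (dlap u (r * q.1, r * q.2) (r * h) / (r * h) ^+ 2) @[h --> (0 : R)^'+] --> r ^+ 2 * 0.
  exact: (@cvgMl_tmp _ _ _ _ _ _ _ (cvg_comp _ _ rh H)).
rewrite mulr0; apply: cvg_trans; apply: near_eq_cvg; near=> h.
have h0 : 0 < h by near: h; exact: nbhs_right_gt.
rewrite /dlap/= !mulrDr !mulrN; field; by rewrite !gt_eqF.
Unshelve. all: by end_near. Qed.

Lemma open_nsq_lt1 : open [set q : R * R | nsq q < 1].
Proof. by move=> q /= q1; exact: near_nsq_lt1. Qed.

Lemma nsq_scale (r : R) q : nsq (r * q.1, r * q.2) = r ^+ 2 * nsq q.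
Proof. by rewrite /nsq/= !exprMn mulrDr. Qed.

(** Dilation by [r < 1] provides the continuity up to the circle that [poisson_formula] asks for. *)
Lemma real_harmonic_poisson u q (r : R) :
  real_harmonic [set q | nsq q < 1] u -> 0 < r < 1 -> nsq q < 1 ->
  u (r * q.1, r * q.2) = poisson_int (fun t => u (r * cos t, r * sin t)) q.
Proof.
move=> hu /andP[r0 r1] q1.
have rn z : nsq z <= 1 -> nsq (r * z.1, r * z.2) < 1.
  have : 0 <= nsq z by rewrite addr_ge0// sqr_ge0.
  by rewrite nsq_scale; nra.
apply: (poisson_formula (u := fun z => u (r * z.1, r * z.2))) => //.
- move=> z /rn z1.
  have [cu _ _] := hu.1 _ z1.
  apply: (@continuous_comp _ _ _ (fun z : R * R => (r * z.1, r * z.2)) u z) => //.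
  exact: (cont_pair (contM (contC r z) (cont_fst z)) (contM (contC r z) (cont_snd z))).
- move=> z z1; apply: dharm_scale => //.
  by apply: real_harmonic_dharm hu open_nsq_lt1 _; exact/rn/ltW.
Qed.

End harmonic_poisson.

(** * Poisson integrals of powers of a chord *)

Section circle_powers.
Context {R : realType}.
Notation mu := (@lebesgue_measure R).
Implicit Types (e s t r x a : R).

Lemma cont_powR a x : 0 < x -> {for x, continuous (@powR R ^~ a)}.
Proof.
by move=> /(@is_derive1_powR R a)[/derivable1_diffP/differentiable_continuous].
Qed.

Arguments cont_powR : clear implicits.
Arguments cont_powR a [x].

(* [|1 - rho e^{2 i (t - s)}|^2] *)
Definition chord2 (rho s t : R) : R := (1 - rho) ^+ 2 + 4 * rho * sin (t - s) ^+ 2.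

Lemma chord2_gt0 (rho s t : R) : 0 <= rho < 1 -> 0 < chord2 rho s t.
Proof.
move=> /andP[r0 r1]; rewrite ltr_pwDl ?exprn_gt0 ?subr_gt0//.
by rewrite mulr_ge0 ?sqr_ge0// mulr_ge0.
Qed.

Lemma continuous_chord2 (rho s : R) : continuous (chord2 rho s).
Proof.
move=> t; have c0 : {for t, continuous (fun t : R => t)} by exact: cvg_id.
exact: (contD (contC ((1 - rho) ^+ 2) t) (contM (contC (4 * rho) t)
  (contX (cont_comp (@continuous_sin R _) (contD c0 (contC (- s) t)))))).
Qed.

Lemma continuous_chord2_powR (rho s e : R) : 0 <= rho < 1 ->
  continuous (fun t => chord2 rho s t `^ e).
Proof.
move=> r01 t; exact: (@cont_comp _ _ (@powR R ^~ e) (chord2 rho s) t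
  (cont_powR e (chord2_gt0 s t r01)) (@continuous_chord2 rho s t)).
Qed.

(** The function is [Re (1 - rho e^{-2is} z^2)^e]. The rotation makes the base real and positive at
    [z = r e^{is}], where it is [1 - rho r^2], and the modulus of the base at [e^{it}] is the square
    root of [chord2 rho s t]. *)
Lemma pk_chord2_le (rho s e r : R) : 0 <= rho < 1 -> `|e| <= 1 -> -1 < r < 1 ->
  cos (e * (pi / 2)) * \int[mu]_(t in `[0, 2 * pi])
    (pk (r * cos s, r * sin s) t * chord2 rho s t `^ (e / 2)) <=
  2 * pi * (1 - rho * r ^+ 2) `^ e.
Proof.
move=> rho01 e1 /andP[rN1 r1]; have [rho0 rho1] := andP rho01.
have p0 := @pi2_gt0 R.
(* [c + i d] is [rho e^{-2is}]. *)
pose c := rho * (cos s ^+ 2 - sin s ^+ 2); pose d := - (2 * rho * cos s * sin s).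
have cs := cos2Dsin2 s.
have cd1 : c ^+ 2 + d ^+ 2 < 1.
  have -> : c ^+ 2 + d ^+ 2 = rho ^+ 2 * (cos s ^+ 2 + sin s ^+ 2) ^+ 2 by rewrite /c /d; ring.
  by rewrite cs; nra.
set q := (r * cos s, r * sin s).
have q1 : nsq q < 1.
  have -> : nsq q = r ^+ 2 * (cos s ^+ 2 + sin s ^+ 2) by rewrite /nsq /q/=; ring.
  by rewrite cs; nra.
have := poisson_formula (u := pow1Bsq e c d) (continuous_pow1Bsq (e := e) cd1)
  (dharm_pow1Bsq e cd1) q1.
have -> : pow1Bsq e c d q = (1 - rho * r ^+ 2) `^ e.
  rewrite -powre_real; last by nra.
  rewrite /pow1Bsq; apply: (f_equal2 (powre e)); rewrite /c /d /q/=; last by ring.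
  have -> : r ^+ 2 = r ^+ 2 * (cos s ^+ 2 + sin s ^+ 2) ^+ 2 by rewrite cs expr1n mulr1.
  by ring.
move=> ->; rewrite /poisson_int mulVKf ?gt_eqF//.
have cC := @continuous_chord2_powR rho s (e / 2) rho01.
rewrite -RintegralZl//; last exact/continuous_itv_integrable/continuous_pkM.
apply: le_Rintegral => //.
- apply: continuous_itv_integrable => t.
  have H : {for t, continuous (fun t => pk q t * chord2 rho s t `^ (e / 2))}.
    exact: continuous_pkM.
  exact: (contM (contC (cos (e * (pi / 2))) t) H).
- apply: continuous_itv_integrable => t; apply: continuous_pkM => // {}t.
  apply: (@continuous_comp _ _ _ (fun t => (cos t, sin t)) (pow1Bsq e c d) t).
    exact: (cont_pair (@continuous_cos R t) (@continuous_sin R t)).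
  by apply: continuous_pow1Bsq => //; rewrite /nsq/= cos2Dsin2.
move=> t _; rewrite mulrCA; apply: ler_wpM2l; first exact: pk_ge0.
(* [a + i b] is [e^{i(t - s)}], and [X + i Y] below is [1 - rho (a + i b)^2]. *)
set a := cos t * cos s + sin t * sin s; set b := sin t * cos s - cos t * sin s.
have ab1 : a ^+ 2 + b ^+ 2 = 1.
  have -> : a ^+ 2 + b ^+ 2 = (cos t ^+ 2 + sin t ^+ 2) * (cos s ^+ 2 + sin s ^+ 2).
    by rewrite /a /b; ring.
  by rewrite !cos2Dsin2 mulr1.
rewrite /pow1Bsq /=; set X := (1 - (_ - _)); set Y := (- _ : R).
have XE : X = 1 - rho * (a ^+ 2 - b ^+ 2) by rewrite /X /c /d /a /b; ring.
have YE : Y = - (2 * rho * a * b).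
  rewrite /Y /c /d.
  have -> : 2 * rho * a * b = rho * (cos t * sin t * (cos s ^+ 2 - sin s ^+ 2) * 2 -
     (cos t ^+ 2 - sin t ^+ 2) * cos s * sin s * 2) by rewrite /a /b; ring.
  ring.
have -> : chord2 rho s t = X ^+ 2 + Y ^+ 2.
  rewrite XE YE /chord2 sinB -/b.
  have -> : (1 - rho * (a ^+ 2 - b ^+ 2)) ^+ 2 + (- (2 * rho * a * b)) ^+ 2 =
    1 - 2 * rho * (a ^+ 2 - b ^+ 2) + rho ^+ 2 * (a ^+ 2 + b ^+ 2) ^+ 2 by ring.
  have -> : a ^+ 2 = 1 - b ^+ 2 by rewrite -ab1; ring.
  by ring.
apply: powre_ge => //; rewrite XE.
have b0 : 0 <= b ^+ 2 := sqr_ge0 _.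
have : rho * (a ^+ 2 - b ^+ 2) <= rho * 1 by apply: ler_wpM2l => //; lra.
lra.
Qed.

End circle_powers.

(** * The limit case: Poisson integrals of powers of the sine *)

Section schur_weights.
Context {R : realType}.
Notation mu := (@lebesgue_measure R).
Implicit Types (e s t r x a c : R).

Lemma EFin_Rintegral d (T : measurableType d) (m : {measure set T -> \bar R})
    (D : set T) (f : T -> R) : measurable D -> m.-integrable D (EFin \o f) ->
  (\int[m]_(x in D) f x)%:E = (\int[m]_(x in D) (f x)%:E)%E.
Proof. by move=> mD /(integrable_fin_num mD) If; rewrite /Rintegral fineK. Qed.

Lemma continuous_norm_powR c : 0 < c -> continuous (fun x : R => `|x| `^ c).
Proof.
move=> c0 x; have [->|x0] := eqVneq x 0; last first.
  apply: (@cont_comp _ _ (@powR R ^~ c) Num.norm x); last exact: norm_continuous.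
  by apply: cont_powR; rewrite normr_gt0.
rewrite /continuous_at normr0 powR0 ?gt_eqF//; apply/cvgrPdist_lt => e e0.
have d0 : 0 < e `^ c^-1 by rewrite powR_gt0.
near=> y; rewrite sub0r normrN ger0_norm ?powR_ge0//.
have yd : `|y| < e `^ c^-1.
  rewrite -normrN -[- y]sub0r; near: y.
  exact: (@cvgr_dist_lt _ _ _ (nbhs (0 : R)) _ id 0 cvg_id _ d0).
have -> : e = (e `^ c^-1) `^ c by rewrite -powRrM mulVf ?gt_eqF// powRr1// ltW.
by apply: gt0_ltr_powR; rewrite ?nnegrE// powR_ge0.
Unshelve. all: by end_near. Qed.

Lemma continuous_sin_powR c s : 0 < c -> continuous (fun t : R => `|sin (t - s)| `^ c).
Proof.
move=> c0 t; have c1 : {for t, continuous (fun t : R => t)} by exact: cvg_id.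
have cs : {for t, continuous (fun t : R => sin (t - s))}.
  exact: (cont_comp (@continuous_sin R _) (contD c1 (contC (- s) t))).
exact: (@cont_comp _ _ (fun x => `|x| `^ c) _ t (@continuous_norm_powR c c0 _) cs).
Qed.

Lemma nsq_polar r s : nsq (r * cos s, r * sin s) = r ^+ 2.
Proof. by rewrite /nsq/= !exprMn -mulrDr cos2Dsin2 mulr1. Qed.

Lemma nsq_polar_lt1 r s : -1 < r < 1 -> nsq (r * cos s, r * sin s) < 1.
Proof. by move=> /andP[? ?]; rewrite nsq_polar; nra. Qed.

Lemma sqr_powR_half x c : (4 * x ^+ 2) `^ (c / 2) = 2 `^ c * `|x| `^ c.
Proof.
rewrite -powRM// [c / 2]mulrC powRrM; congr (_ `^ _).
have -> : 4 * x ^+ 2 = (2 * `|x|) ^+ 2 by rewrite exprMn real_normK ?num_real//; ring.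
rewrite -powR_mulrn; last by rewrite mulr_ge0.
by rewrite -powRrM mulfV ?pnatr_eq0// powRr1// mulr_ge0.
Qed.

Lemma cos_pi2M_gt0 c : `|c| < 1 -> 0 < cos (c * (pi / 2)) :> R.
Proof.
rewrite ltr_norml => /andP[c0 c1]; have p0 := pi_gt0 R; apply: cos_gt0_pihalf.
by apply/andP; split; nra.
Qed.

(** For a positive exponent, [chord2 rho s t >= 4 rho sin^2 (t - s)] compares the integrals directly
    at the cost of a factor [rho^(c / 2)]; both sides are continuous at [rho = 1]. *)
Lemma integral_pk_sin_powR c r s : 0 < c < 1 -> -1 < r < 1 ->
  2 `^ c * \int[mu]_(t in `[0, 2 * pi])
     (pk (r * cos s, r * sin s) t * `|sin (t - s)| `^ c) <=
  2 * pi / cos (c * (pi / 2)) * (1 - r ^+ 2) `^ c.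
Proof.
move=> /andP[c0 c1] r1; set q := (r * cos s, _).
have q1 : nsq q < 1 by exact: nsq_polar_lt1.
have k0 : 0 < cos (c * (pi / 2)) :> R by rewrite cos_pi2M_gt0// gtr0_norm.
have cS := @continuous_sin_powR c s c0.
set I := \int[mu]_(t in _) _.
have bnd (rho : R) : 0 < rho < 1 -> rho `^ (c / 2) * (2 `^ c * I) <=
    2 * pi / cos (c * (pi / 2)) * (1 - rho * r ^+ 2) `^ c.
  move=> /andP[rho0 rho1]; have rho01 : 0 <= rho < 1 by rewrite ltW.
  have ce : `|c| <= 1 by rewrite gtr0_norm// ltW.
  rewrite mulrAC ler_pdivlMr// mulrC; apply: le_trans (@pk_chord2_le R rho s c r rho01 ce r1).
  rewrite ler_pM2l// mulrA -RintegralZl//; last exact/continuous_itv_integrable/continuous_pkM.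
  have cC := @continuous_chord2_powR R rho s (c / 2) rho01.
  apply: le_Rintegral => //.
  - apply: continuous_itv_integrable => t.
    have H : {for t, continuous (fun t => pk q t * `|sin (t - s)| `^ c)} by exact: continuous_pkM.
    exact: (contM (contC (rho `^ (c / 2) * 2 `^ c) t) H).
  - exact/continuous_itv_integrable/continuous_pkM.
  move=> t _; rewrite mulrCA; apply: ler_wpM2l; first exact: pk_ge0.
  rewrite -mulrA -sqr_powR_half -powRM ?(ltW rho0) ?(mulr_ge0 _ (sqr_ge0 _))//.
  apply: ge0_ler_powR; rewrite ?nnegrE.
  - by rewrite divr_ge0// ltW.
  - by apply: mulr_ge0; [exact: ltW|exact: mulr_ge0 (ler0n _ _) (sqr_ge0 _)].
  - exact/ltW/chord2_gt0.
  - by rewrite /chord2 mulrCA mulrA lerDr sqr_ge0.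
have r21 : 0 < 1 - r ^+ 2 by rewrite -(nsq_polar r s) subr_gt0.
have cid : {for 1, continuous (fun t : R => t)} by exact: cvg_id.
have L1 : {for 1, continuous (fun rho : R => rho `^ (c / 2) * (2 `^ c * I))}.
  have H : {for 1, continuous (fun rho : R => rho `^ (c / 2))} by exact: cont_powR.
  exact: (contM H (contC (2 `^ c * I) (1 : R))).
have L2 : {for 1, continuous (fun rho : R => 2 * pi / cos (c * (pi / 2)) * (1 - rho * r ^+ 2) `^ c)}.
  have H : {for 1, continuous (fun rho : R => (1 - rho * r ^+ 2) `^ c)}.
    apply: (@cont_comp _ _ (@powR R ^~ c) (fun rho : R => 1 - rho * r ^+ 2)).
      by apply: cont_powR; rewrite mul1r.
    exact: (contD (contC 1 (1 : R)) (contN (contM cid (contC (r ^+ 2) (1 : R))))).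
  exact: (contM (contC (2 * pi / cos (c * (pi / 2))) (1 : R)) H).
move/cvg_at_left_filter : L1; move/cvg_at_left_filter : L2; rewrite mul1r powR1 mul1r => L2 L1.
apply: (ler_cvg_to L1 L2); near=> rho; apply: bnd; apply/andP; split.
  by near: rho; exact: nbhs_left_gt.
by near: rho; exact: nbhs_left_lt.
Unshelve. all: by end_near. Qed.

Lemma le_limn_einf (u : (\bar R)^nat) x : (forall n, x%:E <= u n)%E -> (x%:E <= limn_einf u)%E.
Proof.
move=> xu; rewrite limn_einf_lim; apply: lime_ge; first exact: is_cvg_einfs.
by apply: nearW => n; apply: le_ereal_inf_tmp => _ [k /= _ <-].
Qed.

Lemma limn_einf_le (u : (\bar R)^nat) (y : \bar R) :
  (forall n, u n <= y)%E -> (limn_einf u <= y)%E.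
Proof.
move=> ux; rewrite limn_einf_lim; apply: lime_le; first exact: is_cvg_einfs.
apply: nearW => n; apply: le_trans (ux n).
by apply: ereal_inf_lbound; exists n => /=.
Qed.

(** For a negative exponent the comparison of [chord2] with the sine goes the wrong way and the
    limit integrand is unbounded. Fatou's lemma along [rho n = 1 - 1 / (n + 1)] replaces it, the
    bound being uniform in [n] since [1 - rho r^2 >= 1 - r^2]. *)
Lemma integral_pk_sin_powRN c r s : 0 < c < 1 -> -1 < r < 1 ->
  (\int[mu]_(t in `[0%R, (2 * pi)%R])
     (pk (r * cos s, r * sin s) t * `|sin (t - s)| `^ (- c))%:E <=
  (2 `^ c * (2 * pi / cos (c * (pi / 2)) * (1 - r ^+ 2) `^ (- c)))%:E)%E.
Proof.
move=> /andP[c0 c1] r1; set q := (r * cos s, _).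
have q1 : nsq q < 1 by exact: nsq_polar_lt1.
have k0 : 0 < cos (c * (pi / 2)) :> R by rewrite cos_pi2M_gt0// gtr0_norm.
have r21 : 0 < 1 - r ^+ 2 by rewrite -(nsq_polar r s) subr_gt0.
pose rho n : R := 1 - harmonic n.
have rho01 n : 0 <= rho n < 1.
  by rewrite subr_ge0 invf_le1// ler1n/= ltrBlDr ltrDl invr_gt0.
have cC n := @continuous_chord2_powR R (rho n) s (- c / 2) (rho01 n).
pose f n t := (2 `^ c * (pk q t * chord2 (rho n) s t `^ (- c / 2)))%:E.
have cf n : continuous (fun t => 2 `^ c * (pk q t * chord2 (rho n) s t `^ (- c / 2))).
  move=> t; have H : {for t, continuous (fun t => pk q t * chord2 (rho n) s t `^ (- c / 2))}.
    exact: continuous_pkM.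
  exact: (contM (contC (2 `^ c) t) H).
have mf n : measurable_fun (`[0, 2 * pi]%classic : set R) (f n).
  apply/measurable_EFinP; apply: measurable_funTS; exact: continuous_measurable_fun.
have f0 n x : `[0, 2 * pi]%classic x -> (0 <= f n x)%E.
  by move=> _; rewrite lee_fin mulr_ge0 ?powR_ge0// mulr_ge0 ?powR_ge0// pk_ge0.
have := fatou mu (measurable_itv _) mf f0.
move/(fun H => le_trans H (limn_einf_le (y := (2 `^ c * (2 * pi / cos (c * (pi / 2)) * (1 - r ^+ 2) `^ (- c)))%:E) _)).
have fi n : (\int[mu]_(t in `[0%R, (2 * pi)%R]) f n t <=
    (2 `^ c * (2 * pi / cos (c * (pi / 2)) * (1 - r ^+ 2) `^ (- c)))%:E)%E.
  rewrite -EFin_Rintegral//; last exact: continuous_itv_integrable.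
  rewrite lee_fin.
  rewrite RintegralZl//; last exact/continuous_itv_integrable/continuous_pkM.
  rewrite ler_pM2l ?powR_gt0// mulrAC ler_pdivlMr// mulrC.
  have := @pk_chord2_le R (rho n) s (- c) r (rho01 n) _ r1.
  rewrite mulNr cosN normrN gtr0_norm// => /(_ (ltW c1))/le_trans; apply.
  rewrite ler_pM2l ?pi2_gt0//.
  rewrite !powRN lef_pV2 ?posrE ?powR_gt0//; last by have := rho01 n; nra.
  have /andP[h0 h1] := rho01 n; have r20 : 0 <= r ^+ 2 := sqr_ge0 _.
  by apply: ge0_ler_powR; rewrite ?nnegrE; [exact: ltW|exact: ltW|nra|nra].
move/(_ fi); apply: le_trans; apply: ge0_le_integral => //.
- by move=> t _; rewrite lee_fin mulr_ge0 ?powR_ge0// pk_ge0.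
- apply/measurable_EFinP; apply: measurable_funM.
    by apply: measurable_funTS; apply: continuous_measurable_fun; exact: continuous_pk2.
  apply: measurable_funTS; apply: (measurableT_comp (measurable_powR (- c))).
  apply: measurableT_comp => //; apply: continuous_measurable_fun => t.
  have c2 : {for t, continuous (fun t : R => t)} by exact: cvg_id.
  exact: (cont_comp (@continuous_sin R _) (contD c2 (contC (- s) t))).
- have -> : (fun t => limn_einf (f ^~ t)) = (fun t => - limn_esup (fun n => - f n t))%E.
    by apply/funext => t; rewrite -limn_einfN; congr limn_einf; apply/funext => n; exact/esym/oppeK.
  apply: measurableT_comp => //; apply: (@measurable_fun_limn_esup _ _ _ _ (fun n t => - f n t)%E) => n.
  by apply: (measurableT_comp (f := -%E)) => //; exact: mf.
(* At a zero of the sine, [powR] with a nonzero exponent returns 0, so the inequality there is mere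
   nonnegativity. *)
move=> t tI; have [s0|s0] := eqVneq (sin (t - s)) 0.
  by rewrite s0 normr0 powR0 ?mulr0 ?oppr_eq0 ?gt_eqF//; apply: le_limn_einf => n; exact: f0.
have L : f ^~ t @ \oo --> (pk q t * `|sin (t - s)| `^ (- c))%:E.
  have -> : `|sin (t - s)| `^ (- c) = 2 `^ c * (4 * sin (t - s) ^+ 2) `^ (- c / 2).
    rewrite sqr_powR_half mulrA -powRD; last by rewrite subrr eqxx/= pnatr_eq0.
    by rewrite subrr powRr0 mul1r.
  rewrite mulrCA; apply: cvg_EFin; first exact: nearW.
  have rl : rho n @[n --> \oo] --> (1 : R).
    by rewrite -[X in _ --> X]subr0; apply: cvgB; [exact: cvg_cst|exact: cvg_harmonic].
  have cid : {for 1, continuous (fun t : R => t)} by exact: cvg_id.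
  have H : {for 1, continuous (fun x : R => chord2 x s t `^ (- c / 2))}.
    apply: (@cont_comp _ _ (@powR R ^~ (- c / 2)) (fun x : R => chord2 x s t)).
      apply: cont_powR; rewrite /chord2 subrr expr0n mulr1 add0r mulr_gt0//.
      by rewrite exprn_even_gt0.
    exact: (contD (contX (contD (contC 1 (1 : R)) (contN cid)))
      (contM (contM (contC 4 (1 : R)) cid) (contC (sin (t - s) ^+ 2) (1 : R)))).
  have H2 := contM (contC (2 `^ c) (1 : R)) (contM (contC (pk q t) (1 : R)) H).
  have := cvg_comp _ _ rl H2; rewrite /chord2 subrr expr0n mulr1 add0r.
  exact.
by rewrite (cvg_limn_einf_sup L).1.
Qed.

End schur_weights.

(** * The integral along a diameter *)

Section radial_integral.
Context {R : realType}.
Notation mu := (@lebesgue_measure R).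
Implicit Types (c x y th : R).

(* [tan (pi / 4 - x / 2)] *)
Let F x : R := cos x / (1 + sin x).

Let F' x : R := - (1 + sin x)^-1.

Let sin1_gt0 x : 0 <= x <= pi -> 0 < 1 + sin x.
Proof. by move=> x0; rewrite ltr_pwDl// sin_ge0_pi. Qed.

Let dF x : 0 < 1 + sin x -> is_derive x (1 : R) F (F' x).
Proof.
move=> s0; have s0' : 1 + sin x != 0 by rewrite gt_eqF.
apply: is_derive_eq (derivM (is_derive_cos x) (derivV (f := fun x => 1 + sin x) s0'
  (derivD (derivC 1 x) (is_derive_sin x)))) _.
rewrite add0r /F'; apply: (mulIf (expf_neq0 2 s0')).
have -> : (- sin x / (1 + sin x) + cos x * (- cos x / (1 + sin x) ^+ 2)) * (1 + sin x) ^+ 2 =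
  - sin x - (cos x ^+ 2 + sin x ^+ 2) by field.
by rewrite cos2Dsin2; field.
Qed.

Let near_sin1 x : 0 < 1 + sin x -> \forall y \near x, 0 < 1 + sin y.
Proof.
move=> s0; have : {for x, continuous (fun y : R => 1 + sin y)}.
  exact: (contD (contC 1 x) (@continuous_sin R x)).
by move/(cvgr_gt _); apply.
Qed.

Let cF' x : 0 < 1 + sin x -> {for x, continuous (F^`()%classic)}.
Proof.
move=> s0; have E y : 0 < 1 + sin y -> (F^`()%classic) y = F' y.
  by move=> /dF[_ <-]; rewrite derive1E.
have s0' : 1 + sin x != 0 by rewrite gt_eqF.
have cF : {for x, continuous F'}.
  exact: (contN (contV (f := fun x => 1 + sin x) s0' (contD (contC 1 x) (@continuous_sin R x)))).
rewrite /prop_for /continuous_at E//; apply: cvg_trans cF; apply: near_eq_cvg.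
by apply: filterS (near_sin1 s0) => y /E ->.
Qed.

Let decrF : {in `[0, pi] &, {homo F : x y /~ (x < y)%R}}.
Proof.
move=> y x; rewrite !in_itv/= => yI xI xy.
have sx := sin1_gt0 xI; have sy := sin1_gt0 yI.
rewrite /F ltr_pdivrMr// mulrAC ltr_pdivlMr// -subr_gt0.
have -> : cos x * (1 + sin y) - cos y * (1 + sin x) = (cos x - cos y) + sin (y - x).
  by rewrite sinB; ring.
apply: ltr_pwDl.
  by rewrite subr_gt0 ltr_cos ?in_itv.
apply: sin_ge0_pi; move: xI yI => /andP[? ?] /andP[? ?]; lra.
Qed.

(** After the substitution the denominator becomes [2 (1 - cos th cos x) / (1 + sin x)], again a
    Poisson denominator. The radial integral is thus at most a multiple of the Poisson integral of
    [|sin|^c] over the upper half circle, and [integral_pk_sin_powR] applies. *)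
Lemma integral_poisson_weight_radial c th : 0 < c < 1 -> sin th != 0 ->
  \int[mu]_(r in `[-1, 1]) (`|1 - r ^+ 2| `^ c / (1 - 2 * r * cos th + r ^+ 2)) <=
  pi / (2 * `|sin th|) * (2 * `|sin th|) `^ c / cos (c * (pi / 2)).
Proof.
move=> /andP[c0 c1] s0; set S : R := `|sin th|.
have S0 : 0 < S by rewrite normr_gt0.
have S2 : S ^+ 2 = 1 - cos th ^+ 2.
  by rewrite /S real_normK ?num_real// -(cos2Dsin2 th); ring.
have pi0 := pi_gt0 R.
pose D (r : R) : R := 1 - 2 * r * cos th + r ^+ 2.
have D0 r : 0 < D r.
  have -> : D r = (r - cos th) ^+ 2 + S ^+ 2 by rewrite S2 /D; ring.
  by rewrite ltr_wpDl ?sqr_ge0// exprn_gt0.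
pose G (r : R) : R := `|1 - r ^+ 2| `^ c / D r.
have cG : continuous G.
  move=> r; have cid : {for r, continuous (fun r : R => r)} by exact: cvg_id.
  have c_1 : {for r, continuous (fun r : R => `|1 - r ^+ 2| `^ c)}.
    apply: (@cont_comp _ _ (fun x : R => `|x| `^ c) (fun r : R => 1 - r ^+ 2)).
      exact: continuous_norm_powR.
    exact: (contD (contC 1 r) (contN (contX cid))).
  have c_2 : {for r, continuous D}.
    exact: (contD (contD (contC 1 r) (contN (contM (contM (contC 2 r) cid) (contC (cos th) r))))
      (contX cid)).
  by apply: (contM c_1 (contV _ c_2)); rewrite gt_eqF.
have F0 : F 0 = 1 by rewrite /F cos0 sin0 addr0 divr1.
have Fpi : F pi = -1 by rewrite /F cospi sinpi addr0 divr1.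
have p01 : ((0 : R) <= 0) && ((0 : R) <= pi) by rewrite lexx ltW.
have p02 : ((0 : R) <= pi) && ((pi : R) <= pi) by rewrite lexx ltW.
have F'E x : 0 <= x <= pi -> (F^`()%classic) x = F' x.
  by move=> /sin1_gt0/dF[_ <-]; rewrite derive1E.
have cF x : 0 <= x <= pi -> {for x, continuous F}.
  by move=> /sin1_gt0/dF[/derivable1_diffP/differentiable_continuous].
have := @integration_by_substitution_decreasing R F G 0 pi (ltW pi0) decrF.
rewrite F0 Fpi => HF.
have {}HF : (\int[mu]_(x in `[(-1)%R, 1%R]) (G x)%:E =
    \int[mu]_(x in `[0%R, pi]) (((G \o F) * - F^`()%classic) x)%:E)%E.
  apply: HF.
  - by move=> x; rewrite in_itv/= => /andP[x0 xp]; apply/cF'/sin1_gt0; rewrite !ltW.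
  - by apply: cvgP; apply: cvg_at_right_filter; exact/cF'/sin1_gt0.
  - by apply: cvgP; apply: cvg_at_left_filter; exact/cF'/sin1_gt0.
  - split.
    + move=> x; rewrite in_itv/= => /andP[x0 xp].
      by have [] := @dF x _; [apply: sin1_gt0; rewrite !ltW|].
    + by apply: cvg_at_right_filter; exact: cF.
    + by apply: cvg_at_left_filter; exact: cF.
  - exact: continuous_subspaceT.
(* The real point with [2 sg / (1 + sg^2) = cos th]; there the kernel equals
   [S / (1 - cos th cos x)]. *)
pose sg := cos th / (1 + S).
have S1 : 0 < 1 + S by rewrite ltr_wpDl.
have cth : cos th ^+ 2 < 1 by have : 0 < S ^+ 2 by [rewrite exprn_gt0|]; rewrite S2; lra.
have sg1 : -1 < sg < 1.
  rewrite /sg ltr_pdivlMr// ltr_pdivrMr//.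
  by apply/andP; split; nra.
pose h x := pk (sg * cos 0, sg * sin 0) x * `|sin (x - 0)| `^ c.
have q1 := nsq_polar_lt1 0 sg1.
have ch : continuous h by apply: continuous_pkM => //; exact: continuous_sin_powR.
have pkE x : pk (sg * cos 0, sg * sin 0) x = S / (1 - cos th * cos x).
  have d1 : 0 < 1 - cos th * cos x.
    have := cos2Dsin2 x; have : 0 <= sin x ^+ 2 := sqr_ge0 _.
    nra.
  have sgE : sg ^+ 2 = (1 - S) / (1 + S).
    have -> : sg ^+ 2 = (1 - S ^+ 2) / (1 + S) ^+ 2 by rewrite S2 /sg; field; rewrite gt_eqF.
    by field; rewrite gt_eqF.
  rewrite /pk nsq_polar /den/= sin0 cos0 mulr0 mulr1 subr0.
  have -> : (cos x - sg) ^+ 2 + sin x ^+ 2 = 2 / (1 + S) * (1 - cos th * cos x).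
    have -> : (cos x - sg) ^+ 2 + sin x ^+ 2 = (cos x ^+ 2 + sin x ^+ 2) - 2 * sg * cos x + sg ^+ 2 by ring.
    by rewrite cos2Dsin2 sgE /sg; field; rewrite gt_eqF.
  by rewrite sgE; field; rewrite !gt_eqF.
(* As [sg] lies on the real axis, [h] is invariant under [x |-> 2 pi - x]. *)
have half : \int[mu]_(x in `[0, 2 * pi]) h x = 2 * \int[mu]_(x in `[0, pi]) h x.
  pose F2 (x : R) : R := 2 * pi - x.
  have dF2 (x : R) : is_derive x (1 : R) F2 (-1).
    by apply: is_derive_eq (derivD (derivC (2 * pi) x) (derivN (derivI x))) _; rewrite add0r.
  have F2' : F2^`()%classic = cst (-1).
    by apply/funext => x; rewrite derive1E; have [_ ->] := dF2 x.
  have cF2 : continuous F2.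
    by move=> x; have [/derivable1_diffP/differentiable_continuous] := dF2 x.
  have := @integration_by_substitution_decreasing R F2 h 0 pi (ltW pi0).
  have -> : F2 0 = 2 * pi by rewrite /F2 subr0.
  have -> : F2 pi = pi by rewrite /F2; ring.
  move=> H2; have {}H2 : (\int[mu]_(x in `[pi, (2 * pi)%R]) (h x)%:E =
      \int[mu]_(x in `[0%R, pi]) (((h \o F2) * - F2^`()%classic) x)%:E)%E.
    apply: H2.
    - by move=> x y _ _; rewrite /F2 ltrD2l ltrN2.
    - by rewrite F2' => x _; exact: cst_continuous.
    - by rewrite F2'; exact: is_cvg_cst.
    - by rewrite F2'; exact: is_cvg_cst.
    - split.
      + by move=> x _; have [] := dF2 x.
      + by apply: cvg_at_right_filter; exact: cF2.
      + by apply: cvg_at_left_filter; exact: cF2.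
    - exact: continuous_subspaceT.
  have Ih := continuous_itv_integrable (0 : R) (2 * pi) ch.
  have E3 : \int[mu]_(x in `[pi, 2 * pi]) h x = \int[mu]_(x in `[0, pi]) h x.
    rewrite {1}/Rintegral H2; congr fine; apply: eq_integral => x _.
    rewrite F2'; congr EFin; rewrite /= !fctE opprK mulr1 /h !pkE !subr0.
    have -> : cos (F2 x) = cos x by rewrite /F2 cosB mulr_natl cos2pi sin2pi; ring.
    by have -> : sin (F2 x) = - sin x; [rewrite /F2 sinB mulr_natl cos2pi sin2pi; ring|rewrite normrN].
  have := Rintegral_itvB (x := pi) Ih.
  rewrite !bnd_simp (ltW pi0) => /(_ isT) => /(_ _)E4.
  have {}E4 := E4 ltac:(by rewrite mulr_natl mulr2n lerDl ltW).
  rewrite -[LHS](subrK (\int[mu]_(x in `[0, pi]) h x)) E4.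
  rewrite Rintegral_itv_obnd_cbnd ?E3; first by ring.
  apply: integrableS (continuous_itv_integrable (0 : R) (2 * pi) ch) => //.
  by apply: subset_itv; rewrite bnd_simp// ltW.
have bound : \int[mu]_(r in `[-1, 1]) G r <= 2 `^ c / (2 * S) * \int[mu]_(x in `[0, pi]) h x.
  rewrite -RintegralZl//; last exact: continuous_itv_integrable.
  (* On [[0, pi]] this is the transformed integrand; the absolute values make it continuous on the
     whole line. The bound then drops the factor [1 + |sin x| >= 1] from the denominator. *)
  pose g x := `|2 * `|sin x| / (1 + `|sin x|)| `^ c * (pk (sg * cos 0, sg * sin 0) x / (2 * S)).
  have n1 x : 0 < 1 + `|sin x| by rewrite ltr_wpDr.
  have cg : continuous g.
    move=> x; have cs : {for x, continuous (fun x : R => `|sin x|)}.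
      exact: (cont_comp (@norm_continuous _ _ (sin x)) (@continuous_sin R x)).
    have c_1 : {for x, continuous (fun x : R => 2 * `|sin x| / (1 + `|sin x|))}.
      apply: (contM (contM (contC 2 x) cs) (contV _ (contD (contC 1 x) cs))).
      by rewrite gt_eqF.
    apply: (contM (@cont_comp _ _ (fun x : R => `|x| `^ c) _ x (@continuous_norm_powR _ c c0 _) c_1)).
    exact: (contM (continuous_pk2 _ q1 x) (contC ((2 * S)^-1) x)).
  rewrite [X in X <= _]/Rintegral HF.
  have -> : (\int[mu]_(x in `[0%R, pi]) (((G \o F) * - F^`()%classic) x)%:E =
     \int[mu]_(x in `[0%R, pi]) (g x)%:E)%E.
    apply: eq_integral => x; rewrite inE/= in_itv/= => xI; congr EFin; rewrite !fctE/=.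
    have s1 := sin1_gt0 xI; have sx0 : 0 <= sin x by exact: sin_ge0_pi.
    rewrite F'E// /F' opprK /G /g /D pkE (ger0_norm sx0).
    have cs := cos2Dsin2 x.
    have E1 : F x ^+ 2 = (1 - sin x) / (1 + sin x).
      have -> : F x ^+ 2 = cos x ^+ 2 / (1 + sin x) ^+ 2 by rewrite /F; field; rewrite gt_eqF.
      have -> : cos x ^+ 2 = 1 - sin x ^+ 2 by rewrite -cs; ring.
      by field; rewrite gt_eqF.
    have -> : 1 - F x ^+ 2 = 2 * sin x / (1 + sin x) by rewrite E1; field; rewrite gt_eqF.
    rewrite [`|_|]ger0_norm; last by rewrite divr_ge0 ?mulr_ge0// ltW.
    rewrite -[LHS]mulrA; congr (_ * _); rewrite E1 /F.
    have d1 : 0 < 1 - cos th * cos x.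
      have : 0 <= sin x ^+ 2 := sqr_ge0 _.
      nra.
    have d2 : 0 < 1 + sin x - 2 * cos x * cos th + (1 - sin x) by lra.
    by field; rewrite !gt_eqF.
  rewrite -[X in X <= _]/(\int[mu]_(x in `[0, pi]) g x).
  apply: le_Rintegral => //.
  - exact: continuous_itv_integrable.
  - apply: continuous_itv_integrable => x; exact: (contM (contC (2 `^ c / (2 * S)) x) (ch x)).
  move=> x; rewrite /= in_itv/= => xI; rewrite /g /h subr0.
  have pk0 : 0 <= pk (sg * cos 0, sg * sin 0) x by exact: pk_ge0.
  have -> : 2 `^ c / (2 * S) * (pk (sg * cos 0, sg * sin 0) x * `|sin x| `^ c) =
    (2 * `|sin x|) `^ c * (pk (sg * cos 0, sg * sin 0) x / (2 * S)).
    by rewrite powRM//; ring.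
  apply: ler_wpM2r; first by rewrite divr_ge0// mulr_ge0// ltW.
  rewrite ger0_norm; last by rewrite divr_ge0 ?mulr_ge0// ltW.
  apply: ge0_ler_powR; rewrite ?nnegrE; [exact: ltW| |exact: mulr_ge0|].
    by rewrite divr_ge0 ?mulr_ge0// ltW.
  by rewrite ler_pdivrMr// ler_peMr ?mulr_ge0// lerDl.
apply: le_trans bound _.
have := @integral_pk_sin_powR R c sg 0; rewrite c0 c1 => /(_ isT sg1).
rewrite -/h half.
set J := \int[mu]_(x in _) _.
have -> : 1 - sg ^+ 2 = 2 * S / (1 + S).
  have -> : sg ^+ 2 = (1 - S ^+ 2) / (1 + S) ^+ 2 by rewrite S2 /sg; field; rewrite gt_eqF.
  by field; rewrite gt_eqF.
have k0 : 0 < cos (c * (pi / 2)) :> R by rewrite cos_pi2M_gt0// gtr0_norm.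
(* Here [2 * S / (1 + S)] is [1 - sg^2], and the denominator [1 + S >= 1] is dropped. *)
have SS : (2 * S / (1 + S)) `^ c <= (2 * S) `^ c.
  have S20 : 0 <= 2 * S by rewrite mulr_ge0// ltW.
  apply: ge0_ler_powR; rewrite ?nnegrE; [exact: ltW|exact: divr_ge0 S20 (ltW S1)|by []|].
  by rewrite ler_pdivrMr// ler_peMr ?mulr_ge0 ?(ltW S0)// lerDl ltW.
move=> HJ.
have {HJ} : 2 `^ c * (2 * J) <= 2 * pi / cos (c * (pi / 2)) * (2 * S) `^ c.
  by apply: le_trans HJ _; rewrite ler_pM2l// divr_gt0// pi2_gt0.
move=> HJ.
have -> : 2 `^ c / (2 * S) * J = (2 `^ c * (2 * J)) / (4 * S) by field; rewrite gt_eqF.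
have -> : pi / (2 * S) * (2 * S) `^ c / cos (c * (pi / 2)) =
    2 * pi / cos (c * (pi / 2)) * (2 * S) `^ c / (4 * S) by field; rewrite !gt_eqF.
by rewrite ler_pM2r// invr_gt0 mulr_gt0.
Qed.

End radial_integral.

(** * Weak limits along an ultrafilter *)

Section ultrafilter_limits.
Context {R : realType}.

(** The image of an ultrafilter is an ultrafilter, hence converges in the compact segment
    [[- C, C]]. One ultrafilter thus serves all measurable sets at once, without extraction of
    subsequences. *)
Lemma ultra_bounded_cvg (T : Type) (G : set_system T) (h : T -> R) (C : R) :
  UltraFilter G -> (forall t, `|h t| <= C) -> cvg (h @ G).
Proof.
move=> uG hC; have pG := @ultra_proper _ _ uG.
have uhG : UltraFilter (h @ G).
  have pF : ProperFilter (h @ G) by exact: fmap_proper_filter.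
  apply: Build_UltraFilter => H pH sH; apply/seteqP; split=> // A HA.
  have [//|GA] := in_ultra_setVsetC (h @^-1` A) uG.
  have : H (~` A) by exact: sH.
  move=> /(filterI HA); rewrite setICr => H0.
  by case: (@filter_not_empty _ _ pH).
have := @segment_compact R (- C) C; rewrite compact_ultra => /(_ (h @ G) uhG)[].
  rewrite (_ : [set` _] = [set x | -C <= x <= C]); last by apply/seteqP; split => x; rewrite /= in_itv.
  by apply: (@filterS _ G _ setT); [move=> t _; rewrite /= -ler_norml|exact: filterT].
by move=> x [_ hx]; exact: cvgP hx.
Qed.

End ultrafilter_limits.

(* The set function [A |-> lim_G \int_(A & I) u n] is a charge, dominated by the measure
   [mu]; its density is the weak limit of [u]. *)
Section weak_limit.
Context d {T : measurableType d} {R : realType}.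
Variables (mu : {sigma_finite_measure set T -> \bar R}).
Variables (u : nat -> T -> R) (I : set T) (G : set_system nat).
Hypotheses (uG : UltraFilter G) (mI : measurable I) (fI : (mu I < +oo)%E).
Hypothesis iu : forall n, mu.-integrable I (EFin \o u n).
(** Uniform integrability in linear form: [e = 1] bounds the [L^1] norms, and letting [e] tend to 0
    makes the limit charge countably additive and absolutely continuous. *)
Hypothesis ui : forall e : R, 0 < e -> exists2 K : R, 0 <= K & forall n (A : set T),
  measurable A -> \int[mu]_(t in I) (\1_A t * `|u n t|) <= K * fine (mu (A `&` I)) + e.

#[local] Instance pG : ProperFilter G := @ultra_proper _ _ uG.

Let J (s : T -> R) n : R := \int[mu]_(t in I) (s t * u n t).

Definition bounded_measurable (s : T -> R) :=
  measurable_fun I s /\ exists C : R, forall t, I t -> `|s t| <= C.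

Lemma bounded_measurable_indic (A : set T) : measurable A -> bounded_measurable \1_A.
Proof.
by move=> mA; split; [exact: measurable_indic|exists 1 => t _; rewrite indicE ger0_norm// lern1 leq_b1].
Qed.

Lemma bounded_measurableD s1 s2 (k : R) : bounded_measurable s1 -> bounded_measurable s2 ->
  bounded_measurable (fun t => s1 t + k * s2 t).
Proof.
move=> [m1 [C1 s1C]] [m2 [C2 s2C]]; split.
  by apply: measurable_funD => //; apply: measurable_funM.
exists (C1 + `|k| * C2) => t It; rewrite (le_trans (ler_normD _ _))// lerD ?s1C//.
by rewrite normrM ler_wpM2l// s2C.
Qed.

Lemma bounded_measurable_integrable s v : bounded_measurable s ->
  mu.-integrable I (EFin \o v) -> mu.-integrable I (EFin \o (fun t => s t * v t)).
Proof.
move=> [ms [C sC]] iv; have := @integrableMr _ _ _ mu I mI s (EFin \o v) ms _ iv.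
apply; exists C; split; first exact: num_real.
by move=> M CM t It /=; rewrite (le_trans (sC _ It))// ltW.
Qed.

Let JD s1 s2 k n : bounded_measurable s1 -> bounded_measurable s2 ->
  J (fun t => s1 t + k * s2 t) n = J s1 n + k * J s2 n.
Proof.
move=> b1 b2; have i1 := bounded_measurable_integrable b1 (iu n).
have i2 := bounded_measurable_integrable b2 (iu n).
rewrite /J -RintegralZl// -RintegralD//; last exact: (integrableZl mI k i2).
by apply: eq_Rintegral => t _; ring.
Qed.

Let J_le (A : set T) K e : measurable A ->
  (forall n (A : set T), measurable A -> \int[mu]_(t in I) (\1_A t * `|u n t|) <= K * fine (mu (A `&` I)) + e) ->
  forall n, `|J \1_A n| <= K * fine (mu (A `&` I)) + e.
Proof.
move=> mA uiK n; apply: le_trans (uiK n A mA).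
apply: le_trans (le_normr_Rintegral mI _) _.
  by apply: bounded_measurable_integrable => //; exact: bounded_measurable_indic.
rewrite le_eqVlt; apply/orP; left; apply/eqP; apply: eq_Rintegral => t _.
by rewrite normrM indicE [X in X * _]ger0_norm.
Qed.

Let J_cvg (A : set T) : measurable A -> cvg (J \1_A @ G).
Proof.
move=> mA; have [K _ uiK] := ui ltr01.
exact: (ultra_bounded_cvg uG (J_le mA uiK)).
Qed.

Let a (A : set T) : R := lim (J \1_A @ G).

Let a_le (A : set T) K e : measurable A ->
  (forall n (A : set T), measurable A -> \int[mu]_(t in I) (\1_A t * `|u n t|) <= K * fine (mu (A `&` I)) + e) ->
  `|a A| <= K * fine (mu (A `&` I)) + e.
Proof.
move=> mA uiK; rewrite ler_norml; apply/andP; split.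
  apply: limr_ge; first exact: J_cvg.
  by apply: nearW => n; have := J_le mA uiK n; rewrite ler_norml => /andP[].
apply: limr_le; first exact: J_cvg.
by apply: nearW => n; have := J_le mA uiK n; rewrite ler_norml => /andP[].
Qed.

Let aU (A B : set T) : measurable A -> measurable B -> A `&` B = set0 -> a (A `|` B) = a A + a B.
Proof.
move=> mA mB AB; rewrite /a -limD; [|exact: J_cvg..].
congr (lim (_ @ G)); apply/funext => n; rewrite fctE -[X in _ + X]mul1r -JD//; try exact: bounded_measurable_indic.
rewrite /J; apply: eq_Rintegral => t _; congr (_ * _).
rewrite mul1r !indicE in_setU; have := mem_set; case: (boolP (t \in A)) => //= tA; case: (boolP (t \in B)) => //= tB;
  rewrite ?addr0 ?add0r//.
by have : (A `&` B) t by [split; exact: set_mem]; rewrite AB.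
Qed.

Let nu (A : set T) : \bar R := (a A)%:E.

Let a0 : a set0 = 0.
Proof.
have : a (set0 `|` set0) = a set0 + a set0 by apply: aU => //; rewrite setI0.
by rewrite setU0 => /eqP; rewrite -subr_eq0 opprD addrA subrr sub0r oppr_eq0 => /eqP.
Qed.

Let nu0 : nu set0 = 0%E. Proof. by rewrite /nu a0. Qed.

Let nu_fin (A : set T) : measurable A -> nu A \is a fin_num. Proof. by []. Qed.

(** By finite additivity it suffices that [a (W n)] tends to 0 on the tails [W n]. These decrease to
    the empty set inside [I], of finite measure, so [mu (W n]&[I)] tends to 0 and [a_le]
    concludes. *)
Let nu_sigma_additive : semi_sigma_additive nu.
Proof.
move=> A mA tA mUA.
pose U n := \big[setU/set0]_(i < n) A i.
have mU n : measurable (U n) by exact: bigsetU_measurable.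
pose W n := (\bigcup_n A n) `\` U n.
have mW n : measurable (W n) by exact: measurableD.
have sumE n : \sum_(0 <= i < n) nu (A i) = (a (U n))%:E.
  elim: n => [|n IHn]; first by rewrite big_nil /U big_ord0 a0.
  rewrite big_nat_recr//= IHn /U big_ord_recr/= aU//; first exact: mU.
  by apply: (@trivIset_bigsetUI _ predT A) => //; exact: sub_trivIset tA.
have aE n : a (U n) = a (\bigcup_n A n) - a (W n).
  have UT : U n `|` W n = \bigcup_n A n.
    rewrite /W setDUK// => t; rewrite /U -bigcup_mkord => -[k _ Akt].
    by exists k.
  by rewrite -UT aU// ?addrK// /W setDE setICA setICr setI0.
rewrite (_ : (fun n => _) = (fun n => (a (\bigcup_n A n) - a (W n))%:E)); last first.
  by apply/funext => n; rewrite sumE aE.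
apply: cvg_EFin; first exact: nearW.
rewrite -[X in _ --> X]subr0; apply: cvgB; first exact: cvg_cst.
apply/cvgrPdist_le => e e0.
have e2 : 0 < e / 2 by rewrite divr_gt0.
have [K K0 uiK] := ui e2.
have : (mu \o (fun n => W n `&` I)) n @[n --> \oo] --> mu (\bigcap_n (W n `&` I)).
  apply: nonincreasing_cvg_mu.
  - apply: le_lt_trans fI; apply: le_measure; rewrite ?inE//; first exact: measurableI.
  - by move=> n; exact: measurableI.
  - by apply: bigcap_measurable => // n _; exact: measurableI.
  - move=> m n mn; apply/subsetPset => t [[UA nU] It]; split=> //; split=> // Um; apply: nU.
    by move: Um; rewrite /U; exact: subset_bigsetU.
have -> : \bigcap_n (W n `&` I) = set0.
  apply/seteqP; split=> // t Ht; have [[[k _ Akt] _] _] := Ht 0%N Logic.I.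
  have [[_ +] _] := Ht k.+1 Logic.I; apply; rewrite /U big_ord_recr/=; by right.
rewrite measure0 => /fine_cvgP[_ /cvgrPdist_lt].
have K1 : 0 < K + 1 by rewrite ltr_wpDl.
move=> /(_ (e / 2 / (K + 1)) (divr_gt0 e2 K1)); apply: filterS => n /=.
rewrite !sub0r !normrN ger0_norm ?fine_ge0// => Hn.
apply: le_trans (a_le (mW n) uiK) _.
rewrite [leRHS](splitr e) lerD2r.
apply: (@le_trans _ _ ((K + 1) * fine (mu (W n `&` I)))).
  by rewrite ler_wpM2r ?fine_ge0// lerDl.
by rewrite mulrC -ler_pdivlMr// ltW.
Qed.

HB.instance Definition _ := isCharge.Build _ _ _ nu nu0 nu_fin nu_sigma_additive.

Let nu_dom : nu `<< mu.
Proof.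
move=> N mN A mA AN; congr EFin; apply/eqP; rewrite -normr_le0; apply/ler_addgt0Pl => e e0.
have [K K0 uiK] := ui e0; rewrite addr0.
apply: le_trans (a_le mA uiK) _.
have -> : mu (A `&` I) = 0%E.
  by apply/eqP; rewrite eq_le measure_ge0 andbT -(mN A mA AN); apply: le_measure; rewrite ?inE//; exact: measurableI.
by rewrite mulr0 add0r.
Qed.

Theorem ultrafilter_weak_limit : exists phi : T -> R,
  [/\ measurable_fun setT phi, mu.-integrable I (EFin \o phi) &
   forall s, bounded_measurable s -> forall l : R,
     J s n @[n --> G] --> l -> l = \int[mu]_(t in I) (s t * phi t)].
Proof.
have [f [ffin fint fE]] : exists f : T -> \bar R, [/\ (forall x, f x \is a fin_num),
    mu.-integrable [set: T] f &
    forall A, measurable A -> nu A = (\int[mu]_(x in A) f x)%E].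
  exists (Radon_Nikodym nu mu); split.
  - by move=> x; exact: Radon_Nikodym_fin_num.
  - exact: Radon_Nikodym_integrable.
  - by move=> A; exact: Radon_Nikodym_integral.
pose phi t := fine (f t).
have phiE : EFin \o phi = f by apply/funext => t /=; rewrite fineK.
have iphi : mu.-integrable I (EFin \o phi).
  by rewrite phiE; exact: (integrableS measurableT).
have mphi : measurable_fun setT phi.
  by apply/measurable_EFinP; rewrite phiE; exact: measurable_int fint.
exists phi; split => //.
pose P s := \int[mu]_(t in I) (s t * phi t).
have PD s1 s2 k : bounded_measurable s1 -> bounded_measurable s2 ->
    P (fun t => s1 t + k * s2 t) = P s1 + k * P s2.
  move=> b1 b2; have i1 := bounded_measurable_integrable b1 iphi.
  have i2 := bounded_measurable_integrable b2 iphi.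
  rewrite /P -RintegralZl// -RintegralD//; last exact: (integrableZl mI k i2).
  by apply: eq_Rintegral => t _; ring.
have Pindic (A : set T) : measurable A -> J \1_A n @[n --> G] --> P \1_A.
  move=> mA; have -> : P \1_A = a (A `&` I).
    apply: EFin_inj; rewrite [RHS](fE _ (measurableI _ _ mA mI)) -phiE setIC integral_mkcondr.
    rewrite /P EFin_Rintegral//; last exact/bounded_measurable_integrable/iphi/bounded_measurable_indic.
    apply: eq_integral => t _; rewrite patchE indicE; case: ifPn => tA /=; first by rewrite mul1r.
    by rewrite mul0r.
  have -> : J \1_A = J \1_(A `&` I).
    apply/funext => n; apply: eq_Rintegral => t; rewrite inE => It.
    by rewrite !indicE in_setI [t \in I]mem_set// andbT.
  exact: J_cvg (measurableI _ _ mA mI).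
have [C1 C1u] : exists C, forall n, \int[mu]_(t in I) `|u n t| <= C.
  have [K K0 uiK] := ui ltr01; exists (K * fine (mu (setT `&` I)) + 1) => n.
  apply: le_trans (uiK n setT measurableT); rewrite le_eqVlt; apply/orP; left; apply/eqP.
  by apply: eq_Rintegral => t _; rewrite indicT mul1r.
(* Uniform approximation by step functions, by peeling off layers: subtracting [e] on the set where
   [s >= e] lowers the bound [N * e] by one step. *)
have simple (e : R) : 0 < e -> forall N s, bounded_measurable s ->
    (forall t, I t -> 0 <= s t <= N%:R * e) ->
    exists s' : T -> R, [/\ bounded_measurable s', J s' n @[n --> G] --> P s' &
      forall t, I t -> `|s t - s' t| <= e].
  move=> e0; elim=> [|N IHN] s bs sN.
    exists \1_set0; split; [exact: bounded_measurable_indic|exact: Pindic|].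
    move=> t It; have := sN _ It; rewrite mul0r => st0.
    by have /eqP -> : s t == 0; [rewrite eq_le andbC|rewrite indic0 subr0 normr0 ltW].
  (* A range inside [[0, e]] is a second base case: off the set [A] nothing is subtracted, and there
     the function is only known to be less than [e], so peeling cannot go down to [0 * e]. *)
  case: N => [|N] in IHN sN *.
    exists \1_set0; split; [exact: bounded_measurable_indic|exact: Pindic|].
    move=> t It; have := sN _ It; rewrite mul1r => /andP[st0 st1].
    by rewrite indic0 subr0 ger0_norm.
  pose A := I `&` s @^-1` `[e, +oo[.
  have mA : measurable A by case: bs => ms _; apply: ms => //; exact: measurable_itv.
  have bA := bounded_measurable_indic mA.
  have b1 : bounded_measurable (fun t => s t + (- e) * \1_A t) by exact: bounded_measurableD.
  have [t It|s' [bs' Js' ss']] := IHN _ b1.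
    have := sN t It; rewrite indicE mulNr; case: (boolP (t \in A)) => tA /=.
      have := set_mem tA; rewrite /A/= in_itv/= andbT => -[_ est].
      rewrite mulr1 subr_ge0 est/= lerBlDr => /andP[_ H]; apply: le_trans H _.
      by rewrite -[X in _ <= _ + X]mul1r -mulrDl natr1.
    move=> /andP[st0 _]; rewrite mulr0 subr0 st0/=.
    have : ~ (e <= s t).
      by move=> est; move: tA; rewrite notin_setE; apply; split => //=; rewrite in_itv/= andbT.
    move/negP; rewrite -ltNge => /ltW/le_trans; apply.
    by apply: ler_peMl; [exact: ltW|rewrite ler1n].
  exists (fun t => s' t + e * \1_A t); split; first exact: bounded_measurableD.
    rewrite PD//; have -> : J (fun t => s' t + e * \1_A t) = (fun n => J s' n + e * J \1_A n).
      by apply/funext => n; exact: JD.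
    by apply: cvgD => //; apply: cvgMl_tmp; exact: Pindic.
  move=> t It; have := ss' t It; by rewrite mulNr opprD addrA addrAC.
have int_close s1 s2 e v : 0 <= e -> bounded_measurable s1 -> bounded_measurable s2 ->
    mu.-integrable I (EFin \o v) -> (forall t, I t -> `|s1 t - s2 t| <= e) ->
    `|\int[mu]_(t in I) (s1 t * v t) - \int[mu]_(t in I) (s2 t * v t)| <=
    e * \int[mu]_(t in I) `|v t|.
  move=> e0 b1 b2 iv s12.
  have i1 := bounded_measurable_integrable b1 iv.
  have i2 := bounded_measurable_integrable b2 iv.
  have inv : mu.-integrable I (EFin \o (fun t => `|v t|)) by exact: integrable_norm.
  rewrite -RintegralB//; apply: le_trans (le_normr_Rintegral mI _) _; first exact: (integrableB mI i1 i2).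
  rewrite -RintegralZl//; apply: le_Rintegral => //.
  - apply: (@integrable_norm _ _ _ _ _ (fun t => s1 t * v t - s2 t * v t)); exact: (integrableB mI i1 i2).
  - exact: (integrableZl mI e inv).
  - by move=> t It; rewrite -mulrBl normrM ler_wpM2r// s12.
have pos s : bounded_measurable s -> (forall t, I t -> 0 <= s t) -> J s n @[n --> G] --> P s.
  move=> bs s0; have [ms [C sC]] := bs.
  apply/cvgrPdist_le => e e0.
  pose C2 := `|C1| + \int[mu]_(t in I) `|phi t|.
  have ip0 : 0 <= \int[mu]_(t in I) `|phi t| by exact: Rintegral_ge0.
  have C20 : 0 <= C2 by rewrite addr_ge0.
  (* Replacing [s] by [s'] costs at most [h] times the [L^1] norm of [phi] in one integral and
     [h * |C1|] in the other, together at most [e / 2]. *)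
  pose h := e / 2 / (C2 + 1).
  have h0 : 0 < h by rewrite !divr_gt0// ltr_wpDl.
  have [|s' [bs' Js' ss']] := simple h h0 (Num.bound `|C / h|) s bs.
    move=> t It; rewrite s0//= -ler_pdivrMr//; apply: (@le_trans _ _ (C / h)).
      by rewrite ler_pM2r ?invr_gt0// (le_trans (ler_norm _))// sC.
    by rewrite (le_trans (ler_norm _))//; apply/ltW/archi_boundP.
  have e2 : 0 < e / 2 by rewrite divr_gt0.
  have /cvgrPdist_le/(_ _ e2)Hn := Js'.
  near=> n.
  have Hn' : `|P s' - J s' n| <= e / 2 by near: n; exact: Hn.
  have H1 := int_close s s' h phi (ltW h0) bs bs' iphi ss'.
  have H2 := int_close s s' h (u n) (ltW h0) bs bs' (iu n) ss'.
  rewrite -/(P s) -/(P s') in H1; rewrite -/(J s n) -/(J s' n) in H2.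
  have H3 : h * \int[mu]_(t in I) `|u n t| <= h * `|C1|.
    by rewrite ler_pM2l// (le_trans (C1u n))// ler_norm.
  have H4 : h * (C2 + 1) = e / 2 by rewrite /h divfK// gt_eqF// ltr_wpDl.
  have -> : P s - J s n = (P s - P s') + (P s' - J s' n) - (J s n - J s' n) by ring.
  apply: le_trans (ler_normB _ _) _; apply: le_trans (lerD (ler_normD _ _) (lexx _)) _.
  move: H4; rewrite /C2; lra.
move=> s bs l Jl.
have [ms [C sC]] := bs.
have b1 : bounded_measurable \1_(setT : set T) by exact: bounded_measurable_indic.
(* Adding the constant [|C|] reduces a bounded function of any sign to the nonnegative case;
   uniqueness of limits then removes it. *)
have bs1 : bounded_measurable (fun t => s t + `|C| * \1_(setT : set T) t).
  exact: bounded_measurableD.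
have H1 : J (fun t => s t + `|C| * \1_(setT : set T) t) n @[n --> G] --> P (fun t => s t + `|C| * \1_(setT : set T) t).
  apply: pos => // t It; rewrite indicT mulr1 -lerBlDr sub0r.
  have := le_trans (sC t It) (ler_norm C); by rewrite ler_norml => /andP[].
have H2 : J (fun t => s t + `|C| * \1_(setT : set T) t) n @[n --> G] --> l + `|C| * P \1_(setT : set T).
  have -> : J (fun t => s t + `|C| * \1_(setT : set T) t) = (fun n => J s n + `|C| * J \1_setT n).
    by apply/funext => n; exact: JD.
  by apply: cvgD => //; apply: cvgMl_tmp; exact: Pindic.
have {H1 H2} := cvg_unique _ H2 H1; rewrite PD// => H; exact: (addIr _ (H (@Rhausdorff R) _)).
Unshelve. all: by end_near. Qed.

End weak_limit.

(** * Poisson representation under bounded means *)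

Section hardy_poisson.
Context {R : realType}.
Notation mu := (@lebesgue_measure R).

(** Beyond [K], [x = x^(1 - p) x^p] and the exponent [1 - p] is negative. This is how a bound on
    [p]-th moments gives uniform integrability. *)
Lemma le_cut_powR (p K x : R) : 1 < p -> 0 < K -> 0 <= x ->
  x <= K + K `^ (1 - p) * x `^ p.
Proof.
move=> p1 K0 x0; have [xK|Kx] := leP x K.
  by rewrite (le_trans xK)// lerDl mulr_ge0// powR_ge0.
have {}x0 : 0 < x by exact: lt_trans Kx.
apply: (@le_trans _ _ (K `^ (1 - p) * x `^ p)); last by rewrite lerDr ltW.
have {1}-> : x = x `^ (1 - p) * x `^ p.
  rewrite -powRD; last by apply/implyP => _; rewrite gt_eqF.
  by rewrite subrK powRr1// ltW.
rewrite ler_pM2r ?powR_gt0//.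
have -> : 1 - p = - (p - 1) by ring.
rewrite !powRN lef_pV2 ?posrE ?powR_gt0//.
by apply: ge0_ler_powR; rewrite ?nnegrE ?subr_ge0; exact: ltW.
Qed.

Lemma powR_moment_unif_integrable (p M : R) (u : nat -> R -> R) :
  let I : set R := `[0, 2 * pi]%classic in 1 < p -> (forall n, continuous (u n)) ->
  (forall n, \int[mu]_(t in I) (`|u n t| `^ p)%:E <= M%:E)%E ->
  forall e : R, 0 < e -> exists2 K : R, 0 <= K & forall n (A : set (measurableTypeR R)),
  measurable A -> \int[mu]_(t in I) (\1_A t * `|u n t|) <= K * fine (mu (A `&` I)) + e.
Proof.
move=> I p1 cu uM e e0.
have M0 : 0 <= M.
  rewrite -lee_fin; apply: le_trans (uM 0%N).
  by apply: integral_ge0 => t _; rewrite lee_fin powR_ge0.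
(* Chosen so that [K^(1 - p) = e / (M + 1)]: the moment term is then at most [e]. *)
pose K := (e / (M + 1)) `^ (- (p - 1)^-1).
have M1 : 0 < M + 1 by rewrite ltr_wpDl.
have K0 : 0 < K by rewrite powR_gt0// divr_gt0.
have Ke : K `^ (1 - p) = e / (M + 1).
  have pE : - (p - 1)^-1 * (1 - p) = 1 by field; rewrite subr_eq0 gt_eqF.
  by rewrite /K -powRrM pE powRr1// ltW// divr_gt0.
exists K; first exact: ltW.
move=> n A mA.
have mI : measurable (I : set (measurableTypeR R)) by exact: measurable_itv.
have cun : continuous (fun t => `|u n t|).
  by move=> t; apply: (cont_comp _ (cu n t)); exact: norm_continuous.
have cup : continuous (fun t => `|u n t| `^ p).
  move=> t; apply: (@cont_comp _ _ (fun x => `|x| `^ p) (u n) t); last exact: cu.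
  by apply: continuous_norm_powR; exact: lt_trans p1.
have iun := @continuous_itv_integrable R 0 (2 * pi) _ cun.
have iup := @continuous_itv_integrable R 0 (2 * pi) _ cup.
have bA : bounded_measurable I (\1_A : measurableTypeR R -> R) by exact: bounded_measurable_indic.
have iAu : mu.-integrable I (EFin \o (fun t => \1_A t * `|u n t|)).
  exact: bounded_measurable_integrable.
have iA : mu.-integrable I (EFin \o (\1_A : R -> R)).
  have := @bounded_measurable_integrable _ _ _ mu I mI \1_A (fun=> 1) bA.
  have c1 : mu.-integrable I (EFin \o (fun=> 1 : R)).
    by apply: continuous_itv_integrable; exact: cst_continuous.
  by move=> /(_ c1); congr (mu.-integrable I _); apply/funext => t /=; rewrite mulr1.
have iKA : mu.-integrable I (EFin \o (fun t => K * \1_A t)) by exact: (integrableZl mI K iA).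
have iKu : mu.-integrable I (EFin \o (fun t => K `^ (1 - p) * `|u n t| `^ p)).
  exact: (integrableZl mI _ iup).
apply: (@le_trans _ _ (\int[mu]_(t in I) (K * \1_A t + K `^ (1 - p) * `|u n t| `^ p))).
  apply: le_Rintegral => //; first exact: (integrableD mI iKA iKu).
  move=> t _; rewrite indicE; case: (t \in A) => /=.
    by rewrite mul1r mulr1; exact: le_cut_powR.
  by rewrite mul0r mulr0 add0r mulr_ge0 ?powR_ge0.
rewrite RintegralD// !RintegralZl//; apply: lerD.
  rewrite le_eqVlt; apply/orP; left; apply/eqP; congr (_ * _).
  by rewrite /Rintegral integral_indic.
rewrite Ke mulrAC ler_pdivrMr// ler_pM2l//.
apply: (@le_trans _ _ M); last by rewrite lerDl.
by rewrite -lee_fin EFin_Rintegral.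
Qed.

(** For fixed [q] the kernel is a bounded test function. The Poisson formula on the circles of
    radius [rho n] passes to the weak limit on one side, and to [w q] by continuity on the other. *)
Lemma real_hardy_poisson (p M : R) (w : R * R -> R) : 1 < p ->
  real_harmonic [set q | nsq q < 1] w ->
  (forall r : R, 0 < r < 1 ->
    (\int[mu]_(t in `[0%R, (2 * pi)%R]) (`|w (r * cos t, r * sin t)| `^ p)%:E <= M%:E)%E) ->
  exists phi : R -> R, [/\ measurable_fun setT phi,
    mu.-integrable `[0, 2 * pi] (EFin \o phi) &
    forall q, nsq q < 1 -> w q = poisson_int phi q].
Proof.
move=> p1 hw wM.
(* The halving keeps [rho 0] positive, as the bound on the means concerns [0 < r < 1] only. *)
pose rho n : R := 1 - harmonic n / 2.
have rho01 n : 0 < rho n < 1.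
  have h0 : 0 < harmonic n :> R by exact: harmonic_gt0.
  have h1 : harmonic n <= 1 :> R by rewrite invf_le1// ler1n.
  by rewrite /rho; apply/andP; split; lra.
pose u n t := w (rho n * cos t, rho n * sin t).
have cw q : nsq q < 1 -> {for q, continuous w} by move=> /hw.1[].
have cu n : continuous (u n).
  move=> t; apply: (@continuous_comp _ _ _ (fun t => (rho n * cos t, rho n * sin t)) w t).
    exact: (cont_pair (contM (contC (rho n) t) (@continuous_cos R t))
      (contM (contC (rho n) t) (@continuous_sin R t))).
  by apply: cw; apply: nsq_polar_lt1; have /andP[? ?] := rho01 n; apply/andP; split; lra.
have [G [uG oG]] := ultraFilterLemma (@eventually_filter).
have ui := powR_moment_unif_integrable p1 cu (fun n => wM _ (rho01 n)).
have mI : measurable (`[0, 2 * pi]%classic : set (measurableTypeR R)) by exact: measurable_itv.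
have iu n : mu.-integrable `[0, 2 * pi] (EFin \o u n) by exact: continuous_itv_integrable.
have fI : (mu `[0%R, (2 * pi)%R] < +oo)%E.
  by rewrite lebesgue_measure_itv/= lte_fin; case: ifP => _; rewrite ?ltry// -EFinB ltry.
have [phi [mphi iphi wphi]] := ultrafilter_weak_limit uG mI fI iu ui.
exists phi; split => // q q1.
rewrite /poisson_int; apply: (mulfI (lt0r_neq0 (@pi2_gt0 R))).
rewrite mulVKf ?gt_eqF ?pi2_gt0//.
apply: (wphi (pk q)).
  split; first by apply: measurable_funTS; apply: continuous_measurable_fun; exact: continuous_pk2.
  have [C C0 HC] := continuous_itv_bounded 0 (2 * pi) (continuous_pk2 q q1).
  by exists C => t It; apply: HC.
have E n : \int[mu]_(t in `[0, 2 * pi]) (pk q t * u n t) = 2 * pi * w (rho n * q.1, rho n * q.2).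
  rewrite (real_harmonic_poisson hw (rho01 n) q1) /poisson_int mulVKf// gt_eqF// pi2_gt0//.
have : 2 * pi * w (rho n * q.1, rho n * q.2) @[n --> \oo] --> 2 * pi * w q.
  apply: cvgMl_tmp.
  have rl : rho n @[n --> \oo] --> (1 : R).
    rewrite -[X in _ --> X]subr0; apply: cvgB; first exact: cvg_cst.
    have := cvgMr_tmp (b := 2^-1) (@cvg_harmonic R); rewrite mul0r; exact.
  have cid : {for 1, continuous (fun x : R => x)} by exact: cvg_id.
  have c1 := cont_pair (contM cid (contC q.1 (1 : R))) (contM cid (contC q.2 (1 : R))).
  have H := cvg_comp _ _ rl c1.
  have := cvg_comp _ _ H (_ : w @ (1 * q.1, 1 * q.2) --> w q).
  apply; rewrite !mul1r -surjective_pairing; exact: cw.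
by rewrite -(funext E) => H A /H HA; exact: oG.
Qed.

End hardy_poisson.

(** * Radial limits at Lebesgue points *)

Section radial_limits.
Context {R : realType}.
Notation mu := (@lebesgue_measure R).

(** On the annulus between the radii [2^k h] and [2^(k + 1) h] the kernel is at most [c / (4^k h)]
    and [g] has integral at most [e 2^(k + 1) h], so its share is [2 c e / 2^k]. With [c e] from the
    first ball, the sum over [k < n] is [c e (5 - 4 / 2^n)]. *)
Lemma dyadic_integral_le (P g : R -> R) (x h e d c : R) :
  measurable_fun setT P -> measurable_fun setT g ->
  (forall t, 0 <= P t) -> (forall t, 0 <= g t) -> 0 < h -> 0 <= e ->
  (forall r, 0 < r < d -> (\int[mu]_(t in ball x r) (g t)%:E <= (e * r)%:E)%E) ->
  (forall t, P t <= c / h) -> (forall t, P t * (t - x) ^+ 2 <= c * h) ->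
  forall n, 2 ^+ n * h < d ->
  (\int[mu]_(t in ball x (2 ^+ n * h)) (P t * g t)%:E <= (c * e * (5 - 4 / 2 ^+ n))%:E)%E.
Proof.
move=> mP mg P0 g0 h0 e0 gd Ph Px.
have c0 : 0 <= c by have := le_trans (P0 0) (Ph 0); rewrite ler_pdivlMr// mul0r.
have mPg : measurable_fun setT (fun t => (P t * g t)%:E).
  by apply/measurable_EFinP; exact: measurable_funM.
have mgE : measurable_fun setT (fun t => (g t)%:E) by exact/measurable_EFinP.
have Ple (A : set R) k : measurable A -> 0 <= k -> (forall t, A t -> P t <= k) ->
    (\int[mu]_(t in A) (P t * g t)%:E <= k%:E * \int[mu]_(t in A) (g t)%:E)%E.
  move=> mA k0 Pk; rewrite -ge0_integralZl_EFin//; last 2 first.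
    by move=> t _; rewrite lee_fin.
    exact: measurable_funTS.
  apply: ge0_le_integral => //.
  - by move=> t _; rewrite lee_fin mulr_ge0.
  - exact: measurable_funTS.
  - by apply: measurable_funeM; exact: measurable_funTS.
  - by move=> t At; rewrite -EFinM lee_fin ler_wpM2r// Pk.
elim=> [|n IHn] nd.
  rewrite expr0 mul1r in nd *; rewrite divr1.
  apply: (@le_trans _ _ ((c / h)%:E * (e * h)%:E)%E).
    apply: le_trans (Ple _ (c / h) _ _ _) _ => //; first exact: measurable_ball.
      by rewrite divr_ge0// ltW.
    by apply: lee_wpmul2l; [rewrite lee_fin divr_ge0// ltW|apply: gd; rewrite h0].
  by rewrite -EFinM lee_fin le_eqVlt; apply/orP; left; apply/eqP; field; rewrite gt_eqF.
have p0 : 0 < 2 ^+ n :> R by rewrite exprn_gt0.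
have nd' : 2 ^+ n * h < d.
  by apply: le_lt_trans nd; rewrite ler_pM2r// exprS; apply: ler_peMl; rewrite ?ler1n// ltW.
have sub : ball x (2 ^+ n * h) `<=` ball x (2 ^+ n.+1 * h).
  by apply: le_ball; rewrite ler_pM2r// exprS; apply: ler_peMl; rewrite ?ler1n// ltW.
rewrite -(setDUK sub) ge0_integral_setU//; last 5 first.
- exact: measurable_ball.
- by apply: measurableD; exact: measurable_ball.
- exact: measurable_funTS.
- by move=> t _; rewrite lee_fin mulr_ge0.
- by apply/disj_setPS => t [? []].
apply: (@le_trans _ _ ((c * e * (5 - 4 / 2 ^+ n))%:E + (c / (4 ^+ n * h))%:E * (e * (2 ^+ n.+1 * h))%:E)%E).
  apply: leeD; first exact: IHn.
  have k0 : 0 <= c / (4 ^+ n * h) by rewrite divr_ge0// mulr_ge0 ?exprn_ge0// ltW.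
  apply: le_trans (Ple _ (c / (4 ^+ n * h)) _ k0 _) _.
  - by apply: measurableD; exact: measurable_ball.
  - move=> t [_ /negP]; rewrite /ball/= -leNgt distrC => tn.
    have n0 : 0 <= 2 ^+ n * h by rewrite mulr_ge0 ?exprn_ge0// ltW.
    have t2 : 4 ^+ n * h ^+ 2 <= (t - x) ^+ 2.
      have -> : 4 ^+ n * h ^+ 2 = (2 ^+ n * h) ^+ 2.
        by rewrite exprMn -exprM mulnC exprM; congr (_ ^+ _ * _); ring.
      by rewrite -[leRHS]real_normK ?num_real// lerXn2r// nnegrE.
    have q0 : 0 < 4 ^+ n :> R by rewrite exprn_gt0.
    rewrite ler_pdivlMr ?mulr_gt0// -(ler_pM2r h0).
    apply: le_trans (Px t); apply: le_trans (ler_wpM2l (P0 t) t2).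
    by rewrite le_eqVlt; apply/orP; left; apply/eqP; ring.
  - apply: lee_wpmul2l; first by rewrite lee_fin.
    apply: (@le_trans _ _ (\int[mu]_(t in ball x (2 ^+ n.+1 * h)) (g t)%:E)%E).
      apply: ge0_subset_integral => //.
      + by apply: measurableD; exact: measurable_ball.
      + exact: measurable_ball.
      + exact: measurable_funTS.
      + by move=> t _; rewrite lee_fin.
    by apply: gd; rewrite nd andbT mulr_gt0// exprn_gt0.
rewrite -EFinM -EFinD lee_fin le_eqVlt; apply/orP; left; apply/eqP.
have -> : 4 ^+ n = (2 ^+ n) ^+ 2 :> R by rewrite -exprM mulnC exprM; congr (_ ^+ _); ring.
rewrite [2 ^+ n.+1]exprS; move: (2 ^+ n) p0 => N p0; field; by rewrite !gt_eqF.
Qed.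

(** Up to [pi / 4] the mean value theorem gives the slope [cos (pi / 4)]; beyond, the sine has a
    positive minimum on a compact interval short of [pi]. Here [b] may exceed [pi / 2]. *)
Lemma sin_ge_linear (b : R) : 0 < b < pi ->
  exists2 k : R, 0 < k & forall y, 0 <= y <= b -> k * y <= sin y.
Proof.
move=> /andP[b0 bpi]; have p0 := pi_gt0 R.
have q0 : 0 < cos (pi / 4) :> R by apply: cos_gt0_pihalf; apply/andP; split; lra.
pose B : R := Num.max (pi / 4) b.
have B1 : pi / 4 <= B by rewrite le_max lexx.
have Bpi : B < pi by rewrite gt_max bpi andbT; lra.
have [|||c cI cmin] := @compact_EVT_min _ _ (@sin R) `[pi / 4, B]%classic.
- by exists (pi / 4); rewrite /= in_itv/= lexx.
- exact: segment_compact.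
- by apply: continuous_subspaceT; exact: continuous_sin.
have sc : 0 < sin c.
  move: cI; rewrite inE/= in_itv/= => /andP[c1 c2].
  by apply: sin_gt0_pi; apply/andP; split; lra.
exists (Num.min (cos (pi / 4)) (sin c / pi)).
  by rewrite lt_min q0 divr_gt0.
move=> y /andP[y0 yb].
have [y4|y4] := leP y (pi / 4); last first.
  apply: (@le_trans _ _ (sin c / pi * y)).
    by rewrite ler_wpM2r// ge_min lexx orbT.
  apply: (@le_trans _ _ (sin c)).
    by rewrite mulrAC ler_pdivrMr// ler_pM2l//; lra.
  by apply: cmin; rewrite inE/= in_itv/= (ltW y4)/= le_max yb orbT.
apply: (@le_trans _ _ (cos (pi / 4) * y)).
  by rewrite ler_wpM2r// ge_min lexx.
move: y0; rewrite le_eqVlt => /predU1P[<-|y0]; first by rewrite mulr0 sin0.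
have [|z] := @MVT R (@sin R) (@cos R) 0 y y0 (fun x _ => is_derive_sin x).
  by apply: continuous_subspaceT; exact: continuous_sin.
rewrite in_itv/= sin0 !subr0 => /andP[z0 zy] ->.
by rewrite ler_pM2r// leNgt ltr_cos ?in_itv/= -?leNgt; [lra|apply/andP; split; lra|apply/andP; split; lra].
Qed.

Lemma den_polar (r x t : R) :
  den (r * cos x, r * sin x) t = (1 - r) ^+ 2 + 4 * r * sin ((t - x) / 2) ^+ 2.
Proof.
have tx : t - x = (t - x) / 2 + (t - x) / 2 by rewrite -splitr.
have s2 : 2 * sin ((t - x) / 2) ^+ 2 = 1 - (cos t * cos x + sin t * sin x).
  rewrite -cosB; have -> : cos (t - x) = cos ((t - x) / 2) ^+ 2 - sin ((t - x) / 2) ^+ 2.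
    by rewrite {1}tx cosD !expr2.
  by have := cos2Dsin2 ((t - x) / 2); lra.
rewrite /den/=.
have -> : 4 * r * sin ((t - x) / 2) ^+ 2 = 2 * r * (2 * sin ((t - x) / 2) ^+ 2) by ring.
rewrite s2.
have -> : (cos t - r * cos x) ^+ 2 + (sin t - r * sin x) ^+ 2 =
  (cos t ^+ 2 + sin t ^+ 2) - 2 * r * (cos t * cos x + sin t * sin x) + r ^+ 2 * (cos x ^+ 2 + sin x ^+ 2) by ring.
by rewrite !cos2Dsin2; ring.
Qed.

(** For [x] strictly inside, [|t - x| / 2] stays at most [b < pi], hence [|sin ((t - x) / 2)|]
    dominates a multiple of [|t - x|]. At [x = 0] or [2 pi] the kernel also peaks at the opposite
    end of the interval. In the constant, 2 comes from [1 - r^2 <= 2 (1 - r)] and [4 / k^2] from the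
    bound on the sine, with [4 r >= 2]. *)
Lemma pk_polar_le (x : R) : 0 < x < 2 * pi -> exists2 c : R, 0 < c &
  forall r t, 2^-1 <= r < 1 -> 0 <= t <= 2 * pi ->
  pk (r * cos x, r * sin x) t <= c / (1 - r) /\
  pk (r * cos x, r * sin x) t * (t - x) ^+ 2 <= c * (1 - r).
Proof.
move=> /andP[x0 xp]; have p0 := pi_gt0 R.
pose b : R := Num.max x (2 * pi - x) / 2.
have m1 : x <= Num.max x (2 * pi - x) by rewrite le_max lexx.
have m2 : 2 * pi - x <= Num.max x (2 * pi - x) by rewrite le_max lexx orbT.
have m3 : Num.max x (2 * pi - x) < 2 * pi by rewrite gt_max; apply/andP; split; lra.
have bx : x <= 2 * b by rewrite /b; lra.
have bx' : 2 * pi - x <= 2 * b by rewrite /b; lra.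
have bpi : 0 < b < pi by apply/andP; split; rewrite /b; lra.
have [k k0 sk] := sin_ge_linear bpi.
exists (2 + 4 / k ^+ 2); first by rewrite addr_gt0// divr_gt0// exprn_gt0.
move=> r t /andP[r2 r1] /andP[t0 tp].
have h0 : 0 < 1 - r by rewrite subr_gt0.
have k2 : 0 < k ^+ 2 by rewrite exprn_gt0.
have r01 : -1 < r < 1 by rewrite r1 andbT; lra.
have D0 : 0 < den (r * cos x, r * sin x) t by apply: den_gt0; exact: nsq_polar_lt1.
have num : 1 - nsq (r * cos x, r * sin x) <= 2 * (1 - r) by rewrite nsq_polar; nra.
have D1 : (1 - r) ^+ 2 <= den (r * cos x, r * sin x) t.
  by rewrite den_polar lerDl mulr_ge0 ?sqr_ge0//; lra.
have D2 : k ^+ 2 / 2 * (t - x) ^+ 2 <= den (r * cos x, r * sin x) t.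
  have S : k * `|(t - x) / 2| <= `|sin ((t - x) / 2)|.
    have yb : 0 <= `|(t - x) / 2| <= b.
      by rewrite normr_ge0/= ler_norml; apply/andP; split; lra.
    apply: le_trans (sk _ yb) _.
    by case: (ger0P ((t - x) / 2)) => _; rewrite ?ler_norm// sinN -normrN ler_norm.
  have S2 : k ^+ 2 * ((t - x) / 2) ^+ 2 <= sin ((t - x) / 2) ^+ 2.
    rewrite -[leRHS]real_normK ?num_real// -[(_ / 2) ^+ 2]real_normK ?num_real// -exprMn.
    by rewrite lerXn2r// nnegrE// mulr_ge0// ltW.
  rewrite den_polar.
  apply: (@le_trans _ _ (4 * r * sin ((t - x) / 2) ^+ 2)); last by rewrite lerDr sqr_ge0.
  apply: (@le_trans _ _ (2 * sin ((t - x) / 2) ^+ 2)); last first.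
    by apply: ler_wpM2r; [exact: sqr_ge0|lra].
  have -> : k ^+ 2 / 2 * (t - x) ^+ 2 = 2 * (k ^+ 2 * ((t - x) / 2) ^+ 2) by field.
  by rewrite ler_pM2l.
have c2 : 2 <= 2 + 4 / k ^+ 2 by rewrite lerDl divr_ge0// ltW.
have c4 : 4 / k ^+ 2 <= 2 + 4 / k ^+ 2 by rewrite lerDr.
split.
  rewrite /pk ler_pdivrMr// mulrAC ler_pdivlMr//.
  apply: (@le_trans _ _ (2 * (1 - r) ^+ 2)).
    by apply: le_trans (ler_wpM2r (ltW h0) num) _; rewrite expr2 mulrA.
  by apply: ler_pM => //; exact: sqr_ge0.
rewrite /pk mulrAC ler_pdivrMr//.
apply: (@le_trans _ _ (2 * (1 - r) * (t - x) ^+ 2)); first by rewrite ler_wpM2r ?sqr_ge0.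
have -> : 2 * (1 - r) * (t - x) ^+ 2 = 4 / k ^+ 2 * (1 - r) * (k ^+ 2 / 2 * (t - x) ^+ 2).
  by field; rewrite gt_eqF.
apply: ler_pM => //; last by rewrite ler_pM2r.
  by rewrite !mulr_ge0 ?invr_ge0// ltW.
by rewrite mulr_ge0 ?sqr_ge0// divr_ge0// ltW.
Qed.

End radial_limits.

Section poisson_radial.
Context {R : realType}.
Notation mu := (@lebesgue_measure R).

Lemma dyadic_scale (h d : R) : 0 < h -> h < d ->
  exists n, 2 ^+ n * h < d /\ d <= 2 ^+ n.+1 * h.
Proof.
move=> h0 hd.
have ex : exists n, d <= 2 ^+ n * h.
  exists (Num.bound (d / h)); rewrite -ler_pdivrMr//.
  have d0 : 0 <= d / h by rewrite divr_ge0// ltW// (lt_trans h0).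
  apply: le_trans (ltW (archi_boundP d0)) _.
  by rewrite -natrX ler_nat ltnW// ltn_expl.
have [n] := ex_minnP ex; case: n => [|n]; first by rewrite expr0 mul1r leNgt hd.
move=> nd nmin; exists n; split => //.
by rewrite ltNge; apply/negP => /nmin; rewrite ltnn.
Qed.

Lemma lebesgue_pt_le (f : R -> R) (x e : R) : lebesgue_pt f x -> 0 < e ->
  exists2 d : R, 0 < d & forall r, 0 < r < d ->
  (\int[mu]_(t in ball x r) (`|f t - f x|)%:E <= (e * r)%:E)%E.
Proof.
move=> fx e0; have /fine_cvgP[] := fx.
have e2 : 0 < e / 2 by rewrite divr_gt0.
move=> H1 /cvgrPdist_lt/(_ _ e2) H2.
have : \forall r \near (0 : R)^'+, davg f x r \is a fin_num /\ `|0 - (fine \o davg f x) r| < e / 2.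
  exact: filterI.
move=> /nbhs_ballP[d /= d0 H]; exists d => // r /andP[r0 rd].
have [fr dr] : davg f x r \is a fin_num /\ `|0 - (fine \o davg f x) r| < e / 2.
  by apply: H => //; rewrite /ball/= sub0r normrN gtr0_norm.
have : (davg f x r <= (e / 2)%:E)%E.
  rewrite -(fineK fr) lee_fin ltW//; apply: le_lt_trans (ler_norm _) _.
  by move: dr; rewrite sub0r normrN.
rewrite /davg /iavg lebesgue_measure_ball ?(ltW r0)//.
have r2 : 0 < r *+ 2 by rewrite mulrn_wgt0.
rewrite inver gt_eqF// lee_pdivrMl// => Hi.
have -> : (e * r)%:E = ((r *+ 2)%:E * (e / 2)%:E)%E by rewrite -EFinM; congr EFin; rewrite -mulr_natl; field.
exact: Hi.
Qed.

Theorem poisson_radial_limit (phi : R -> R) (x : R) :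
  measurable_fun setT phi -> mu.-integrable `[0, 2 * pi] (EFin \o phi) ->
  0 < x < 2 * pi -> lebesgue_pt (phi \_ `[0, 2 * pi]) x ->
  poisson_int phi (r * cos x, r * sin x) @[r --> (1 : R)^'-] --> phi x.
Proof.
move=> mphi iphi /andP[x0 xp] px.
set I := `[0, 2 * pi]%classic in iphi px *.
have mI : measurable (I : set (measurableTypeR R)) by exact: measurable_itv.
have mI' : measurable I by exact: measurable_itv.
have p0 := @pi2_gt0 R.
have xI : x \in I by rewrite inE /I/= in_itv/= !ltW.
have phixE : (phi \_ I) x = phi x by rewrite patchE xI.
have [c c0 cP] : exists2 c : R, 0 < c & _ := pk_polar_le (introT andP (conj x0 xp)).
apply/cvgrPdist_le => e e0.
(* The dyadic sum then contributes at most [5 * c * e1 = e / 2]. *)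
pose e1 := e / (10 * c).
have e10 : 0 < e1 by rewrite divr_gt0// mulr_gt0.
have [d1 d10 H1] := lebesgue_pt_le px e10.
(* The distances from [x] to both endpoints enter so that the ball of radius [d] lies in [I]. *)
pose d := Num.min d1 (Num.min x (2 * pi - x)).
have d0 : 0 < d by rewrite !lt_min d10 x0 subr_gt0.
have dd1 : d <= d1 by rewrite ge_min lexx.
have dx : d <= x by rewrite !ge_min lexx orbT.
have dx' : d <= 2 * pi - x by rewrite !ge_min lexx !orbT.
pose g (t : R) : R := `|(phi \_ I) t - phi x|.
have mg : measurable_fun setT g.
  apply: measurableT_comp => //; apply: measurable_funB => //.
  by apply/(measurable_restrictT _ _).1 => //; exact: measurable_funTS.
have g0 t : 0 <= g t by exact: normr_ge0.
have ic : mu.-integrable I (EFin \o cst (phi x)).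
  by apply: continuous_itv_integrable; exact: cst_continuous.
have igv : mu.-integrable I (EFin \o (fun t => phi t - phi x)).
  exact: (integrableB mI iphi ic).
have ig : mu.-integrable I (EFin \o g).
  have := integrable_norm igv; apply: eq_integrable => //.
  by move=> t tI; rewrite /g/= patchE tI.
pose N := \int[mu]_(t in I) g t.
have N0 : 0 <= N by exact: Rintegral_ge0.
near=> r.
have r1 : r < 1 by near: r; exact: nbhs_left_lt.
have r2 : 2^-1 <= r by apply: ltW; near: r; apply: nbhs_left_gt; lra.
pose h := 1 - r.
have h0 : 0 < h by rewrite subr_gt0.
have hd : h < d by rewrite /h ltrBlDr -ltrBlDl; near: r; apply: nbhs_left_gt; lra.
have hN : h < e * d ^+ 2 / (8 * c * (N + 1)).
  rewrite /h ltrBlDr -ltrBlDl; near: r; apply: nbhs_left_gt; rewrite ltrBlDr ltrDl.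
  by rewrite divr_gt0 ?mulr_gt0 ?exprn_gt0// ltr_wpDl.
set q := (r * cos x, r * sin x).
have q1 : nsq q < 1 by apply: nsq_polar_lt1; rewrite r1 andbT; lra.
have bm : bounded_measurable I (pk q : measurableTypeR R -> R).
  split; first by apply: measurable_funTS; apply: continuous_measurable_fun; exact: continuous_pk2.
  have [C C0 HC] := continuous_itv_bounded 0 (2 * pi) (continuous_pk2 q q1).
  by exists C => t It; apply: HC.
have i1 := bounded_measurable_integrable mI bm iphi.
have i2 := bounded_measurable_integrable mI bm ic.
have i3 := bounded_measurable_integrable mI bm igv.
have i4 := bounded_measurable_integrable mI bm ig.
have bound : \int[mu]_(t in I) (pk q t * g t) <= e.
  (* Cutting the kernel off outside [I] makes the bounds of [pk_polar_le] valid for every real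
     [t]. *)
  pose P := (pk q) \_ I.
  have PE t : I t -> P t = pk q t by move=> tI; rewrite /P patchE mem_set.
  have P0 t : 0 <= P t by rewrite /P patchE; case: ifP => // _; exact: pk_ge0.
  have mP : measurable_fun setT P.
    by apply/(measurable_restrictT _ _).1 => //; case: bm.
  have cP' t : I t -> pk q t <= c / h /\ pk q t * (t - x) ^+ 2 <= c * h.
    by rewrite /I/= in_itv/= => tI; apply: cP => //; rewrite r2.
  have Ph t : P t <= c / h.
    rewrite /P patchE; case: ifPn => [|_]; last by rewrite divr_ge0// ltW.
    by rewrite inE => /cP'[].
  have Px t : P t * (t - x) ^+ 2 <= c * h.
    rewrite /P patchE; case: ifPn => [|_]; last by rewrite mul0r mulr_ge0// ltW.
    by rewrite inE => /cP'[].
  have gd s : 0 < s < d -> (\int[mu]_(t in ball x s) (g t)%:E <= (e1 * s)%:E)%E.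
    move=> /andP[s0 sd]; have := H1 s; rewrite s0 (lt_le_trans sd dd1) phixE; exact.
  (* The largest dyadic radius below [d] is at least [d / 2], so outside the ball [B] one has
     [|t - x| >= d / 2]. *)
  have [n [n1 n2]] := dyadic_scale h0 hd.
  have near_part := dyadic_integral_le mP mg P0 g0 h0 (ltW e10) gd Ph Px n1.
  set B := ball x (2 ^+ n * h) in near_part.
  have mB : measurable B by exact: measurable_ball.
  have BI : B `<=` I.
    move=> t; rewrite /B ball_itv/= /I/= !in_itv/= => /andP[? ?]; apply/andP; split; lra.
  rewrite -lee_fin EFin_Rintegral//.
  have -> : (\int[mu]_(t in I) (pk q t * g t)%:E = \int[mu]_(t in I) (P t * g t)%:E)%E.
    by apply: eq_integral => t; rewrite inE => tI; rewrite PE.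
  have mPg : measurable_fun setT (fun t => (P t * g t)%:E).
    by apply/measurable_EFinP; exact: measurable_funM.
  rewrite -(setDUK BI) ge0_integral_setU//; last 4 first.
  - exact: measurableD.
  - exact: measurable_funTS.
  - by move=> t _; rewrite lee_fin mulr_ge0.
  - by apply/disj_setPS => t [? []].
  have -> : e = c * e1 * 5 + e / 2 by rewrite /e1; field; rewrite gt_eqF.
  rewrite EFinD; apply: leeD.
    apply: le_trans near_part _; rewrite lee_fin; apply: ler_wpM2l.
      by rewrite mulr_ge0// ltW.
    by rewrite gerBl divr_ge0// exprn_ge0.
  (* The bound [c * h / (t - x)^2] at distance [d / 2]. The smallness [hN] of [h] makes
     [k * (N + 1)] at most [e / 2]. *)
  pose k := 4 * c * h / d ^+ 2.
  have k0 : 0 <= k by rewrite divr_ge0 ?exprn_ge0 ?mulr_ge0// ltW.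
  apply: (@le_trans _ _ (\int[mu]_(t in I `\` B) (k%:E * (g t)%:E))%E).
    apply: ge0_le_integral => //.
    - exact: measurableD.
    - by move=> t _; rewrite lee_fin mulr_ge0.
    - exact: measurable_funTS.
    - by apply: measurable_funeM; apply: measurable_funTS; exact/measurable_EFinP.
    - move=> t [tI /negP]; rewrite /B /ball/= -leNgt distrC => tB.
      rewrite -EFinM lee_fin; apply: ler_wpM2r => //.
      have td : (d / 2) ^+ 2 <= (t - x) ^+ 2.
        rewrite -[leRHS]real_normK ?num_real// lerXn2r ?nnegrE ?divr_ge0 ?(ltW d0)//.
        by apply: le_trans tB; rewrite ler_pdivrMr// mulrC mulrA -exprS.
      rewrite /k ler_pdivlMr ?exprn_gt0//.
      have := le_trans (ler_wpM2l (P0 t) td) (Px t).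
      have -> : (d / 2) ^+ 2 = d ^+ 2 / 4 by field.
      by rewrite mulrA ler_pdivrMr// => H; apply: le_trans H _; rewrite le_eqVlt; apply/orP; left; apply/eqP; ring.
  rewrite ge0_integralZl_EFin//; last 3 first.
  - exact: measurableD.
  - by move=> t _; rewrite lee_fin.
  - by apply: measurable_funTS; exact/measurable_EFinP.
  apply: (@le_trans _ _ (k%:E * N%:E)%E).
    apply: lee_wpmul2l; first by rewrite lee_fin.
    rewrite /N EFin_Rintegral//; apply: ge0_subset_integral => //.
    - exact: measurableD.
    - by apply: measurable_funTS; exact/measurable_EFinP.
    - by move=> t _; rewrite lee_fin.
  rewrite -EFinM lee_fin.
  have d2 : 0 < d ^+ 2 by rewrite exprn_gt0.
  have N1 : 0 < N + 1 by rewrite ltr_wpDl.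
  apply: (@le_trans _ _ (k * (N + 1))); first by rewrite ler_wpM2l// lerDl.
  move: hN; rewrite ltr_pdivlMr ?mulr_gt0// => hN'.
  rewrite /k mulrAC ler_pdivrMr//; lra.
have pE : \int[mu]_(t in I) pk q t = 2 * pi by exact: integral_pk.
have -> : phi x - poisson_int phi q = - ((2 * pi)^-1 * \int[mu]_(t in I) (pk q t * (phi t - phi x))).
  have -> : \int[mu]_(t in I) (pk q t * (phi t - phi x)) =
      \int[mu]_(t in I) (pk q t * phi t) - \int[mu]_(t in I) (pk q t * phi x).
    by rewrite -RintegralB//; apply: eq_Rintegral => t _; rewrite mulrBr.
  rewrite RintegralZr//; last by apply: continuous_itv_integrable; exact: continuous_pk2.
  by rewrite pE /poisson_int -/I mulrBr mulKf ?gt_eqF// opprB.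
rewrite normrN normrM gtr0_norm ?invr_gt0// ler_pdivrMl//.
apply: le_trans (le_normr_Rintegral mI i3) _.
have -> : \int[mu]_(t in I) `|pk q t * (phi t - phi x)| = \int[mu]_(t in I) (pk q t * g t).
  apply: eq_Rintegral => t tI; rewrite normrM ger0_norm; last exact: pk_ge0.
  by rewrite /g patchE tI.
apply: le_trans bound _; rewrite ler_peMl ?(ltW e0)//.
by have := pi_ge2 R; lra.
Unshelve. all: by end_near. Qed.

End poisson_radial.

(** * The Schur test *)

Section schur_test.
Context {R : realType}.
Notation mu := (@lebesgue_measure R).

(** The tangent at [lam^p] to the concave function [y |-> y^(1 / p)], evaluated at [y = a^p];
    equality holds for [a = lam]. *)
Lemma young_powR (p lam a : R) : 1 < p -> 0 < lam -> 0 <= a ->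
  a <= lam `^ (1 - p) / p * a `^ p + (1 - p^-1) * lam.
Proof.
move=> p1 l0 a0; have p0 : 0 < p by exact: lt_trans p1.
have p10 : 0 < p - 1 by rewrite subr_gt0.
pose q := p / (p - 1).
have q0 : 0 < q by rewrite divr_gt0.
have pq : p^-1 + q^-1 = 1 by rewrite /q; field; rewrite !gt_eqF.
have := conjugate_powR a0 (powR_ge0 lam (p - 1)) p0 q0 pq.
rewrite -powRrM (_ : (p - 1) * q = p); last by rewrite /q; field; rewrite gt_eqF.
have lE : lam `^ (1 - p) * lam `^ (p - 1) = 1.
  rewrite -powRD; last by apply/implyP => _; rewrite gt_eqF.
  by rewrite (_ : _ + _ = 0) ?powRr0//; ring.
have lE2 : lam `^ (1 - p) * lam `^ p = lam.
  rewrite -powRD; last by apply/implyP => _; rewrite gt_eqF.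
  by rewrite subrK powRr1// ltW.
have L0 : 0 < lam `^ (1 - p) by rewrite powR_gt0.
move=> /(ler_wpM2l (ltW L0)).
have -> : lam `^ (1 - p) * (a * lam `^ (p - 1)) = a * (lam `^ (1 - p) * lam `^ (p - 1)) by ring.
rewrite lE mulr1 => /le_trans; apply.
have -> : lam `^ (1 - p) * (a `^ p / p + lam `^ p / q) =
  lam `^ (1 - p) / p * a `^ p + lam `^ (1 - p) * lam `^ p / q by ring.
rewrite lE2 lerD2l mulrC ler_wpM2r ?(ltW l0)//.
by rewrite (_ : q^-1 = 1 - p^-1)// -pq; ring.
Qed.

(** [t - s] ranges over [[- 2 pi, 2 pi]], whence five candidates. They must be discarded as a null
    set: there [powR] gives the singular weight the value 0, and the pointwise inequality may
    fail. *)
Lemma sin_eq0_finite (s : R) : 0 <= s <= 2 * pi ->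
  exists2 F : set R, finite_set F & forall t, 0 <= t <= 2 * pi -> ~ F t -> sin (t - s) != 0.
Proof.
move=> /andP[s0 sp]; have p0 := pi_gt0 R.
exists [set` [:: s; s + pi; s - pi; s + 2 * pi; s - 2 * pi]]; first exact: finite_seq.
have pos x : 0 < x < 2 * pi -> x != pi -> sin x != 0.
  move=> /andP[x0 x2] xp; have [h|h] := ltP x pi.
    by rewrite gt_eqF// sin_gt0_pi// x0.
  have {}h : pi < x by rewrite lt_neqAle eq_sym xp.
  have -> : x = (x - pi) + pi by ring.
  by rewrite sinDpi oppr_eq0 gt_eqF// sin_gt0_pi//; apply/andP; split; lra.
move=> t /andP[t0 tp] nF.
have ne y : y \in [:: s; s + pi; s - pi; s + 2 * pi; s - 2 * pi] -> t != y.
  by move=> ys; apply/eqP => ty; apply: nF; rewrite /= ty.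
have n1 := ne s; have n2 := ne (s + pi); have n3 := ne (s - pi).
have n4 := ne (s + 2 * pi); have n5 := ne (s - 2 * pi).
rewrite !inE !eqxx ?orbT/= in n1 n2 n3 n4 n5.
have {}n1 := n1 isT; have {}n2 := n2 isT; have {}n3 := n3 isT; have {}n4 := n4 isT; have {}n5 := n5 isT.
have [h|h] := ltP 0 (t - s).
  apply: pos; last by rewrite subr_eq addrC.
  rewrite h/= lt_neqAle; apply/andP; split; first by rewrite subr_eq addrC.
  by lra.
have -> : t - s = - (s - t) by ring.
rewrite sinN oppr_eq0; apply: pos.
  apply/andP; split.
    by rewrite lt_neqAle; apply/andP; split; [rewrite eq_sym subr_eq0 eq_sym|lra].
  rewrite lt_neqAle; apply/andP; split; last by lra.
  by apply/eqP => H; move/eqP: n5; apply; lra.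
by apply/eqP => H; move/eqP: n3; apply; lra.
Qed.

Definition schur_const (p : R) : R :=
  (2 `^ p^-1 / cos (p^-1 * (pi / 2))) `^ (p - 1) / (2 * pi).

(* Hoelder's inequality for the weight [`|sin (t - s)| `^ (- p^-1)], obtained by integrating
   Young's inequality with the optimal parameter [X / H]. *)
Lemma poisson_schur_pointwise (p s r : R) (Phi : R -> R) : 1 < p -> 0 <= s <= 2 * pi ->
  -1 < r < 1 -> measurable_fun setT Phi -> (forall t, 0 <= Phi t) ->
  mu.-integrable `[0, 2 * pi] (EFin \o Phi) ->
  ((poisson_int Phi (r * cos s, r * sin s) `^ p)%:E <=
   \int[mu]_(t in `[0%R, (2 * pi)%R])
     (schur_const p * ((1 - r ^+ 2) `^ (p^-1 - 1) * pk (r * cos s, r * sin s) t * (`|sin (t - s)| `^ (1 - p^-1) * Phi t `^ p)))%:E)%E.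
Proof.
move=> p1 s02 r1 mPhi Phi0 iPhi; set q := (r * cos s, _); set k := schur_const p.
have p0 : 0 < p by exact: lt_trans p1.
set c := p^-1.
have c0 : 0 < c by rewrite invr_gt0.
have c1 : c < 1 by rewrite invf_lt1.
have tp := @pi2_gt0 R.
have q1 : nsq q < 1 by exact: nsq_polar_lt1.
have r21 : 0 < 1 - r ^+ 2 by rewrite -(nsq_polar r s) subr_gt0.
set I := `[0, 2 * pi]%classic in iPhi *.
have mI : measurable (I : set (measurableTypeR R)) by exact: measurable_itv.
have k1 : 0 < cos (c * (pi / 2)) :> R by rewrite cos_pi2M_gt0// gtr0_norm.
have mpk : measurable_fun setT (pk q) by apply: continuous_measurable_fun; exact: continuous_pk2.
have msin a : measurable_fun setT (fun t : R => `|sin (t - s)| `^ a).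
  apply: (measurableT_comp (measurable_powR a)); apply: measurableT_comp => //.
  apply: continuous_measurable_fun => t.
  have c2 : {for t, continuous (fun t : R => t)} by exact: cvg_id.
  exact: (cont_comp (@continuous_sin R _) (contD c2 (contC (- s) t))).
have mPp : measurable_fun setT (fun t => Phi t `^ p) by exact: (measurableT_comp (measurable_powR p)).
pose y t := pk q t * (`|sin (t - s)| `^ (1 - c) * Phi t `^ p).
have y0 t : 0 <= y t by rewrite mulr_ge0 ?pk_ge0// mulr_ge0// powR_ge0.
have my : measurable_fun setT (fun t => (y t)%:E).
  by apply/measurable_EFinP; apply: measurable_funM => //; exact: measurable_funM.
pose v t := pk q t * `|sin (t - s)| `^ (- c).
have v0 t : 0 <= v t by rewrite mulr_ge0 ?pk_ge0// powR_ge0.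
have mv : measurable_fun setT (fun t => (v t)%:E).
  by apply/measurable_EFinP; exact: measurable_funM.
have kr0 : 0 < (1 - r ^+ 2) `^ (c - 1) by rewrite powR_gt0.
have A0 : 0 < 2 `^ c / cos (c * (pi / 2)) by rewrite divr_gt0// powR_gt0.
have k0 : 0 < k by rewrite /k /schur_const divr_gt0// powR_gt0.
have -> : (\int[mu]_(t in I) (k * ((1 - r ^+ 2) `^ (c - 1) * pk q t * (`|sin (t - s)| `^ (1 - c) * Phi t `^ p)))%:E =
    (k * (1 - r ^+ 2) `^ (c - 1))%:E * \int[mu]_(t in I) (y t)%:E)%E.
  rewrite -ge0_integralZl_EFin//.
  - by apply: eq_integral => t _; rewrite -EFinM; congr EFin; rewrite /y; ring.
  - by move=> t _; rewrite lee_fin.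
  - exact: measurable_funTS.
  - by rewrite mulr_ge0// ltW.
set Y := (\int[mu]_(t in I) (y t)%:E)%E.
have Y0 : (0 <= Y)%E by apply: integral_ge0 => t _; rewrite lee_fin.
have kk0 : 0 < k * (1 - r ^+ 2) `^ (c - 1) by exact: mulr_gt0.
have [Yoo|] := eqVneq Y +oo%E; first by rewrite Yoo mulry gtr0_sg// mul1e leey.
rewrite -ltey => Yoo.
have Yfin : Y \is a fin_num by rewrite ge0_fin_numE.
set X := poisson_int Phi q.
have bm : bounded_measurable I (pk q : measurableTypeR R -> R).
  split; first exact: measurable_funTS.
  have [C C0 HC] := continuous_itv_bounded 0 (2 * pi) (continuous_pk2 q q1).
  by exists C => t It; apply: HC.
have iX := bounded_measurable_integrable mI bm iPhi.
have X0 : 0 <= X.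
  by rewrite /X /poisson_int mulr_ge0 ?invr_ge0 ?(ltW tp)// Rintegral_ge0// => t _; rewrite mulr_ge0// pk_ge0.
pose H := 2 `^ c / cos (c * (pi / 2)) * (1 - r ^+ 2) `^ (- c).
have H0 : 0 < H by rewrite mulr_gt0// powR_gt0.
have intv : (\int[mu]_(t in I) (v t)%:E <= (2 * pi * H)%:E)%E.
  have := @integral_pk_sin_powRN R c r s; rewrite c0 c1 => /(_ isT r1)/le_trans; apply.
  by rewrite lee_fin le_eqVlt; apply/orP; left; apply/eqP; rewrite /H; ring.
have [F finF sinF] := sin_eq0_finite s02.
(* Young's inequality integrated against the kernel; [lam] stays free until both integrals are
   known. *)
have main lam : 0 < lam -> 2 * pi * X <= lam `^ (1 - p) / p * fine Y + (1 - c) * lam * (2 * pi * H).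
  move=> l0; rewrite -lee_fin EFinD [X in (_ <= X + _)%E]EFinM fineK//.
  have a0 : 0 <= lam `^ (1 - p) / p by rewrite divr_ge0 ?powR_ge0// ltW.
  have b0 : 0 <= (1 - c) * lam by rewrite mulr_ge0 ?subr_ge0// ltW.
  have -> : 2 * pi * X = \int[mu]_(t in I) (pk q t * Phi t).
    by rewrite /X /poisson_int mulVKf// gt_eqF.
  rewrite EFin_Rintegral//.
  apply: (@le_trans _ _ (\int[mu]_(t in I) ((lam `^ (1 - p) / p)%:E * (y t)%:E + ((1 - c) * lam)%:E * (v t)%:E))%E).
    apply: ae_ge0_le_integral => //.
    - by move=> t _; rewrite lee_fin mulr_ge0// pk_ge0.
    - by apply: measurable_funTS; apply/measurable_EFinP; exact: measurable_funM.
    - by move=> t _; rewrite adde_ge0// mule_ge0// lee_fin.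
    - by apply: measurable_funTS; apply: emeasurable_funD; exact: measurable_funeM.
    exists F; split.
    - apply: countable_measurable; last exact: finite_set_countable.
      by move=> t; exact: measurable_set1.
    - by apply: countable_lebesgue_measure0; exact: finite_set_countable.
    move=> t /= /not_implyP[It]; apply: contra_notP => nFt.
    have st : sin (t - s) != 0 by apply: sinF => //; move: It; rewrite /I/= in_itv.
    have S0 : 0 < `|sin (t - s)| by rewrite normr_gt0.
    rewrite -!EFinM -EFinD lee_fin /y /v.
    have -> : lam `^ (1 - p) / p * (pk q t * (`|sin (t - s)| `^ (1 - c) * Phi t `^ p)) +
       (1 - c) * lam * (pk q t * `|sin (t - s)| `^ (- c)) =
       pk q t * (`|sin (t - s)| `^ (- c) * (lam `^ (1 - p) / p * (`|sin (t - s)| * Phi t `^ p) + (1 - c) * lam)).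
      have -> : `|sin (t - s)| `^ (1 - c) = `|sin (t - s)| `^ (- c) * `|sin (t - s)|.
        rewrite -[X in _ * X]powRr1// -powRD; first by congr (_ `^ _); ring.
        by apply/implyP => _; rewrite gt_eqF.
      by ring.
    apply: ler_wpM2l; first exact: pk_ge0.
    (* Applied to [|sin|^c Phi], whose [p]-th power is [|sin| Phi^p] because [c p = 1]; multiplying
       by [|sin|^(- c)] produces the two weights. *)
    have := young_powR p1 l0 (mulr_ge0 (powR_ge0 `|sin (t - s)| c) (Phi0 t)).
    rewrite powRM ?powR_ge0// -powRrM mulVf ?gt_eqF// powRr1// => Yg.
    have := ler_wpM2l (powR_ge0 `|sin (t - s)| (- c)) Yg.
    rewrite mulrA -powRD; last by apply/implyP => _; rewrite gt_eqF.
    by rewrite addNr powRr0 mul1r.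
  rewrite ge0_integralD//; last 4 first.
  - by move=> t _; rewrite mule_ge0// lee_fin.
  - by apply: measurable_funTS; exact: measurable_funeM.
  - by move=> t _; rewrite mule_ge0// lee_fin.
  - by apply: measurable_funTS; exact: measurable_funeM.
  rewrite !ge0_integralZl_EFin//; last 4 first.
  - by move=> t _; rewrite lee_fin.
  - exact: measurable_funTS.
  - by move=> t _; rewrite lee_fin.
  - exact: measurable_funTS.
  by apply: leeD => //; rewrite [leRHS]EFinM; apply: lee_wpmul2l => //; rewrite lee_fin.
rewrite -(fineK Yfin) -EFinM lee_fin.
have fY0 : 0 <= fine Y by exact: fine_ge0.
move: X0; rewrite le_eqVlt => /predU1P[<-|X0].
  by rewrite powR0 ?gt_eqF// mulr_ge0// ltW.
(* For [lam = X / H] the second term is [(1 - c)] times the left side and is absorbed. The parameter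
   has to be positive, hence the separate case [X = 0]. *)
have L0 : 0 < X / H by rewrite divr_gt0.
have := main _ L0.
have -> : (1 - c) * (X / H) * (2 * pi * H) = (1 - c) * (2 * pi * X) by field; rewrite gt_eqF.
move=> M1.
have {}M1 : 2 * pi * X <= (X / H) `^ (1 - p) * fine Y.
  have : c * (2 * pi * X) <= c * ((X / H) `^ (1 - p) * fine Y) by rewrite /c; move: M1; rewrite /c; lra.
  by rewrite ler_pM2l.
have LE : (X / H) `^ (1 - p) * X `^ (p - 1) = H `^ (p - 1).
  have -> : X `^ (p - 1) = (X / H) `^ (p - 1) * H `^ (p - 1).
    by rewrite -powRM ?(ltW H0) ?(ltW L0)// divfK// gt_eqF.
  rewrite mulrA -powRD; last by apply/implyP => _; rewrite gt_eqF.
  by rewrite (_ : 1 - p + (p - 1) = 0) ?powRr0 ?mul1r//; ring.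
have {}M1 := ler_wpM2l (powR_ge0 X (p - 1)) M1.
have XE : X `^ (p - 1) * X = X `^ p.
  by rewrite mulrC mulr_powRB1// ltW.
have {}M1 : 2 * pi * X `^ p <= H `^ (p - 1) * fine Y.
  have -> : 2 * pi * X `^ p = X `^ (p - 1) * (2 * pi * X) by rewrite -XE; ring.
  by apply: le_trans M1 _; rewrite -LE le_eqVlt; apply/orP; left; apply/eqP; ring.
rewrite -(ler_pM2l tp); apply: le_trans M1 _.
rewrite le_eqVlt; apply/orP; left; apply/eqP.
have -> : H `^ (p - 1) = (2 `^ c / cos (c * (pi / 2))) `^ (p - 1) * (1 - r ^+ 2) `^ (c - 1).
  rewrite /H powRM ?powR_ge0 ?(ltW A0)// -powRrM; congr (_ * _ `^ _).
  by rewrite /c; field; rewrite gt_eqF.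
by rewrite /k /schur_const -/c; move: (2 * pi) tp => T0 T0_gt0; field; rewrite gt_eqF.
Qed.

End schur_test.

Section schur_integrated.
Context {R : realType}.
Notation mu := (@lebesgue_measure R).

Lemma den_polar_cos (r s t : R) :
  den (r * cos s, r * sin s) t = 1 - 2 * r * cos (t - s) + r ^+ 2.
Proof.
rewrite /den/= cosB.
have -> : (cos t - r * cos s) ^+ 2 + (sin t - r * sin s) ^+ 2 =
  (cos t ^+ 2 + sin t ^+ 2) - 2 * r * (cos t * cos s + sin t * sin s) + r ^+ 2 * (cos s ^+ 2 + sin s ^+ 2) by ring.
by rewrite !cos2Dsin2 mulr1.
Qed.

Variables (p s : R) (Phi : R -> R).
Hypotheses (p1 : 1 < p) (mPhi : measurable_fun setT Phi) (Phi0 : forall t, 0 <= Phi t).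

Let p0 : 0 < p. Proof. exact: lt_trans p1. Qed.
Let c := p^-1.
Let c0 : 0 < c. Proof. by rewrite invr_gt0. Qed.
Let c1 : c < 1. Proof. by rewrite invf_lt1. Qed.
Let kap : R := cos (c * (pi / 2)).
Let kap0 : 0 < kap. Proof. by rewrite cos_pi2M_gt0// gtr0_norm. Qed.

Let w (t : R) : R := `|sin (t - s)| `^ (1 - c) * Phi t `^ p.
(** For [|r| < 1] this is [(1 - r^2)^(c - 1)] times the Poisson kernel. The absolute value and the
    power [-1] give an expression whose measurability in both variables follows from that of [powR];
    the indicators in [K] then allow Tonelli's theorem on the whole plane. *)
Let a (r t : R) : R := `|1 - r ^+ 2| `^ c * den (r * cos s, r * sin s) t `^ (-1).
Let I := `[0, 2 * pi]%classic : set R.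
Let U := `]-1, 1[%classic : set R.

Let K (z : measurableTypeR R * measurableTypeR R) : \bar R :=
  (schur_const p * (a z.1 z.2 * w z.2) * \1_U z.1 * \1_I z.2)%:E.

Let k0 : 0 <= schur_const p.
Proof. by rewrite divr_ge0 ?powR_ge0// ltW// pi2_gt0. Qed.

Let a0 r t : 0 <= a r t. Proof. by rewrite mulr_ge0// powR_ge0. Qed.

Let w0 t : 0 <= w t. Proof. by rewrite mulr_ge0// powR_ge0. Qed.

Let K0 z : (0 <= K z)%E.
Proof.
by rewrite /K lee_fin; apply: mulr_ge0 => //; apply: mulr_ge0 => //; rewrite mulr_ge0// mulr_ge0.
Qed.

Let mw : measurable_fun setT w.
Proof.
apply: measurable_funM.
  apply: (measurableT_comp (measurable_powR (1 - c))); apply: measurableT_comp => //.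
  apply: continuous_measurable_fun => t.
  have c2 : {for t, continuous (fun t : R => t)} by exact: cvg_id.
  exact: (cont_comp (@continuous_sin R _) (contD c2 (contC (- s) t))).
exact: (measurableT_comp (measurable_powR p)).
Qed.

Let mK : measurable_fun setT K.
Proof.
have m1 : measurable_fun setT (fst : measurableTypeR R * measurableTypeR R -> measurableTypeR R).
  exact: measurable_fst.
have m2 : measurable_fun setT (snd : measurableTypeR R * measurableTypeR R -> measurableTypeR R).
  exact: measurable_snd.
have cm (f : R -> R) : continuous f -> measurable_fun setT f by exact: continuous_measurable_fun.
have m3 : measurable_fun setT (fun z : measurableTypeR R * measurableTypeR R => den (z.1 * cos s, z.1 * sin s) z.2).
  apply: measurable_funD; apply: measurable_funX; apply: measurable_funB.
  - exact: (measurableT_comp (cm _ (@continuous_cos R)) m2).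
  - exact: measurable_funM.
  - exact: (measurableT_comp (cm _ (@continuous_sin R)) m2).
  - exact: measurable_funM.
apply/measurable_EFinP; apply: measurable_funM; last first.
  by apply: (measurableT_comp _ m2); apply: measurable_indic; exact: measurable_itv.
apply: measurable_funM; last first.
  by apply: (measurableT_comp _ m1); apply: measurable_indic; exact: measurable_itv.
apply: measurable_funM => //; apply: measurable_funM; last exact: (measurableT_comp mw m2).
apply: measurable_funM.
  apply: (measurableT_comp (measurable_powR c)); apply: measurableT_comp => //.
  by apply: measurable_funB => //; apply: measurable_funX.
exact: (measurableT_comp (measurable_powR (-1)) m3).
Qed.

Let F (r : R) : \bar R := (\int[mu]_t K (r, t))%E.

Let FE r : -1 < r < 1 -> F r = (\int[mu]_(t in I)
  (schur_const p * ((1 - r ^+ 2) `^ (c - 1) * pk (r * cos s, r * sin s) t * w t))%:E)%E.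
Proof.
move=> r1; rewrite /F [RHS]integral_mkcond; apply: eq_integral => t _.
have r21 : 0 < 1 - r ^+ 2 by rewrite -(nsq_polar r s) subr_gt0 nsq_polar_lt1.
rewrite /K /= patchE !indicE; have -> : r \in U by rewrite inE /U/= in_itv.
rewrite mulr1; case: (t \in I) => /=; last by rewrite mulr0.
rewrite mulr1; congr (_ * (_ * _))%:E.
rewrite /a gtr0_norm// powR_inv1; last by rewrite ltW// den_gt0// nsq_polar_lt1.
rewrite /pk nsq_polar mulrA; congr (_ * _).
have {1}-> : c = (c - 1) + 1 by ring.
rewrite powRD; last by apply/implyP => _; rewrite gt_eqF.
by rewrite powRr1// ltW.
Qed.

(** The weight [|sin|^(1 - c)] cancels the factor [|sin|^(c - 1)] of the radial estimate, so the
    coefficient of [Phi t^p] does not depend on [t]. *)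
Let G t : (\int[mu]_r K (r, t) <= (1 / (2 * kap `^ p) * Phi t `^ p * \1_I t)%:E)%E.
Proof.
pose C := schur_const p * w t * \1_I t.
have C0 : 0 <= C by apply: mulr_ge0 => //; exact: mulr_ge0.
have mA : measurable_fun setT (fun r => a r t).
  apply: measurable_funM.
    apply: (measurableT_comp (measurable_powR c)); apply: measurableT_comp => //.
    by apply: measurable_funB => //; exact: measurable_funX.
  apply: (measurableT_comp (measurable_powR (-1))).
  by apply: measurable_funD; apply: measurable_funX; apply: measurable_funB => //; exact: measurable_funM.
have mU : measurable U by exact: measurable_itv.
have -> : (\int[mu]_r K (r, t) = C%:E * \int[mu]_(r in U) (a r t)%:E)%E.
  rewrite -ge0_integralZl_EFin//; last 2 first.
  - by move=> r _; rewrite lee_fin.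
  - by apply: measurable_funTS; exact/measurable_EFinP.
  rewrite [RHS]integral_mkcond; apply: eq_integral => r _.
  rewrite /K/= patchE !indicE; case: (r \in U) => /=; last by rewrite mulr0 mul0r.
  by rewrite -EFinM; congr EFin; rewrite /C indicE; ring.
have [st|st] := eqVneq (sin (t - s)) 0.
  have -> : C = 0 by rewrite /C /w st normr0 powR0 ?subr_eq0 ?gt_eqF// ?mul0r ?mulr0 ?mul0r.
  by rewrite mul0e lee_fin !mulr_ge0 ?powR_ge0 ?invr_ge0 ?mulr_ge0 ?powR_ge0// indicE.
set S := `|sin (t - s)|.
have S0 : 0 < S by rewrite normr_gt0.
have D0 r : 0 < 1 - 2 * r * cos (t - s) + r ^+ 2.
  have -> : 1 - 2 * r * cos (t - s) + r ^+ 2 = (r - cos (t - s)) ^+ 2 + sin (t - s) ^+ 2.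
    by have := cos2Dsin2 (t - s); lra.
  by rewrite ltr_wpDl ?sqr_ge0// exprn_even_gt0.
have aE r : a r t = `|1 - r ^+ 2| `^ c / (1 - 2 * r * cos (t - s) + r ^+ 2).
  by rewrite /a den_polar_cos powR_inv1// ltW.
have ca : continuous (fun r : R => `|1 - r ^+ 2| `^ c / (1 - 2 * r * cos (t - s) + r ^+ 2)).
  move=> r; have cid : {for r, continuous (fun r : R => r)} by exact: cvg_id.
  have c_1 : {for r, continuous (fun r : R => `|1 - r ^+ 2| `^ c)}.
    apply: (@cont_comp _ _ (fun x : R => `|x| `^ c) (fun r : R => 1 - r ^+ 2)).
      exact: continuous_norm_powR.
    exact: (contD (contC 1 r) (contN (contX cid))).
  have c_2 : {for r, continuous (fun r : R => 1 - 2 * r * cos (t - s) + r ^+ 2)}.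
    exact: (contD (contD (contC 1 r) (contN (contM (contM (contC 2 r) cid) (contC (cos (t - s)) r))))
      (contX cid)).
  by apply: (contM c_1 (contV _ c_2)); rewrite gt_eqF.
have Ja : (\int[mu]_(r in U) (a r t)%:E <= (pi / (2 * S) * (2 * S) `^ c / kap)%:E)%E.
  apply: (@le_trans _ _ (\int[mu]_(r in `[(-1)%R, 1%R]) (a r t)%:E)%E).
    apply: ge0_subset_integral => //.
    - by apply: measurable_funTS; exact/measurable_EFinP.
    - by move=> r _; rewrite lee_fin.
    - by move=> r; rewrite /U/= !in_itv/= => /andP[? ?]; rewrite !ltW.
  have -> : (\int[mu]_(r in `[(-1)%R, 1%R]) (a r t)%:E =
     \int[mu]_(r in `[(-1)%R, 1%R]) (`|1 - r ^+ 2| `^ c / (1 - 2 * r * cos (t - s) + r ^+ 2))%:E)%E.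
    by apply: eq_integral => r _; rewrite aE.
  rewrite -EFin_Rintegral//; last exact: continuous_itv_integrable.
  by rewrite lee_fin; apply: integral_poisson_weight_radial => //; rewrite c0.
apply: le_trans (lee_wpmul2l _ Ja) _; first by rewrite lee_fin.
rewrite -EFinM lee_fin le_eqVlt; apply/orP; left; apply/eqP.
have pi0 := pi_gt0 R.
have E1 : S `^ (1 - c) * S `^ c = S.
  rewrite -powRD; last by apply/implyP => _; rewrite gt_eqF.
  by rewrite subrK powRr1// ltW.
have B0 : 0 < 2 `^ c / kap by rewrite divr_gt0// powR_gt0.
have kp0 : 0 < kap `^ p by rewrite powR_gt0.
(* The powers [p - 1] and 1 of [2^c / kap] combine into its [p]-th power [2 / kap^p]. *)
have E2 : schur_const p * (2 `^ c / kap) = 1 / (pi * kap `^ p).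
  rewrite /schur_const -/c -/kap mulrAC.
  have -> : (2 `^ c / kap) `^ (p - 1) * (2 `^ c / kap) = (2 `^ c / kap) `^ p.
    by rewrite mulrC mulr_powRB1// ltW.
  rewrite powRM ?powR_ge0 ?invr_ge0 ?(ltW kap0)// -powRrM mulVf ?gt_eqF// powRr1//.
  have -> : kap^-1 `^ p = (kap `^ p)^-1 by rewrite -powR_inv1 ?(ltW kap0)// -powRrM mulN1r powRN.
  by move: (kap `^ p) kp0 (pi : R) pi0 => x x0 y y0; field; rewrite !gt_eqF.
rewrite /C /w -/S powRM ?(ltW S0)//.
have -> : schur_const p * (S `^ (1 - c) * Phi t `^ p) * \1_I t * (pi / (2 * S) * (2 `^ c * S `^ c) / kap) =
  (schur_const p * (2 `^ c / kap)) * (S `^ (1 - c) * S `^ c) * (pi / (2 * S)) * Phi t `^ p * \1_I t.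
  by field; rewrite !gt_eqF.
rewrite E1 E2; move: (kap `^ p) kp0 (pi : R) pi0 => x x0 y y0.
by field; rewrite !gt_eqF.
Qed.

(** Exposing a measurable majorant [F] reduces the later comparison with [f] on the diameter to a
    pointwise one. *)
Theorem poisson_schur : 0 <= s <= 2 * pi -> mu.-integrable I (EFin \o Phi) ->
  exists F : R -> \bar R, [/\ measurable_fun setT F,
   forall r, -1 < r < 1 -> ((poisson_int Phi (r * cos s, r * sin s) `^ p)%:E <= F r)%E &
   (\int[mu]_(r in `](-1)%R, 1%R[) F r <= (1 / (2 * cos (pi / (2 * p)) `^ p))%:E *
     \int[mu]_(t in I) (Phi t `^ p)%:E)%E].
Proof.
move=> s02 iPhi.
have mF : @measurable_fun _ _ (measurableTypeR R) _ setT F.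
  exact: (@measurable_fun_fubini_tonelli_F _ _ _ _ _ mu K mK K0).
exists F; split.
- exact: mF.
- by move=> r r1; rewrite FE//; exact: poisson_schur_pointwise.
have -> : cos (pi / (2 * p)) = kap by congr cos; rewrite /c; field; rewrite gt_eqF.
have F0 r : (0 <= F r)%E by apply: integral_ge0.
have mI : measurable I by exact: measurable_itv.
apply: (@le_trans _ _ (\int[mu]_r F r)%E).
  by apply: ge0_subset_integral => //; exact: measurable_itv.
rewrite /F (@fubini_tonelli _ _ _ _ _ mu mu K mK K0).
have A0 : 0 <= 1 / (2 * kap `^ p) by rewrite divr_ge0// mulr_ge0// powR_ge0.
have mPp : measurable_fun setT (fun t => Phi t `^ p) by exact: (measurableT_comp (measurable_powR p)).
rewrite -ge0_integralZl_EFin//; last 2 first.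
- by move=> t _; rewrite lee_fin powR_ge0.
- by apply: measurable_funTS; exact/measurable_EFinP.
rewrite [leRHS]integral_mkcond; apply: ge0_le_integral => //.
- by move=> t _; apply: integral_ge0.
- exact: (@measurable_fun_fubini_tonelli_G _ _ _ _ _ mu K mK K0).
- apply/(measurable_restrictT _ _).1 => //; apply: measurable_funeM.
  by apply: measurable_funTS; exact/measurable_EFinP.
- move=> t _; apply: le_trans (G t) _; rewrite patchE indicE; case: (t \in I) => /=.
    by rewrite mulr1 EFinM.
  by rewrite mulr0.
Qed.

End schur_integrated.

(** * Complex values and the conclusion *)

Section complex_values.
Context {R : realType}.
Notation mu := (@lebesgue_measure R).

Lemma unit_diskE (x y : R) : unit_disk (x +i* y) <-> nsq (x, y) < 1.
Proof.
rewrite /unit_disk/= normc_def ltcR /nsq/=.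
rewrite -[X in _ < X]sqrtr1 ltr_sqrt//; exact: ltr01.
Qed.

Lemma circle_point (r t : R) : r%:C * expi t = (r * cos t) +i* (r * sin t).
Proof. by apply/eqP; rewrite eq_complex /= !mul0r subr0 addr0 !eqxx. Qed.

Lemma normcE (z : R[i]) : Normc.normc z = Num.sqrt (complex.Re z ^+ 2 + complex.Im z ^+ 2).
Proof. by case: z. Qed.

Lemma normc_le_add (z : R[i]) : Normc.normc z <= `|complex.Re z| + `|complex.Im z|.
Proof.
rewrite normcE -[leRHS]ger0_norm ?addr_ge0// -sqrtr_sqr ler_wsqrtr//.
rewrite -(real_normK (num_real (complex.Re z))) -(real_normK (num_real (complex.Im z))).
have := mulr_ge0 (normr_ge0 (complex.Re z)) (normr_ge0 (complex.Im z)).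
by rewrite sqrrD; lra.
Qed.

Lemma norm_le_sqrtDl (x y : R) : `|x| <= Num.sqrt (x ^+ 2 + y ^+ 2).
Proof. by rewrite -sqrtr_sqr ler_wsqrtr// lerDl sqr_ge0. Qed.

Lemma norm_le_sqrtDr (x y : R) : `|y| <= Num.sqrt (x ^+ 2 + y ^+ 2).
Proof. by rewrite -sqrtr_sqr ler_wsqrtr// lerDr sqr_ge0. Qed.

Lemma cvg_complex (T : Type) (F : set_system T) {FF : ProperFilter F} (f : T -> R[i]) (a b : R) :
  complex.Re (f x) @[x --> F] --> a -> complex.Im (f x) @[x --> F] --> b ->
  (f x : R[i]^o) @[x --> F] --> (a +i* b : R[i]^o).
Proof.
move=> /cvgrPdist_lt fa /cvgrPdist_lt fb; apply/cvgrPdist_lt => e e0.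
(* In the order on [R[i]], a positive [e] is real. *)
have : 0 < complex.Re e /\ complex.Im e = 0.
  by case: e e0 => x y; rewrite ltcE/= => /andP[/eqP -> ->].
move=> [re0 im0].
have e2 : 0 < complex.Re e / 2 by rewrite divr_gt0.
near=> x.
have h1 : `|a - complex.Re (f x)| < complex.Re e / 2 by near: x; exact: fa.
have h2 : `|b - complex.Im (f x)| < complex.Re e / 2 by near: x; exact: fb.
have -> : e = (complex.Re e)%:C by case: (e) im0 => ? ? /= ->.
have := normc_le_add (a +i* b - f x).
case: (f x) h1 h2 => fr fi /= h1 h2 H.
rewrite normc_def ltcR/=; apply: le_lt_trans H _.
by rewrite (splitr (complex.Re e)) ltrD.
Unshelve. all: by end_near. Qed.

End complex_values.

Section le_integral.
Context d {T : measurableType d} {R : realType} (mu : {measure set T -> \bar R}).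

(* The radial limit function need not be Borel measurable. *)
Lemma ge0_le_integral_nonmeasurable (f g : T -> \bar R) :
  (forall x, 0 <= f x)%E -> (forall x, f x <= g x)%E ->
  (\int[mu]_x f x <= \int[mu]_x g x)%E.
Proof.
move=> f0 fg; have g0 x : (0 <= g x)%E by exact: le_trans (fg x).
rewrite !ge0_integralTE//; apply: ereal_sup_le => _ [h hf <-]; exists h => // x.
exact: le_trans (fg x).
Qed.

End le_integral.

Section hardy_harmonic.
Context {R : realType}.
Notation mu := (@lebesgue_measure R).
Notation I := (`[0, 2 * pi]%classic : set R).
Implicit Types (f : R[i] -> R[i]) (p s : R).

Lemma hardy_mean_bound p f : 1 < p -> hardy_harmonic p f ->
  exists M : R, forall r : R, 0 < r < 1 ->
  (\int[mu]_(t in I) (Normc.normc (f ((r * cos t)%R +i* (r * sin t)%R)) `^ p)%:E <= M%:E)%E.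
Proof.
move=> p1 [_ [M fM]]; have p0 : 0 < p by exact: lt_trans p1.
exists (2 * pi * M `^ p) => r /fM; rewrite /integral_mean.
have -> : (\int[lebesgue_measure]_(t in `[0%R, (2 * pi)%R]) (Normc.normc (f (r%:C * expi t)) `^ p)%:E =
  \int[mu]_(t in I) (Normc.normc (f ((r * cos t)%R +i* (r * sin t)%R)) `^ p)%:E)%E.
  by apply: eq_integral => t _; rewrite circle_point.
set X := (\int[mu]_(t in I) _)%E => HM.
have X0 : (0 <= X)%E by apply: integral_ge0 => t _; rewrite lee_fin powR_ge0.
have tp := @pi2_gt0 R.
have Y0 : (0 <= ((2 * pi)^-1)%:E * X)%E by rewrite mule_ge0// lee_fin invr_ge0 ltW.
have M0 : 0 <= M by rewrite -lee_fin; apply: le_trans HM; exact: poweR_ge0.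
have := @gt0_ler_poweR R p (ltW p0) _ _ _ _ HM.
rewrite !in_itv/= !leey !andbT poweR_ge0 lee_fin => /(_ isT M0) /=.
rewrite -poweRrM mulVf ?gt_eqF// poweRe1// lee_pdivrMl// EFinM; exact.
Qed.

Lemma hardy_boundary_function p f : 1 < p -> hardy_harmonic p f ->
  exists phi1 phi2 : R -> R,
  [/\ measurable_fun setT phi1 /\ measurable_fun setT phi2,
      mu.-integrable I (EFin \o phi1) /\ mu.-integrable I (EFin \o phi2),
      forall x y, nsq (x, y) < 1 ->
        f (x +i* y) = poisson_int phi1 (x, y) +i* poisson_int phi2 (x, y) &
      exists N : set R, [/\ measurable (N : set (measurableTypeR R)), mu N = 0%E &
        forall t, I t -> ~ N t -> radial_limit f t = phi1 t +i* phi2 t]].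
Proof.
move=> p1 hf; have [M fM] := hardy_mean_bound p1 hf.
have p0 : 0 < p by exact: lt_trans p1.
have DE : [set q : R * R | unit_disk (q.1 +i* q.2)] = [set q | nsq q < 1].
  by apply/seteqP; split => -[x y] /= /unit_diskE.
pose u (q : R * R) := complex.Re (f (q.1 +i* q.2)).
pose v (q : R * R) := complex.Im (f (q.1 +i* q.2)).
have [hu hv] : real_harmonic [set q | nsq q < 1] u /\ real_harmonic [set q | nsq q < 1] v.
  by case: hf => -[]; rewrite DE.
have cu q : nsq q < 1 -> {for q, continuous u} by move=> /hu.1[].
have cv q : nsq q < 1 -> {for q, continuous v} by move=> /hv.1[].
have rc (r : R) : 0 < r < 1 -> continuous (fun t => (r * cos t, r * sin t)).
  move=> _ t; exact: (cont_pair (contM (contC r t) (@continuous_cos R t))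
    (contM (contC r t) (@continuous_sin R t))).
have r1 (r t : R) : 0 < r < 1 -> nsq (r * cos t, r * sin t) < 1.
  by move=> /andP[? ?]; apply: nsq_polar_lt1; apply/andP; split; lra.
have part (w : R * R -> R) : (forall q, nsq q < 1 -> {for q, continuous w}) ->
    (forall x y, `|w (x, y)| <= Normc.normc (f (x +i* y))) ->
    forall r : R, 0 < r < 1 ->
    (\int[mu]_(t in I) (`|w ((r * cos t)%R, (r * sin t)%R)| `^ p)%:E <= M%:E)%E.
  move=> cw wf r r01; apply: le_trans (fM r r01).
  have cc (g : R * R -> R) : (forall q, nsq q < 1 -> {for q, continuous g}) ->
      continuous (fun t : R => g (r * cos t, r * sin t)).
    by move=> cg t; apply: (@continuous_comp _ _ _ (fun t => (r * cos t, r * sin t)) g t (rc r r01 t)); apply: cg; exact: r1.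
  apply: ge0_le_integral => //.
  - apply/measurable_EFinP; apply: measurable_funTS; apply: (measurableT_comp (measurable_powR p)).
    by apply: measurableT_comp => //; apply: continuous_measurable_fun; exact: cc.
  - apply/measurable_EFinP; apply: measurable_funTS; apply: (measurableT_comp (measurable_powR p)).
    have -> : (fun t => Normc.normc (f ((r * cos t) +i* (r * sin t)))) =
        (fun t => Num.sqrt (u (r * cos t, r * sin t) ^+ 2 + v (r * cos t, r * sin t) ^+ 2)).
      by apply/funext => t; rewrite normcE.
    apply: measurableT_comp; first by apply: continuous_measurable_fun; exact: sqrt_continuous.
    by apply: measurable_funD; apply: measurable_funX; apply: continuous_measurable_fun; exact: cc.
  - move=> t _; rewrite lee_fin; apply: ge0_ler_powR; rewrite ?nnegrE ?(ltW p0)//.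
    by rewrite normcE sqrtr_ge0.
have [phi1 [mphi1 iphi1 uphi1]] := real_hardy_poisson p1 hu
  (part u cu (fun x y => ltac:(rewrite normcE; exact: norm_le_sqrtDl))).
have [phi2 [mphi2 iphi2 vphi2]] := real_hardy_poisson p1 hv
  (part v cv (fun x y => ltac:(rewrite normcE; exact: norm_le_sqrtDr))).
exists phi1, phi2; split => //.
  move=> x y xy; rewrite -uphi1// -vphi2// /u /v/=.
  by case: (f _).
have mI : measurable I by exact: measurable_itv.
have [N1 [mN1 N10 HN1]] := lebesgue_differentiation (integrable_locally_restrict mI iphi1).
have [N2 [mN2 N20 HN2]] := lebesgue_differentiation (integrable_locally_restrict mI iphi2).
have fin : finite_set [set` [:: 0; 2 * pi : R]] by exact: finite_seq.
have mF : measurable ([set` [:: 0; 2 * pi : R]] : set (measurableTypeR R)).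
  by apply: countable_measurable; [move=> t; exact: measurable_set1|exact: finite_set_countable].
(* The endpoints 0 and [2 pi] join the non-Lebesgue points of both densities, as
   [poisson_radial_limit] concerns interior points. *)
exists (N1 `|` N2 `|` [set` [:: 0; 2 * pi : R]]); split.
- by apply: measurableU => //; exact: measurableU.
- have NF : mu [set` [:: 0; 2 * pi : R]] = 0%E.
    by apply: countable_lebesgue_measure0; exact: finite_set_countable.
  by rewrite (null_set_setU _ _ _ NF)//; [exact: measurableU|rewrite (null_set_setU _ _ _ N20)].
move=> t It nN.
have nN1 : ~ N1 t by move=> h; apply: nN; left; left.
have nN2 : ~ N2 t by move=> h; apply: nN; left; right.
have t02 : 0 < t < 2 * pi.
  move: It; rewrite /= in_itv/= !le_eqVlt => /andP[/predU1P[t0|->] /predU1P[t2|->]] //.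
  - by exfalso; apply: nN; right; rewrite /= !inE -t0 eqxx.
  - by exfalso; apply: nN; right; rewrite /= !inE -t0 eqxx.
  - by exfalso; apply: nN; right; rewrite /= !inE t2 eqxx orbT.
have lp1 : lebesgue_pt (phi1 \_ I) t by apply: contrapT => h; exact: nN1 (HN1 _ h).
have lp2 : lebesgue_pt (phi2 \_ I) t by apply: contrapT => h; exact: nN2 (HN2 _ h).
have L1 := poisson_radial_limit mphi1 iphi1 t02 lp1.
have L2 := poisson_radial_limit mphi2 iphi2 t02 lp2.
have E (w : R * R -> R) phi : (forall q, nsq q < 1 -> w q = poisson_int phi q) ->
    poisson_int phi (r * cos t, r * sin t) @[r --> (1 : R)^'-] --> phi t ->
    w (r * cos t, r * sin t) @[r --> (1 : R)^'-] --> phi t.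
  move=> wE; apply: cvg_trans; apply: near_eq_cvg; near=> r.
  apply/esym/wE/r1; apply/andP; split.
    by near: r; apply: nbhs_left_gt; exact: ltr01.
  by near: r; exact: nbhs_left_lt.
suff H : (f (r%:C * expi t) : R[i]^o) @[r --> (1 : R)^'-] --> (phi1 t +i* phi2 t : R[i]^o).
  exact: (cvg_lim (@norm_hausdorff _ _) H).
rewrite (_ : (fun r : R => f (r%:C * expi t)) = (fun r => f ((r * cos t) +i* (r * sin t)))); last first.
  by apply/funext => r; rewrite circle_point.
apply: cvg_complex; first exact: E uphi1 L1.
exact: E vphi2 L2.
Unshelve. all: by end_near. Qed.

(** The triangle inequality for a plane-valued integral: the inner product of the integral [(a, b)]
    with itself is moved inside, where Cauchy-Schwarz bounds the integrand by [n] times the kernel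
    times [Phi]; then one divides by [n]. *)
Lemma poisson_int_norm_le (phi1 phi2 : R -> R) q : nsq q < 1 ->
  mu.-integrable I (EFin \o phi1) -> mu.-integrable I (EFin \o phi2) ->
  mu.-integrable I (EFin \o (fun t => Num.sqrt (phi1 t ^+ 2 + phi2 t ^+ 2))) ->
  Num.sqrt (poisson_int phi1 q ^+ 2 + poisson_int phi2 q ^+ 2) <=
  poisson_int (fun t => Num.sqrt (phi1 t ^+ 2 + phi2 t ^+ 2)) q.
Proof.
move=> q1 i1 i2 i3; set a := poisson_int phi1 q; set b := poisson_int phi2 q.
set n := Num.sqrt (a ^+ 2 + b ^+ 2); pose Phi t := Num.sqrt (phi1 t ^+ 2 + phi2 t ^+ 2).
have mI : measurable (I : set (measurableTypeR R)) by exact: measurable_itv.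
have tp := @pi2_gt0 R.
have bm : bounded_measurable I (pk q : measurableTypeR R -> R).
  split; first by apply: measurable_funTS; apply: continuous_measurable_fun; exact: continuous_pk2.
  have [C C0 HC] := continuous_itv_bounded 0 (2 * pi) (continuous_pk2 q q1).
  by exists C => t It; apply: HC.
have j1 := bounded_measurable_integrable mI bm i1.
have j2 := bounded_measurable_integrable mI bm i2.
have j3 := bounded_measurable_integrable mI bm i3.
have Phi0 : 0 <= poisson_int Phi q.
  rewrite /poisson_int mulr_ge0 ?invr_ge0 ?(ltW tp)// Rintegral_ge0// => t _.
  by rewrite mulr_ge0 ?pk_ge0// sqrtr_ge0.
have n0 : 0 <= n by exact: sqrtr_ge0.
have n2 : n ^+ 2 = a ^+ 2 + b ^+ 2 by rewrite sqr_sqrtr// addr_ge0// sqr_ge0.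
have H : n * n <= n * poisson_int Phi q.
  rewrite -expr2 n2.
  have -> : a ^+ 2 + b ^+ 2 = (2 * pi)^-1 * \int[mu]_(t in I) (a * (pk q t * phi1 t) + b * (pk q t * phi2 t)).
    rewrite RintegralD//; [|exact: (integrableZl mI a j1)|exact: (integrableZl mI b j2)].
    by rewrite !RintegralZl// /a /b /poisson_int; ring.
  have -> : n * poisson_int Phi q = (2 * pi)^-1 * \int[mu]_(t in I) (n * (pk q t * Phi t)).
    by rewrite RintegralZl// /poisson_int; ring.
  rewrite ler_pM2l ?invr_gt0//; apply: le_Rintegral => //.
  - exact: (integrableD mI (integrableZl mI a j1) (integrableZl mI b j2)).
  - exact: (integrableZl mI n j3).
  move=> t _.
  have -> : a * (pk q t * phi1 t) + b * (pk q t * phi2 t) = pk q t * (a * phi1 t + b * phi2 t) by ring.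
  rewrite mulrCA; apply: ler_wpM2l; first exact: pk_ge0.
  apply: le_trans (ler_norm _) _.
  rewrite /n /Phi -sqrtrM; last by rewrite addr_ge0// sqr_ge0.
  rewrite -sqrtr_sqr ler_wsqrtr//.
  have : 0 <= (a * phi2 t - b * phi1 t) ^+ 2 by exact: sqr_ge0.
  by lra.
have [n00|n_neq0] := eqVneq n 0; first by rewrite n00.
by rewrite -(@ler_pM2l _ n)// lt0r n_neq0.
Qed.

End hardy_harmonic.

Theorem theorem1p1 (R : realType) (p : R) (f : R[i] -> R[i]) (s : R) :
  1 < p -> hardy_harmonic p f -> s \in `[0, 2 * pi] ->
  (\int[lebesgue_measure]_(r in `](-1)%R, 1%R[)
      (Normc.normc (f (r%:C * expi s)) `^ p)%:E
   <= (1 / (2 * cos (pi / (2 * p)) `^ p))%:E *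
      \int[lebesgue_measure]_(t in `[0%R, (2 * pi)%R])
        (Normc.normc (radial_limit f t) `^ p)%:E)%E.
Proof.
move=> p1 hf; rewrite in_itv/= => s02.
have p0 : 0 < p by exact: lt_trans p1.
have [phi1 [phi2 [[m1 m2] [i1 i2] fphi [N [mN N0 rN]]]]] := hardy_boundary_function p1 hf.
pose I : set R := `[0, 2 * pi]%classic.
have mI : measurable (I : set (measurableTypeR R)) by exact: measurable_itv.
pose Phi t := Num.sqrt (phi1 t ^+ 2 + phi2 t ^+ 2).
have Phi0 t : 0 <= Phi t by exact: sqrtr_ge0.
have mPhi : measurable_fun setT Phi.
  apply: measurableT_comp; first by apply: continuous_measurable_fun; exact: sqrt_continuous.
  by apply: measurable_funD; exact: measurable_funX.
have iPhi : (@lebesgue_measure R).-integrable I (EFin \o Phi).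
  have i12 := integrableD mI (integrable_norm i1) (integrable_norm i2).
  apply: le_integrable i12 => //; first by apply: measurable_funTS; exact/measurable_EFinP.
  move=> t _; rewrite /= lee_fin ger0_norm// ger0_norm ?addr_ge0//.
  exact: (normc_le_add (phi1 t +i* phi2 t)).
have [F [mF FX FPhi]] := poisson_schur p1 mPhi Phi0 s02 iPhi.
have A0 : 0 <= 1 / (2 * cos (pi / (2 * p)) `^ p) by rewrite divr_ge0// mulr_ge0// powR_ge0.
have mU : measurable (`]-1, 1[%classic : set R) by exact: measurable_itv.
apply: (@le_trans _ _ (\int[lebesgue_measure]_(r in `](-1)%R, 1%R[) F r)%E).
  have fF r : -1 < r < 1 -> ((Normc.normc (f (r%:C * expi s)) `^ p)%:E <= F r)%E.
    move=> r1; apply: le_trans (FX r r1); rewrite lee_fin circle_point.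
    have q1 := nsq_polar_lt1 s r1.
    apply: ge0_ler_powR; rewrite ?nnegrE ?(ltW p0)//; first by rewrite normcE sqrtr_ge0.
      by apply: le_trans (poisson_int_norm_le q1 i1 i2 iPhi); exact: sqrtr_ge0.
    by rewrite fphi//; exact: poisson_int_norm_le.
  rewrite integral_mkcond [leRHS]integral_mkcond; apply: ge0_le_integral_nonmeasurable => r.
    by rewrite patchE; case: ifP => // _; rewrite lee_fin powR_ge0.
  by rewrite !patchE; case: ifPn => //; rewrite inE/= in_itv/= => /fF.
apply: le_trans FPhi _; apply: lee_wpmul2l; first by rewrite lee_fin.
(* On [N] nothing is known of [radial_limit], so [N] is removed on the side of [Phi] only. The
   integral over [I] minus [N] is then at most the one over [I] of the nonnegative boundary term,
   whatever its values on [N]. *)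
have -> : (\int[lebesgue_measure]_(t in I) (Phi t `^ p)%:E =
    \int[lebesgue_measure]_(t in I `\` N) (Phi t `^ p)%:E)%E.
  apply: ge0_negligible_integral => //; last by move=> t _; rewrite lee_fin powR_ge0.
  apply: measurable_funTS; apply/measurable_EFinP.
  exact: (measurableT_comp (measurable_powR p)).
rewrite integral_mkcond [leRHS]integral_mkcond; apply: ge0_le_integral_nonmeasurable => t.
  by rewrite patchE; case: ifP => // _; rewrite lee_fin powR_ge0.
rewrite !patchE; case: ifPn; last by case: ifP => // _ _; rewrite lee_fin powR_ge0.
by rewrite inE => -[It nNt]; rewrite mem_set// (rN t It nNt) normcE.
Qed.
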